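(* Let $\varphi$ be a $G_2$-structure on a $7$-manifold $M$, with induced metric $g$ and torsion $T$. Let $$\tilde P_1=-\mathrm{Ric}-\tfrac13\mathcal L_{\mathsf VT}g-\tfrac23\bigl(T\circ(\mathsf VT\lrcorner\varphi)\bigr)_{\mathrm{sym}}+\mathrm{tr}\,T\;T_{\mathrm{sym}}+\tfrac13\left(|T|^2-\tfrac13|\mathsf VT|^2\right)g,$$ $$P_2=\tfrac23\,\mathrm{div}\,T+\tfrac13\nabla\mathrm{tr}\,T+\tfrac13\,\mathrm{tr}\,T\;\mathsf VT .$$ Then the operator $\tilde P(\varphi)=\tilde P_1(\varphi)\diamond\varphi+P_2(\varphi)\lrcorner\psi$ satisfies the Bianchi-type identity $\tilde B(\tilde P_1,P_2)=0$, where, for a symmetric $2$-tensor $h$ and a $1$-form $X$, $$\tilde B(h,X)=\mathsf L\left(h-\frac{\mathrm{tr}\,h}{4}g,X\right)=\mathrm{div}\,h-\tfrac14\nabla\mathrm{tr}\,h+\tfrac12\mathrm{curl}(X)-\tfrac12X\lrcorner\mathsf P(T)-T(X).$$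
   Context: Abstract index notation; repeated indices are contracted with the metric. A $G_2$-structure on $M^7$ is a $3$-form $\varphi$ inducing an orientation and a Riemannian metric $g$ by $(V\lrcorner\varphi)\wedge(W\lrcorner\varphi)\wedge\varphi=-6g(V,W)\,d\mu_g$; $\psi=*\varphi$; $\nabla$ is the Levi-Civita connection. For a symmetric $2$-tensor $h$ and a $1$-form $X$: $(h\diamond\varphi)_{ijk}=h_{ip}\varphi_{pjk}+h_{jp}\varphi_{ipk}+h_{kp}\varphi_{ijp}$ and $(X\lrcorner\psi)_{ijk}=X_m\psi_{mijk}$. The torsion $T$ is the $2$-tensor with $\nabla_p\varphi_{ijk}=T_{pl}\psi_{lijk}$. For $2$-tensors: $(\mathsf VA)_k=A_{ij}\varphi_{ijk}$, $\mathsf P(A)_{ij}=A_{ab}\psi_{abij}$, $(A\circ B)_{ij}=A_{ip}B_{pj}$, $A_{\mathrm{sym}}=\frac12(A+A^t)$, $(\mathrm{div}\,A)_k=\nabla_aA_{ak}$, $A(X)_i=A_{ij}X_j$, $(X\lrcorner A)_j=X_iA_{ij}$; $(\mathsf VT\lrcorner\varphi)_{jk}=(\mathsf VT)_i\varphi_{ijk}$; $\mathrm{curl}(X)_k=\nabla_aX_b\varphi_{abk}$. Norms are full contractions. The operator $\mathsf L$ is $\mathsf L(h,X)=\mathrm{div}\,h+\frac12\mathrm{curl}\,X-\frac12X\lrcorner\mathsf P(T)-T(X)$. *)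

(* Defs.v *)
From HB Require Import structures.
From mathcomp Require Import all_boot all_order all_algebra.
From mathcomp Require Import all_classical all_reals all_analysis.
Import Order.TTheory GRing.Theory Num.Theory numFieldNormedType.Exports.

Set Implicit Arguments.
Unset Strict Implicit.
Unset Printing Implicit Defensive.

Local Open Scope classical_set_scope.
Local Open Scope ring_scope.

(* Manifolds are given by an atlas modelled on 'rV[R]_n.  A tensor field is    *)
(* the family of its components in the charts, related by the transformation  *)
(* law.  All indices are covariant; a repeated index is contracted with the   *)
(* inverse metric (see contract), and 1-forms and vector fields are identified*)
(* through the metric.                                                        *)

Section SmoothFunctions.
Variables (R : realType) (n : nat).
Implicit Types (U : set 'rV[R]_n) (f : 'rV[R]_n -> R).

Definition partial (i : 'I_n) f (x : 'rV[R]_n) : R :=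
  'D_(delta_mx ord0 i : 'rV[R]_n) f x.

(* Meaningful for open U: both continuity and derivability at a point of U    *)
(* are taken in the ambient space.                                            *)
Fixpoint Ck_on (k : nat) U f : Prop :=
  (forall x, U x -> {for x, continuous f}) /\
  if k is k'.+1 then
    forall i : 'I_n,
      (forall x, U x -> derivable f x (delta_mx ord0 i : 'rV[R]_n)) /\
      Ck_on k' U (partial i f)
  else True.

Definition smooth_on U f : Prop := forall k, Ck_on k U f.

End SmoothFunctions.

Section Manifolds.
Variables (R : realType) (n : nat).

Record chart (M : topologicalType) := Chart {
  chart_dom : set M;
  chart_img : set 'rV[R]_n;
  chart_map : M -> 'rV[R]_n;
  chart_inv : 'rV[R]_n -> M;
  chart_dom_open : open chart_dom;
  chart_img_open : open chart_img;
  chart_mapP : forall p, chart_dom p -> chart_img (chart_map p);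
  chart_invP : forall x, chart_img x -> chart_dom (chart_inv x);
  chart_mapK : forall p, chart_dom p -> chart_inv (chart_map p) = p;
  chart_invK : forall x, chart_img x -> chart_map (chart_inv x) = x;
  chart_map_cont : forall p, chart_dom p -> {for p, continuous chart_map};
  chart_inv_cont : forall x, chart_img x -> {for x, continuous chart_inv}
}.

Definition overlap M (c d : chart M) : set 'rV[R]_n :=
  [set x | chart_img c x /\ chart_dom d (chart_inv c x)].

Definition transition M (c d : chart M) (x : 'rV[R]_n) : 'rV[R]_n :=
  chart_map d (chart_inv c x).

Record manifold := Manifold {
  carrier :> topologicalType;
  carrier_hausdorff : hausdorff_space carrier;
  carrier_second_countable : @second_countable carrier;
  atlas_index : Type;
  atlas : atlas_index -> chart carrier;
  atlas_cover : forall p : carrier, exists c, chart_dom (atlas c) p;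
  atlas_smooth : forall (c d : atlas_index) (a : 'I_n),
    smooth_on (overlap (atlas c) (atlas d))
              (fun x => transition (atlas c) (atlas d) x ord0 a)
}.

Definition coord_dom (M : manifold) (c : atlas_index M) : set 'rV[R]_n :=
  chart_img (atlas c).

(* Row i, column a: the derivative in x^i of the a-th new coordinate.         *)
Definition transition_jac (M : manifold) (c d : atlas_index M)
    (x : 'rV[R]_n) : 'M[R]_n :=
  \matrix_(i, a)
    partial i (fun y => transition (atlas c) (atlas d) y ord0 a) x.

(* Smooth covariant tensor fields of rank r.                                  *)
Record tensor_field (M : manifold) (r : nat) := TensorField {
  comp : atlas_index M -> 'rV[R]_n -> r.-tuple 'I_n -> R;
  comp_smooth : forall c I, smooth_on (coord_dom c) (fun x => comp c x I);
  comp_transform : forall c d x I,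
    overlap (atlas c) (atlas d) x ->
    comp c x I =
      \sum_(J : r.-tuple 'I_n)
        comp d (transition (atlas c) (atlas d) x) J *
        \prod_(s < r) transition_jac c d x (tnth I s) (tnth J s)
}.

Definition comp1 M (t : tensor_field M 1) (c : atlas_index M) x i : R :=
  comp t c x [tuple i].
Definition comp2 M (t : tensor_field M 2) (c : atlas_index M) x i j : R :=
  comp t c x [tuple i; j].
Definition comp3 M (t : tensor_field M 3) (c : atlas_index M) x i j k : R :=
  comp t c x [tuple i; j; k].

Definition symmetric_tensor M (t : tensor_field M 2) : Prop :=
  forall c x i j, coord_dom c x -> comp2 t c x i j = comp2 t c x j i.

Record differential_3form (M : manifold) := Differential3Form {
  form_tensor :> tensor_field M 3;
  form_alt12 : forall c x i j k, coord_dom c x ->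
    comp3 form_tensor c x i j k = - comp3 form_tensor c x j i k;
  form_alt23 : forall c x i j k, coord_dom c x ->
    comp3 form_tensor c x i j k = - comp3 form_tensor c x i k j
}.

Record riemannian_metric (M : manifold) := RiemannianMetric {
  metric_tensor :> tensor_field M 2;
  metric_sym : symmetric_tensor metric_tensor;
  metric_pos : forall c x (v : 'I_n -> R), coord_dom c x ->
    (exists i, v i != 0) ->
    0 < \sum_i \sum_j comp2 metric_tensor c x i j * v i * v j
}.

(* In each chart, a locally constant sign comparing the coordinate frame with *)
(* the orientation.                                                           *)
Record orientation (M : manifold) := Orientation {
  orient_sign : atlas_index M -> 'rV[R]_n -> R;
  orient_signP : forall c x, coord_dom c x ->
    orient_sign c x = 1 \/ orient_sign c x = -1;
  orient_sign_cont : forall c x, coord_dom c x ->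
    {for x, continuous (orient_sign c)};
  orient_sign_transform : forall c d x,
    overlap (atlas c) (atlas d) x ->
    orient_sign c x =
      Num.sg (\det (transition_jac c d x)) *
      orient_sign d (transition (atlas c) (atlas d) x)
}.

Definition metric_mx M (g : riemannian_metric M) (c : atlas_index M)
    (x : 'rV[R]_n) : 'M[R]_n :=
  \matrix_(i, j) comp2 g c x i j.

(* The coefficient of the Riemannian volume form on dx^1 /\ ... /\ dx^n.      *)
Definition volume_coef M (g : riemannian_metric M) (o : orientation M)
    (c : atlas_index M) (x : 'rV[R]_n) : R :=
  orient_sign o c x * Num.sqrt (\det (metric_mx g c x)).

End Manifolds.

(* Riemannian calculus in a coordinate domain, for a metric with matrix g.    *)
Section RiemannianCalculus.
Variables (R : realType) (n : nat) (g : 'rV[R]_n -> 'M[R]_n).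
Local Notation E := 'rV[R]_n.
Local Notation I := 'I_n.
Implicit Types (x : E) (X : E -> I -> R) (A B : E -> I -> I -> R).

Definition contract x (F : I -> I -> R) : R :=
  \sum_a \sum_b invmx (g x) a b * F a b.

Definition christoffel x (k i j : I) : R :=
  2^-1 * \sum_l invmx (g x) k l *
    (partial i (fun y => g y j l) x + partial j (fun y => g y i l) x
     - partial l (fun y => g y i j) x).

(* nabla A x p i ... is the covariant derivative of A_{i ...} in direction p. *)
Definition nabla1 X x (p i : I) : R :=
  partial p (fun y => X y i) x - \sum_m christoffel x m p i * X x m.

Definition nabla2 A x (p i j : I) : R :=
  partial p (fun y => A y i j) x
  - \sum_m christoffel x m p i * A x m j
  - \sum_m christoffel x m p j * A x i m.

Definition nabla3 (C : E -> I -> I -> I -> R) x (p i j k : I) : R :=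
  partial p (fun y => C y i j k) x
  - \sum_m christoffel x m p i * C x m j k
  - \sum_m christoffel x m p j * C x i m k
  - \sum_m christoffel x m p k * C x i j m.

(* The d_l-component of R(d_i, d_j) d_k, where                                *)
(* R(V, W) = [nabla_V, nabla_W] - nabla_[V, W].                               *)
Definition riemann x (i j k l : I) : R :=
  partial i (fun y => christoffel y l j k) x
  - partial j (fun y => christoffel y l i k) x
  + \sum_m (christoffel x l i m * christoffel x m j k
            - christoffel x l j m * christoffel x m i k).

(* With this trace the Ricci tensor of the round sphere is positive.          *)
Definition Ricci x (j k : I) : R := \sum_i riemann x i j k i.

Definition trace A x : R := contract x (A x).

Definition sym A x (i j : I) : R := 2^-1 * (A x i j + A x j i).

Definition compose A B x (i j : I) : R :=
  contract x (fun p q => A x i p * B x q j).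

Definition norm2_1 X x : R := contract x (fun i i' => X x i * X x i').

Definition norm2_2 A x : R :=
  contract x (fun i i' => contract x (fun j j' => A x i j * A x i' j')).

(* A(X)_i = A_ij X_j *)
Definition apply A X x (i : I) : R := contract x (fun j j' => A x i j * X x j').

(* (X _| A)_j = X_i A_ij *)
Definition interior2 X A x (j : I) : R :=
  contract x (fun i i' => X x i * A x i' j).

Definition div A x (k : I) : R := contract x (fun a b => nabla2 A x a b k).

Definition grad (f : E -> R) x (k : I) : R := partial k f x.

Definition sharp X x (k : I) : R := \sum_l invmx (g x) k l * X x l.

(* The Lie derivative of g along the vector field dual to X.                  *)
Definition lie_metric X x (i j : I) : R :=
  \sum_k (sharp X x k * partial k (fun y => g y i j) x
          + g x k j * partial i (fun y => sharp X y k) x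
          + g x i k * partial j (fun y => sharp X y k) x).

End RiemannianCalculus.

(* The Levi-Civita symbol in dimension 7: the sign of the permutation         *)
(* (a, b, c, i, j, k, l), and 0 if two of these indices coincide.             *)
Definition levi_civita (R : realType) (a b c i j k l : 'I_7) : R :=
  \det (\matrix_(r < 7, s < 7)
          (tnth [tuple a; b; c; i; j; k; l] r == s)%:R).

(* The coefficient on dx^1 /\ ... /\ dx^7 of al /\ be /\ ga, with two 2-forms *)
(* and a 3-form; for this normalisation dx^1 /\ ... /\ dx^7 takes the value 1 *)
(* on the coordinate frame.                                                   *)
Definition wedge223 (R : realType) (al be : 'I_7 -> 'I_7 -> R)
    (ga : 'I_7 -> 'I_7 -> 'I_7 -> R) : R :=
  (2`! * 2`! * 3`!)%:R^-1 *
  \sum_a \sum_b \sum_c \sum_d \sum_e \sum_f \sum_h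
    levi_civita R a b c d e f h * al a b * be c d * ga e f h.

(* The metric and the orientation are determined by the 3-form through        *)
(* g2_induces, and are fields only to give them names.                        *)
Record g2_structure (R : realType) (M : manifold R 7) := G2Structure {
  g2_form : differential_3form M;
  g2_metric : riemannian_metric M;
  g2_orient : orientation M;
  g2_induces : forall (c : atlas_index M) x (V W : 'I_7 -> R), coord_dom c x ->
    wedge223 (fun j k => \sum_i V i * comp3 g2_form c x i j k)
             (fun j k => \sum_i W i * comp3 g2_form c x i j k)
             (comp3 g2_form c x)
    = - 6 * (\sum_i \sum_j comp2 g2_metric c x i j * V i * W j)
      * volume_coef g2_metric g2_orient c x
}.

Section G2.
Variables (R : realType) (M : manifold R 7) (s : g2_structure M).
Variable T : tensor_field M 2.
Variable c : atlas_index M.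
Local Notation E := 'rV[R]_7.
Local Notation I := 'I_7.
Implicit Types (x : E) (X : E -> I -> R) (A h : E -> I -> I -> R).

Definition g_ : E -> 'M[R]_7 := metric_mx (g2_metric s) c.
Definition phi_ : E -> I -> I -> I -> R := comp3 (g2_form s) c.
Definition T_ : E -> I -> I -> R := comp2 T c.

(* The Hodge dual: psi_ijkl = phi^abc mu_abcijkl / 3!, mu the volume form.    *)
Definition psi_ x (i j k l : I) : R :=
  (3`!)%:R^-1 *
  contract g_ x (fun a a' => contract g_ x (fun b b' => contract g_ x
    (fun d d' => phi_ x a b d *
       (volume_coef (g2_metric s) (g2_orient s) c x
        * levi_civita R a' b' d' i j k l)))).

(* (h <> phi)_ijk, the action of a symmetric 2-tensor on phi *)
Definition diamond h x (i j k : I) : R :=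
  contract g_ x (fun p q => h x i p * phi_ x q j k)
  + contract g_ x (fun p q => h x j p * phi_ x i q k)
  + contract g_ x (fun p q => h x k p * phi_ x i j q).

Definition interior_psi X x (i j k : I) : R :=
  contract g_ x (fun m m' => X x m * psi_ x m' i j k).

Definition interior_phi X x (j k : I) : R :=
  contract g_ x (fun i i' => X x i * phi_ x i' j k).

Definition Vop A x (k : I) : R :=
  contract g_ x (fun i i' => contract g_ x (fun j j' =>
    A x i j * phi_ x i' j' k)).

Definition Pop A x (i j : I) : R :=
  contract g_ x (fun a a' => contract g_ x (fun b b' =>
    A x a b * psi_ x a' b' i j)).

Definition curl X x (k : I) : R :=
  contract g_ x (fun a a' => contract g_ x (fun b b' =>
    nabla1 g_ X x a b * phi_ x a' b' k)).

Definition Lop h X x (k : I) : R :=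
  div g_ h x k + 2^-1 * curl X x k
  - 2^-1 * interior2 g_ X (Pop T_) x k - apply g_ T_ X x k.

Definition Btilde h X : E -> I -> R :=
  Lop (fun x i j => h x i j - trace g_ h x / 4 * g_ x i j) X.

Definition VT_ : E -> I -> R := Vop T_.
Definition trT_ : E -> R := trace g_ T_.

Definition Ptilde1 x (i j : I) : R :=
  - Ricci g_ x i j
  - 3^-1 * lie_metric g_ VT_ x i j
  - 2 / 3 * sym (compose g_ T_ (interior_phi VT_)) x i j
  + trT_ x * sym T_ x i j
  + 3^-1 * (norm2_2 g_ T_ x - 3^-1 * norm2_1 g_ VT_ x) * g_ x i j.

Definition P2 x (k : I) : R :=
  2 / 3 * div g_ T_ x k + 3^-1 * grad trT_ x k + 3^-1 * (trT_ x * VT_ x k).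

Definition Ptilde x (i j k : I) : R :=
  diamond Ptilde1 x i j k + interior_psi P2 x i j k.

(* The 3-form Q is h <> phi + X _| psi, and the pair (h, X) is annihilated    *)
(* by Btilde.                                                                 *)
Definition satisfies_Bianchi (Q : E -> I -> I -> I -> R) h X : Prop :=
  forall x, coord_dom c x ->
    (forall i j k, Q x i j k = diamond h x i j k + interior_psi X x i j k) /\
    (forall k, Btilde h X x k = 0).

End G2.

Definition is_torsion (R : realType) (M : manifold R 7) (s : g2_structure M)
    (T : tensor_field M 2) : Prop :=
  forall (c : atlas_index M) x p i j k, coord_dom c x ->
    nabla3 (g_ s c) (phi_ s c) x p i j k
    = contract (g_ s c) x (fun l l' => T_ T c x p l * psi_ s c x l' i j k).

(* Main.v *)
From Stdlib Require Import ZArith.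
From HB Require Import structures.
From mathcomp Require Import all_boot all_order all_algebra all_fingroup.
From mathcomp Require Import all_classical all_reals all_analysis.
From mathcomp Require Import zify ssrZ ring lra.
Require Import Defs.
Import Order.TTheory GRing.Theory Num.Theory numFieldNormedType.Exports.
Local Open Scope ring_scope.
Set Implicit Arguments.
Unset Strict Implicit.
Unset Printing Implicit Defensive.

(** Why the identity holds.

    Everything is local, so a chart and a point [x] in it are fixed.  The proof
    turns the differential identity into polynomial identities between numbers:
    the components at [x], in a well chosen orthonormal basis, of the torsion
    [T], of the curvature and of their covariant derivatives.

    Horizontal jets.  On the bundle of frames, the components of a tensor field
    are functions, and the covariant derivative in the direction of the c-th
    vector of the frame is the standard horizontal vector field [D_c] acting on
    these functions.  Only the values at one frame [E0] over [x] of the iterated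
    derivatives matter, so a function on the frame bundle is recorded as its
    jet, which maps a word [c1 .. ck] to the value of the k-fold derivative with
    [D_c1] applied first.  Jets form a commutative ring (the Leibniz rule is a
    shuffle product), on which the [D_c] are derivations.  If [hatk A] denotes
    the jets of the frame components of [A], then [D] corresponds to [nabla]
    ([jshift_hat1], [jshift_hat2], [jshift_hat3]), contraction with the metric
    becomes a plain sum over repeated indices ([hjet_contract]), and
    [D_a D_b - D_b D_a] is the action of the Riemann tensor ([jcomm_hat1],
    [jcomm_hat2], [jcomm_hat3]), which is the Ricci identity.

    Adapted frames.  The relation between the 3-form, the metric and the volume
    form says that the cross product of [phi] satisfies
    [u x (u x w) = <u,w> u - <u,u> w]; this comes out of matrix identities for
    the Pfaffian and for Hitchin's endomorphism of the restriction of [phi] to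
    the complement of a unit vector ([cross_sqr]).  The octonionic basis
    construction then gives an orthonormal frame in which
    [phi] has the standard components [phi0] ([octonion_frame],
    [adapted_frame]) and the dual form has the components [psi0]
    ([adapted_dual]).  In particular [psi] is given by the contraction identity
    [psi_ijkl = g_ik g_jl - g_il g_jk - phi_ijp phi_klp] ([psiE]), and with
    [nabla phi = T psi] every derivative at [x] of [phi], [psi] and [VT] becomes
    a polynomial in the derivatives of [T].

    Curvature from torsion.  The commutator of two covariant derivatives of
    [phi] is on the one hand an expression in [nabla T] and, quadratically, in
    [T], and on the other hand the action of the Riemann tensor on [phi].  Comparing them determines the part
    [phi_ijl R_abij] of the curvature, and the algebraic Bianchi identity turns
    this into a formula for the Ricci tensor ([jeval_Ric], [RicciE]).  Since it
    holds at every point it can be differentiated, so that [Ric] can be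
    eliminated from the operator.

    The identity.  After this elimination, [72 Btilde] at [x] involves [T] with
    at most two derivatives, and the second derivatives occur only through
    commutators ([pBianchi_rest]).  Replacing these commutators, and the
    curvature part found above, by curvature gives an expression that is linear
    in the Riemann tensor and vanishes by its algebraic symmetries
    ([pRest_curv]); hence [pBianchi0].  These steps are identities between
    polynomials in finitely many components, and are established by a verified
    normalisation procedure ([checkP]). *)

(** * Components in a moving frame *)

Section Slot.
Variables (A : comNzRingType) (n : nat) (fr : 'I_n -> 'I_n -> A).

(** The operation that converts one tensor index from coordinates to a frame;
    a tensor of rank k is converted by k nested slots. *)
Definition slot (F : 'I_n -> A) a : A := \sum_i fr a i * F i.

Lemma eq_slot F G a : (forall i, F i = G i) -> slot F a = slot G a.
Proof. by move=> FG; apply: eq_bigr => i _; rewrite FG. Qed.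

Lemma slotD F G a : slot (fun i => F i + G i) a = slot F a + slot G a.
Proof. by rewrite /slot -big_split; apply: eq_bigr => i _; rewrite mulrDr. Qed.

Lemma slotN F a : slot (fun i => - F i) a = - slot F a.
Proof. by rewrite /slot -sumrN; apply: eq_bigr => i _; rewrite mulrN. Qed.

Lemma slotB F G a : slot (fun i => F i - G i) a = slot F a - slot G a.
Proof. by rewrite slotD slotN. Qed.

Lemma slotZ z F a : slot (fun i => z * F i) a = z * slot F a.
Proof. by rewrite /slot mulr_sumr; apply: eq_bigr => i _; rewrite mulrCA. Qed.

Lemma slotZr z F a : slot (fun i => F i * z) a = slot F a * z.
Proof. by rewrite /slot mulr_suml; apply: eq_bigr => i _; rewrite mulrA. Qed.

Lemma slot_sum (K : Type) (r : seq K) (P : pred K) (F : K -> 'I_n -> A) a :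
  slot (fun i => \sum_(k <- r | P k) F k i) a = \sum_(k <- r | P k) slot (F k) a.
Proof.
by rewrite /slot exchange_big /=; apply: eq_bigr => i _; rewrite mulr_sumr.
Qed.

Lemma slotC (F : 'I_n -> 'I_n -> A) a b :
  slot (fun i => slot (F i) b) a = slot (fun j => slot (F^~ j) a) b.
Proof. by rewrite slot_sum; apply: eq_bigr => j _; rewrite slotZ. Qed.

End Slot.

(** * The ring of jets *)

Section JetRing.
Variables (R : comNzRingType) (I : Type).

(** A jet lists the iterated derivatives of a function along words of
    non-commuting derivations; the first letter of the word is the derivation
    that is applied first. *)
Definition jet := seq I -> R.
HB.instance Definition _ := gen_eqMixin jet.
HB.instance Definition _ := gen_choiceMixin jet.
Implicit Types (f g h : jet) (w : seq I).

Definition jshift (c : I) f : jet := fun w => f (c :: w).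
Definition jadd f g : jet := fun w => f w + g w.
Definition jopp f : jet := fun w => - f w.
Definition jcst (a : R) : jet := fun w => if w is [::] then a else 0.

(** The iterated Leibniz rule. *)
Fixpoint jprod w f g : R :=
  if w is c :: u then jprod u (jshift c f) g + jprod u f (jshift c g)
  else f [::] * g [::].
Definition jmul f g : jet := fun w => jprod w f g.

Lemma jaddA : associative jadd.
Proof. by move=> f g h; apply/funext => w; rewrite /jadd addrA. Qed.
Lemma jaddC : commutative jadd.
Proof. by move=> f g; apply/funext => w; rewrite /jadd addrC. Qed.
Lemma jadd0 : left_id (jcst 0) jadd.
Proof. by move=> f; apply/funext => -[|c w]; rewrite /jadd /= add0r. Qed.
Lemma jaddN : left_inverse (jcst 0) jopp jadd.
Proof. by move=> f; apply/funext => -[|c w]; rewrite /jadd /jopp /= addNr. Qed.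
HB.instance Definition _ := GRing.isZmodule.Build jet jaddA jaddC jadd0 jaddN.

Lemma jprodC w f g : jprod w f g = jprod w g f.
Proof.
elim: w f g => [|c w IH] f g /=; first by rewrite mulrC.
by rewrite addrC (IH f) (IH _ g).
Qed.

Lemma jprodDl w f g h : jprod w (jadd f g) h = jprod w f h + jprod w g h.
Proof.
elim: w f g h => [|c w IH] f g h /=; first by rewrite /jadd mulrDl.
by rewrite -[jshift c (jadd f g)]/(jadd (jshift c f) (jshift c g)) !IH addrACA.
Qed.

Lemma jprodDr w f g h : jprod w h (jadd f g) = jprod w h f + jprod w h g.
Proof. by rewrite !(jprodC w h) jprodDl. Qed.

(** Both sides expand to the sum over all ways of distributing the letters of
    the word to three factors. *)
Lemma jprodA w f g h : jprod w f (jmul g h) = jprod w (jmul f g) h.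
Proof.
elim: w f g h => [|c w IH] f g h /=; first by rewrite mulrA.
rewrite -[jshift c (jmul g h)]/(jadd (jmul (jshift c g) h) (jmul g (jshift c h))).
rewrite -[jshift c (jmul f g)]/(jadd (jmul (jshift c f) g) (jmul f (jshift c g))).
by rewrite jprodDl jprodDr !IH addrA.
Qed.

Lemma jprod0 w g : jprod w (jcst 0) g = 0.
Proof.
elim: w g => [|c w IH] g /=; first by rewrite mul0r.
rewrite (_ : jshift c (jcst 0) = jcst 0) ?IH ?addr0 //.
by apply/funext => -[].
Qed.

Lemma jprod1 w g : jprod w (jcst 1) g = g w.
Proof.
elim: w g => [|c w IH] g /=; first by rewrite mul1r.
rewrite (_ : jshift c (jcst 1) = jcst 0) ?jprod0 ?add0r ?IH //.
by apply/funext => -[].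
Qed.

Lemma jmulA : associative jmul.
Proof. by move=> f g h; apply/funext => w; exact: jprodA. Qed.
Lemma jmulC : commutative jmul.
Proof. by move=> f g; apply/funext => w; exact: jprodC. Qed.
Lemma jmul1 : left_id (jcst 1) jmul.
Proof. by move=> f; apply/funext => w; exact: jprod1. Qed.
Lemma jmulDl : left_distributive jmul jadd.
Proof. by move=> f g h; apply/funext => w; exact: jprodDl. Qed.
Lemma jet1_neq0 : jcst 1 != 0 :> jet.
Proof. by apply/eqP => /(congr1 (@^~ [::])) /eqP; rewrite oner_eq0. Qed.
HB.instance Definition _ :=
  GRing.Zmodule_isComNzRing.Build jet jmulA jmulC jmul1 jmulDl jet1_neq0.

Lemma jshift_is_zmod_morphism c : zmod_morphism (jshift c : jet -> jet).
Proof. by []. Qed.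
HB.instance Definition _ c :=
  GRing.isZmodMorphism.Build jet jet (jshift c) (jshift_is_zmod_morphism c).

Lemma jshiftM c f g : jshift c (f * g) = jshift c f * g + f * jshift c g.
Proof. by []. Qed.

Lemma jshiftD c f g : jshift c (f + g) = jshift c f + jshift c g.
Proof. by []. Qed.
Lemma jshiftN c f : jshift c (- f) = - jshift c f.
Proof. by []. Qed.
Lemma jshiftB c f g : jshift c (f - g) = jshift c f - jshift c g.
Proof. by []. Qed.
Lemma jshift_sum (J : Type) (r : seq J) (P : pred J) (F : J -> jet) c :
  jshift c (\sum_(i <- r | P i) F i) = \sum_(i <- r | P i) jshift c (F i).
Proof. exact: (raddf_sum (jshift c)). Qed.

Lemma jshift_cst c a : jshift c (jcst a) = 0.
Proof. by apply/funext => -[]. Qed.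

(** A function whose derivatives all vanish is known by its value; this is how
    parallel tensors are shown to have constant components. *)
Lemma jet_constP f : (forall c, jshift c f = 0) -> f = jcst (f [::]).
Proof. by move=> f0; apply/funext => -[|c w] //; have /(congr1 (@^~ w)) := f0 c; case: w. Qed.

Lemma jcst_is_zmod_morphism : zmod_morphism (jcst : R -> jet).
Proof. by move=> a b; apply/funext => -[|c w] //=; rewrite [RHS]subr0. Qed.
HB.instance Definition _ :=
  GRing.isZmodMorphism.Build R jet jcst jcst_is_zmod_morphism.
Lemma jcst_is_monoid_morphism : monoid_morphism (jcst : R -> jet).
Proof.
split=> // a b; apply/esym/jet_constP => c.
by rewrite jshiftM !jshift_cst mul0r mulr0 addr0.
Qed.
HB.instance Definition _ :=
  GRing.isMonoidMorphism.Build R jet jcst jcst_is_monoid_morphism.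

(** Evaluation at the base point: the only information that survives in the
    final identity. *)
Definition jeval f : R := f [::].
Lemma jeval_is_zmod_morphism : zmod_morphism jeval.
Proof. by []. Qed.
HB.instance Definition _ :=
  GRing.isZmodMorphism.Build jet R jeval jeval_is_zmod_morphism.
Lemma jeval_is_monoid_morphism : monoid_morphism jeval.
Proof. by []. Qed.
HB.instance Definition _ :=
  GRing.isMonoidMorphism.Build jet R jeval jeval_is_monoid_morphism.

(** Jets are compared order by order, since the horizontal derivatives below are
    only defined by recursion on the order. *)
Definition jeq m f g := forall w, (size w <= m)%N -> f w = g w.

Lemma jeqM m f f' g g' : jeq m f f' -> jeq m g g' -> jeq m (f * g) (f' * g').
Proof.
have H : forall w f f' g g', jeq (size w) f f' -> jeq (size w) g g' ->
    jprod w f g = jprod w f' g'.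
  elim=> [|c w IH] f1 f1' g1 g1' ff gg /=; first by rewrite ff ?gg.
  congr (_ + _); apply: IH => u su;
    by [apply: ff|apply: gg|apply: ff; rewrite leqW|apply: gg; rewrite leqW].
move=> ff gg w sw; apply: H => u su; [apply: ff|apply: gg]; exact: leq_trans su sw.
Qed.

Lemma jet_sumE (J : Type) (r : seq J) (P : pred J) (F : J -> jet) w :
  (\sum_(i <- r | P i) F i) w = \sum_(i <- r | P i) F i w.
Proof. by elim/big_rec2: _ => [|i y x _ <-] //; case: w. Qed.

Lemma jeq_sum (J : Type) (r : seq J) (P : pred J) m (F G : J -> jet) :
  (forall i, jeq m (F i) (G i)) -> jeq m (\sum_(i <- r | P i) F i) (\sum_(i <- r | P i) G i).
Proof. by move=> FG w sw; rewrite !jet_sumE; apply: eq_bigr => i _; exact: FG. Qed.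

End JetRing.

(** * A verified decision procedure for identities between components *)

Section SparsePolynomials.

(** A polynomial with integer coefficients in indexed unknowns.  An unknown is a
    number, naming a tensor, together with a list of indices; monomials are
    sorted lists of unknowns and polynomials sorted lists of terms. *)
Definition akey := (nat * seq 'I_7)%type.
Definition mono := seq akey.
Definition spoly := seq (Z * mono).

Fixpoint cmp_idx (s t : seq 'I_7) : comparison :=
  match s, t with
  | [::], [::] => Eq
  | [::], _ => Lt
  | _, [::] => Gt
  | i :: s', j :: t' =>
      match Nat.compare (nat_of_ord i) (nat_of_ord j) with Eq => cmp_idx s' t' | c => c end
  end.

Definition cmp_key (a b : akey) : comparison :=
  match Nat.compare a.1 b.1 with Eq => cmp_idx a.2 b.2 | c => c end.

Fixpoint cmp_mono (s t : mono) : comparison :=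
  match s, t with
  | [::], [::] => Eq
  | [::], _ => Lt
  | _, [::] => Gt
  | a :: s', b :: t' => match cmp_key a b with Eq => cmp_mono s' t' | c => c end
  end.

Fixpoint mono_mul (s : mono) : mono -> mono :=
  fix aux (t : mono) : mono :=
  match s, t with
  | [::], _ => t
  | _, [::] => s
  | a :: s', b :: t' =>
      if cmp_key a b is Gt then b :: aux t' else a :: mono_mul s' t
  end.

Fixpoint padd (p : spoly) : spoly -> spoly :=
  fix aux (q : spoly) : spoly :=
  match p, q with
  | [::], _ => q
  | _, [::] => p
  | (c, m) :: p', (d, l) :: q' =>
      match cmp_mono m l with
      | Eq => let e := Z.add c d in
              if Z.eqb e Z0 then padd p' q' else (e, m) :: padd p' q'
      | Lt => (c, m) :: padd p' q
      | Gt => (d, l) :: aux q'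
      end
  end.

Definition pmul1 (c : Z) (m : mono) (q : spoly) : spoly :=
  [seq (Z.mul c t.1, mono_mul m t.2) | t <- q].

(** Multiplication by a monomial may change the order of the terms; adding them
    one by one restores it. *)
Definition psort (q : spoly) : spoly := foldr (fun t => padd [:: t]) [::] q.

Fixpoint pmul (p q : spoly) : spoly :=
  if p is (c, m) :: p' then padd (psort (pmul1 c m q)) (pmul p' q) else [::].

Definition popp (p : spoly) : spoly := [seq (Z.opp t.1, t.2) | t <- p].

Variables (R : comNzRingType) (val : nat -> seq 'I_7 -> R).

Definition zR (z : Z) : R := (ssrZ.int_of_Z z)%:~R.

Definition meval (m : mono) : R := \prod_(a <- m) val a.1 a.2.
Definition peval (p : spoly) : R := \sum_(t <- p) zR t.1 * meval t.2.

Lemma zRD a b : zR (Z.add a b) = zR a + zR b.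
Proof. by rewrite /zR -intrD -[Z.add a b]/(a + b) raddfD. Qed.
Lemma zRM a b : zR (Z.mul a b) = zR a * zR b.
Proof. by rewrite /zR -intrM -[Z.mul a b]/(a * b) rmorphM. Qed.
Lemma zRN a : zR (Z.opp a) = - zR a.
Proof. by rewrite /zR -intrN -[Z.opp a]/(- a) raddfN. Qed.
Lemma zR_nat n : zR (Z.of_nat n) = n%:R.
Proof. by rewrite /zR (_ : ssrZ.int_of_Z _ = n) //; lia. Qed.

Lemma cmp_idx_eq s t : cmp_idx s t = Eq -> s = t.
Proof.
elim: s t => [|i s IH] [|j t] //=.
case E: Nat.compare => // /IH ->; congr (_ :: _); apply: val_inj.
exact: (proj1 (PeanoNat.Nat.compare_eq_iff _ _)) E.
Qed.

Lemma cmp_key_eq a b : cmp_key a b = Eq -> a = b.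
Proof.
case: a b => [k s] [l t]; rewrite /cmp_key /=; case E: Nat.compare => // /cmp_idx_eq ->.
by congr (_, _); exact: (proj1 (PeanoNat.Nat.compare_eq_iff _ _)) E.
Qed.

Lemma cmp_mono_eq s t : cmp_mono s t = Eq -> s = t.
Proof.
elim: s t => [|a s IH] [|b t] //=.
by case E: cmp_key => // /IH ->; rewrite (cmp_key_eq E).
Qed.

Lemma meval_mul s t : meval (mono_mul s t) = meval s * meval t.
Proof.
rewrite /meval; elim: s t => [|a s IHs] t; first by case: t => [|b t]; rewrite big_nil mul1r.
elim: t => [|b t IHt] /=; first by rewrite big_nil mulr1.
case: (cmp_key a b); last 1 first.
- by rewrite big_cons -/(mono_mul (a :: s) t) IHt [in RHS](big_cons _ _ b) mulrCA.
- by rewrite big_cons IHs [in RHS](big_cons _ _ a) mulrA.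
- by rewrite big_cons IHs [in RHS](big_cons _ _ a) mulrA.
Qed.

Lemma peval_cons t p : peval (t :: p) = zR t.1 * meval t.2 + peval p.
Proof. by rewrite /peval big_cons. Qed.

Lemma peval_nil : peval [::] = 0. Proof. by rewrite /peval big_nil. Qed.

Lemma peval_add p q : peval (padd p q) = peval p + peval q.
Proof.
elim: p q => [|[c m] p IHp] q; first by case: q => [|t q]; rewrite peval_nil add0r.
elim: q => [|[d l] q IHq] /=; first by rewrite peval_nil addr0.
case E: (cmp_mono m l).
- move: (cmp_mono_eq E) => ->; rewrite !peval_cons /=.
  have H : zR c * meval l + peval p + (zR d * meval l + peval q) =
           zR (Z.add c d) * meval l + (peval p + peval q).
    by rewrite zRD mulrDl addrACA.
  rewrite H; case: Z.eqb_spec => [->|_]; last by rewrite peval_cons IHp.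
  by rewrite IHp /zR /= mul0r add0r.
- by rewrite !peval_cons IHp peval_cons addrA.
- by rewrite peval_cons -/(padd ((c, m) :: p) q) IHq [in RHS](peval_cons (d, l)) addrCA.
Qed.

Local Arguments padd : simpl never.

Lemma peval_sort q : peval (psort q) = peval q.
Proof.
elim: q => [|t q IH] //=.
by rewrite peval_add IH !peval_cons peval_nil addr0.
Qed.

Lemma peval_mul1 c m q : peval (pmul1 c m q) = zR c * meval m * peval q.
Proof.
elim: q => [|t q IH]; first by rewrite peval_nil mulr0.
by rewrite /= !peval_cons /= IH zRM meval_mul mulrDr mulrACA.
Qed.

Lemma peval_mul p q : peval (pmul p q) = peval p * peval q.
Proof.
elim: p => [|[c m] p IH] /=; first by rewrite peval_nil mul0r.
by rewrite peval_add peval_sort peval_mul1 IH peval_cons mulrDl.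
Qed.

Lemma peval_opp p : peval (popp p) = - peval p.
Proof.
elim: p => [|t p IH]; first by rewrite peval_nil oppr0.
by rewrite /= !peval_cons /= IH zRN mulNr opprD.
Qed.

End SparsePolynomials.

Definition ords7 : seq 'I_7 :=
  [:: @Ordinal 7 0 isT; @Ordinal 7 1 isT; @Ordinal 7 2 isT; @Ordinal 7 3 isT;
      @Ordinal 7 4 isT; @Ordinal 7 5 isT; @Ordinal 7 6 isT].

Lemma ords7E : ords7 = enum 'I_7.
Proof. by apply: (inj_map val_inj); rewrite val_enum_ord. Qed.

Lemma mem_ords7 i : i \in ords7. Proof. by rewrite ords7E mem_enum. Qed.

Lemma sum_ords7 (V : nmodType) (F : 'I_7 -> V) : \sum_i F i = foldr (fun i => +%R (F i)) 0 ords7.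
Proof.
rewrite -big_enum ords7E; elim: (enum _) => [|i s IH]; first by rewrite big_nil.
by rewrite big_cons IH.
Qed.

Section PolynomialBuilders.
Local Arguments padd : simpl never.
Local Arguments pmul : simpl never.
Variables (R : comNzRingType) (val : nat -> seq 'I_7 -> R).
Local Notation pev := (peval val).

Definition pcst (z : Z) : spoly := if z is Z0 then [::] else [:: (z, [::])].
Definition patom (k : nat) (s : seq 'I_7) : spoly := [:: (Z.one, [:: (k, s)])].
Definition psum7 (f : 'I_7 -> spoly) : spoly := foldr (fun i => padd (f i)) [::] ords7.

(** The factor is a function of [unit], so that it is evaluated only if [z] is
    non-zero. *)
Definition pscale (z : Z) (p : unit -> spoly) : spoly :=
  if z is Z0 then [::] else pmul1 z [::] (p tt).

Lemma peval_cst z : pev (pcst z) = zR R z.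
Proof.
have E t : pev [:: (t, [::])] = zR R t by rewrite peval_cons peval_nil /meval big_nil mulr1 addr0.
by case: z => [|p|p]; rewrite /pcst ?E // peval_nil.
Qed.

Lemma peval_atom k s : pev (patom k s) = val k s.
Proof. by rewrite peval_cons peval_nil addr0 /= /meval big_seq1 /zR mul1r. Qed.

Lemma peval_sum7 f : pev (psum7 f) = \sum_i pev (f i).
Proof. by rewrite sum_ords7 /psum7; elim: ords7 => [|i s IH] /=; rewrite ?peval_nil ?peval_add ?IH. Qed.

Lemma peval_scale z p : pev (pscale z p) = zR R z * pev (p tt).
Proof.
have E t : pev (pmul1 t [::] (p tt)) = zR R t * pev (p tt) by rewrite peval_mul1 /meval big_nil mulr1.
by case: z => [|q|q]; rewrite /pscale ?E // peval_nil /zR mul0r.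
Qed.
End PolynomialBuilders.

Section Expressions.
Local Arguments padd : simpl never.
Local Arguments pmul : simpl never.

Definition env := seq 'I_7.

(** Tensor expressions with summation and derivation.  A bound index is a de
    Bruijn variable, so that the index arguments are functions of the
    environment that lists the values of the indices, innermost first. *)
Inductive cexpr :=
| CNat (n : nat)
| CAtom (k : nat) (f : env -> seq 'I_7)
| CAdd (a b : cexpr)
| CMul (a b : cexpr)
| COpp (a : cexpr)
| CSum (a : cexpr)
| CDer (f : env -> 'I_7) (a : cexpr).

Variables (R A : comNzRingType) (v : {rmorphism A -> jet R 'I_7}).
Variable D : 'I_7 -> A -> A.
Hypothesis vD : forall c a, v (D c a) = jshift c (v a).
Variable at_ : nat -> seq 'I_7 -> A.
Variable val : nat -> seq 'I_7 -> R.

Fixpoint interp (e : cexpr) (r : env) : A :=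
  match e with
  | CNat n => n%:R
  | CAtom k f => at_ k (f r)
  | CAdd a b => interp a r + interp b r
  | CMul a b => interp a r * interp b r
  | COpp a => - interp a r
  | CSum a => \sum_(i < 7) interp a (i :: r)
  | CDer f a => D (f r) (interp a r)
  end.

(** [norm k s w] expresses the value at the word [w] of the unknown [k] with
    indices [s]. *)
Variable norm : nat -> seq 'I_7 -> seq 'I_7 -> spoly.

(** The second factor of a product is computed only if the first one is not the
    zero polynomial, since in the applications most components vanish. *)
Fixpoint pjmul (w : seq 'I_7) (f g : seq 'I_7 -> spoly) : spoly :=
  if w is c :: u then
    padd (pjmul u (fun t => f (c :: t)) g) (pjmul u f (fun t => g (c :: t)))
  else if f [::] is t :: p then pmul (t :: p) (g [::]) else [::].

Fixpoint expand (e : cexpr) (r : env) (w : seq 'I_7) : spoly :=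
  match e with
  | CNat n => if w is [::] then
                (if n is 0%N then [::] else [:: (Z.of_nat n, [::])]) else [::]
  | CAtom k f => norm k (f r) w
  | CAdd a b => padd (expand a r w) (expand b r w)
  | CMul a b => pjmul w (expand a r) (expand b r)
  | COpp a => popp (expand a r w)
  | CSum a => foldr (fun i => padd (expand a (i :: r) w)) [::] ords7
  | CDer f a => expand a r (f r :: w)
  end.

Hypothesis normP : forall k s w, v (at_ k s) w = peval val (norm k s w).

Lemma pjmulP w f g (x y : jet R 'I_7) :
  (forall u, x u = peval val (f u)) -> (forall u, y u = peval val (g u)) ->
  (x * y) w = peval val (pjmul w f g).
Proof.
rewrite -[(x * y) w]/(jprod w x y); elim: w f g x y => [|c w IH] f g x y xf yg /=.
  rewrite xf yg; case: (f [::]) => [|t p]; first by rewrite !peval_nil mul0r.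
  by rewrite peval_mul.
by rewrite peval_add; congr (_ + _); apply: IH => // u; rewrite /jshift ?xf ?yg.
Qed.

Lemma expandP e r w : v (interp e r) w = peval val (expand e r w).
Proof.
elim: e r w => [n|k f|a IHa b IHb|a IHa b IHb|a IHa|a IHa|f a IHa] r w /=.
- rewrite rmorph_nat; have -> : n%:R = jcst n%:R :> jet R 'I_7 by rewrite rmorph_nat.
  case: w => [|c w] /=; last by rewrite peval_nil.
  case: n => [|n]; first by rewrite peval_nil.
  by rewrite peval_cons peval_nil addr0 /= -zR_nat /meval big_nil mulr1.
- exact: normP.
- by rewrite rmorphD peval_add -IHa -IHb.
- by rewrite rmorphM; apply: pjmulP.
- by rewrite rmorphN peval_opp -IHa.
- rewrite rmorph_sum jet_sumE sum_ords7 /=.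
  by rewrite !peval_add peval_nil !IHa.
- by rewrite vD -IHa.
Qed.

Fixpoint all_env (n : nat) (P : env -> bool) : bool :=
  if n is m.+1 then all (fun i => all_env m (fun r => P (i :: r))) ords7 else P [::].

Lemma all_envP n P r : all_env n P -> size r = n -> P r.
Proof.
elim: n P r => [|n IH] P [|i r] // H [sr].
by have Hi := allP H i (mem_ords7 i); exact: IH Hi sr.
Qed.

Definition check n e1 e2 :=
  all_env n (fun r => if padd (expand e1 r [::]) (popp (expand e2 r [::])) is [::] then true else false).

(** Two expressions have equal values at the base point as soon as their
    expansions have the same normal form for all values of the free indices. *)
Lemma checkP n e1 e2 r : check n e1 e2 -> size r = n ->
  v (interp e1 r) [::] = v (interp e2 r) [::].
Proof.
move=> /all_envP H /H; rewrite !expandP.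
case E: (padd _ _) => [|//] _; apply/eqP; rewrite -subr_eq0 -peval_opp -peval_add.
by rewrite E peval_nil.
Qed.

End Expressions.

(** * The Bianchi identity at a point *)

(** [t] is the abstraction of a tensor expression over the environment; [atom]
    recognises the unknowns. *)
Ltac reify_with atom t :=
  lazymatch t with
  | fun r : env => @GRing.add _ (@?x r) (@?y r) =>
      let a := reify_with atom x in let b := reify_with atom y in constr:(CAdd a b)
  | fun r : env => @GRing.mul _ (@?x r) (@?y r) =>
      let a := reify_with atom x in let b := reify_with atom y in constr:(CMul a b)
  | fun r : env => @GRing.opp _ (@?x r) =>
      let a := reify_with atom x in constr:(COpp a)
  | fun r : env => @GRing.natmul _ (@GRing.one _) (nat_of_bool (@?b r)) => atom t
  | fun r : env => @GRing.natmul _ (@GRing.one _) ?n => constr:(CNat n)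
  | fun r : env => @GRing.zero _ => constr:(CNat 0)
  | fun r : env => @GRing.one _ => constr:(CNat 1)
  | fun r : env => jshift (@?c r) (@?x r) =>
      let a := reify_with atom x in constr:(CDer c a)
  | fun r : env => bigop.body _ _ (fun i => BigBody i _ true (@?F r i)) =>
      let G := eval cbv beta in (fun r : env => F (behead r) (head ord0 r)) in
      let a := reify_with atom G in constr:(CSum a)
  | _ => atom t
  end.

(** For goals of the form [forall i1 .. in, ev (lhs i1 .. in) = ev (rhs i1 .. in)]
    with n at most 5. *)
Ltac decide_with atom sound ev :=
  let go n L M r :=
    (let t1 := eval cbv beta in L in let t2 := eval cbv beta in M in
     let e1 := reify_with atom t1 in let e2 := reify_with atom t2 in
     refine (sound n e1 e2 r _ _); [vm_cast_no_check (erefl true) | reflexivity]) in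
  lazymatch goal with
  | |- forall (i j k l m : 'I_7), ev (@?L i j k l m) = ev (@?M i j k l m) =>
    let i' := fresh in let j' := fresh in let k' := fresh in let l' := fresh in let m' := fresh in
    intros i' j' k' l' m';
    go 5%N (fun r : env => L (head ord0 r) (head ord0 (behead r)) (head ord0 (behead (behead r)))
          (head ord0 (behead (behead (behead r)))) (head ord0 (behead (behead (behead (behead r))))))
         (fun r : env => M (head ord0 r) (head ord0 (behead r)) (head ord0 (behead (behead r)))
          (head ord0 (behead (behead (behead r)))) (head ord0 (behead (behead (behead (behead r))))))
         [:: i'; j'; k'; l'; m']
  | |- forall (i j k l : 'I_7), ev (@?L i j k l) = ev (@?M i j k l) =>
    let i' := fresh in let j' := fresh in let k' := fresh in let l' := fresh in
    intros i' j' k' l';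
    go 4%N (fun r : env => L (head ord0 r) (head ord0 (behead r)) (head ord0 (behead (behead r)))
          (head ord0 (behead (behead (behead r)))))
         (fun r : env => M (head ord0 r) (head ord0 (behead r)) (head ord0 (behead (behead r)))
          (head ord0 (behead (behead (behead r))))) [:: i'; j'; k'; l']
  | |- forall (i j k : 'I_7), ev (@?L i j k) = ev (@?M i j k) =>
    let i' := fresh in let j' := fresh in let k' := fresh in
    intros i' j' k';
    go 3%N (fun r : env => L (head ord0 r) (head ord0 (behead r)) (head ord0 (behead (behead r))))
         (fun r : env => M (head ord0 r) (head ord0 (behead r)) (head ord0 (behead (behead r))))
         [:: i'; j'; k']
  | |- forall (i j : 'I_7), ev (@?L i j) = ev (@?M i j) =>
    let i' := fresh in let j' := fresh in
    intros i' j';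
    go 2%N (fun r : env => L (head ord0 r) (head ord0 (behead r)))
         (fun r : env => M (head ord0 r) (head ord0 (behead r))) [:: i'; j']
  | |- forall (i : 'I_7), ev (@?L i) = ev (@?M i) =>
    let i' := fresh in
    intros i'; go 1%N (fun r : env => L (head ord0 r)) (fun r : env => M (head ord0 r)) [:: i']
  | |- ev ?L = ev ?M => go 0%N (fun r : env => L) (fun r : env => M) (Nil 'I_7)
  end.

Definition zif (b : bool) : Z := if b then Z.one else Z0.

(** The lines of the Fano plane, oriented so that [phi0] is the 3-form
    [e123 + e145 + e167 + e246 - e257 - e347 - e356]; indices start at 0. *)
Definition fano : seq (nat * nat * nat) :=
  [:: (0, 1, 2); (0, 3, 4); (0, 5, 6); (1, 3, 5); (1, 6, 4); (2, 6, 3); (2, 5, 4)]%N.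

Definition on_fano (i j k : nat) : bool :=
  has (fun t => let: (a, b, c) := t in
    [|| [&& a == i, b == j & c == k], [&& b == i, c == j & a == k]
      | [&& c == i, a == j & b == k]]%N) fano.

Definition phi_table : seq (seq (seq Z)) := Eval vm_compute in
  [seq [seq [seq if on_fano i j k then Z.one
                 else if on_fano i k j then Z.opp Z.one else Z0
            | k <- iota 0 7] | j <- iota 0 7] | i <- iota 0 7].

Definition phi0 (i j k : 'I_7) : Z := nth Z0 (nth [::] (nth [::] phi_table i) j) k.

Lemma phi0_alt12 a b c : phi0 a b c = Z.opp (phi0 b a c).
Proof.
have H : all (fun a => all (fun b => all (fun c =>
    phi0 a b c == Z.opp (phi0 b a c)) ords7) ords7) ords7 by vm_compute.
have Ha := allP H a (mem_ords7 a); have Hb := allP Ha b (mem_ords7 b).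
exact/eqP/(allP Hb c (mem_ords7 c)).
Qed.

Lemma phi0_alt23 a b c : phi0 a b c = Z.opp (phi0 a c b).
Proof.
have H : all (fun a => all (fun b => all (fun c =>
    phi0 a b c == Z.opp (phi0 a c b)) ords7) ords7) ords7 by vm_compute.
have Ha := allP H a (mem_ords7 a); have Hb := allP Ha b (mem_ords7 b).
exact/eqP/(allP Hb c (mem_ords7 c)).
Qed.

Definition zsum7 (f : 'I_7 -> Z) : Z := foldr (fun i => Z.add (f i)) Z0 ords7.

Lemma zR_sum (R : comNzRingType) (f : 'I_7 -> Z) : \sum_i zR R (f i) = zR R (zsum7 f).
Proof. by rewrite sum_ords7 /zsum7; elim: ords7 => [|i s IH] //=; rewrite zRD IH. Qed.

Lemma zR_zif (R : comNzRingType) (b : bool) : zR R (zif b) = b%:R.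
Proof. by case: b. Qed.

(** The contraction identity taken as the definition of the dual form. *)
Definition psi0_def (i j k l : 'I_7) : Z :=
  Z.sub (Z.sub (Z.mul (zif (i == k)) (zif (j == l))) (Z.mul (zif (i == l)) (zif (j == k))))
        (zsum7 (fun p => Z.mul (phi0 i j p) (phi0 k l p))).

Definition psi_table : seq (seq (seq (seq Z))) := Eval vm_compute in
  [seq [seq [seq [seq psi0_def i j k l | l <- ords7] | k <- ords7] | j <- ords7]
  | i <- ords7].

(** Tabulated, because the decision procedure evaluates it many times. *)
Definition psi0 (i j k l : 'I_7) : Z :=
  nth Z0 (nth [::] (nth [::] (nth [::] psi_table i) j) k) l.

Lemma psi0E i j k l : psi0 i j k l = psi0_def i j k l.
Proof.
have H : all (fun i => all (fun j => all (fun k => all (fun l =>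
    psi0 i j k l == psi0_def i j k l) ords7) ords7) ords7) ords7 by vm_compute.
have Hi := allP H i (mem_ords7 i); have Hj := allP Hi j (mem_ords7 j).
have Hk := allP Hj k (mem_ords7 k); exact/eqP/(allP Hk l (mem_ords7 l)).
Qed.

Section G2Point.
Variables (R : realFieldType).
Local Notation J := (jet R 'I_7).
Variables (T : 'I_7 -> 'I_7 -> J) (phi : 'I_7 -> 'I_7 -> 'I_7 -> J).
Variables (psi Rm : 'I_7 -> 'I_7 -> 'I_7 -> 'I_7 -> J).

(** In the rest of this part [T], [phi], [psi], [V] and [Rm] stand for the jets
    of the torsion, the 3-form, its dual, the vector [VT] and the Riemann
    tensor in an adapted frame, of which the hypotheses record the relations. *)
Hypothesis phi_nil : forall i j k, jeval (phi i j k) = zR R (phi0 i j k).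
Hypothesis Dphi : forall c i j k, jshift c (phi i j k) = \sum_l T c l * psi l i j k.
Hypothesis psiE : forall i j k l, psi i j k l =
  (i == k)%:R * (j == l)%:R - (i == l)%:R * (j == k)%:R - \sum_p phi i j p * phi k l p.
Hypothesis phi12 : forall i j k, phi i j k = - phi j i k.
Hypothesis phi23 : forall i j k, phi i j k = - phi i k j.
Variable V : 'I_7 -> J.
Hypothesis VE : forall k, V k = \sum_i \sum_j phi i j k * T i j.
Hypothesis Rm12 : forall a b c d, Rm a b c d = - Rm b a c d.
Hypothesis Rm34 : forall a b c d, Rm a b c d = - Rm a b d c.
Hypothesis RmB : forall a b c d, Rm a b c d + Rm b c a d + Rm c a b d = 0.

(** The unknowns: the components of the five tensors, and Kronecker symbols. *)
Definition pt_atom (k : nat) (s : seq 'I_7) : J :=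
  match k, s with
  | 0%N, [:: i; j] => T i j
  | 1%N, [:: i; j; l] => phi i j l
  | 2%N, [:: i; j; l; m] => psi i j l m
  | 3%N, [:: i; j; l; m] => Rm i j l m
  | 4%N, [:: i; j] => (i == j)%:R
  | 5%N, [:: i] => V i
  | _, _ => 0
  end.

(** The unknowns of the normal forms carry the word of derivatives in front of
    the tensor indices, which are the last ones; hence the reversal. *)
Definition pt_val (k : nat) (s : seq 'I_7) : R :=
  match k, rev s with
  | 0%N, [:: j, i & u] => T i j (rev u)
  | 1%N, [:: l, j, i & u] => phi i j l (rev u)
  | 2%N, [:: m, l, j, i & u] => psi i j l m (rev u)
  | 3%N, [:: m, l, j, i & u] => Rm i j l m (rev u)
  | 5%N, [:: i & u] => V i (rev u)
  | _, _ => 0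
  end.

(** The derivatives of [phi], [psi] and [V] in terms of those of [T], obtained
    by differentiating [Dphi], [psiE] and [VE]. *)
Definition phi_d1 c i j k : spoly :=
  psum7 (fun l => pscale (psi0 l i j k) (fun=> patom 0 [:: c; l])).
Definition psi_d1 c i j k l : spoly :=
  popp (psum7 (fun p => padd (pscale (phi0 k l p) (fun=> phi_d1 c i j p))
                             (pscale (phi0 i j p) (fun=> phi_d1 c k l p)))).
Definition phi_d2 c d i j k : spoly :=
  psum7 (fun l => padd (pscale (psi0 l i j k) (fun=> patom 0 [:: d; c; l]))
                       (pmul (patom 0 [:: c; l]) (psi_d1 d l i j k))).

Definition V_d0 k : spoly :=
  psum7 (fun i => psum7 (fun j => pscale (phi0 i j k) (fun=> patom 0 [:: i; j]))).
Definition V_d1 c k : spoly :=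
  psum7 (fun i => psum7 (fun j => padd
    (pscale (phi0 i j k) (fun=> patom 0 [:: c; i; j]))
    (pmul (phi_d1 c i j k) (patom 0 [:: i; j])))).

(** A normal form for the components of an algebraic curvature tensor: the pair
    symmetries order the indices within and between the pairs, and the Bianchi
    identity removes one of the three components with four distinct indices. *)
Definition riem_nf3 (a b c d : 'I_7) : spoly :=
  if (c < b < d)%N && (a < c)%N then
    padd (patom 3 [:: a; c; b; d]) (patom 3 [:: a; d; c; b])
  else patom 3 [:: a; b; c; d].
Definition riem_nf2 (a b c d : 'I_7) : spoly :=
  if (c < a)%N || ((c == a) && (d < b)%N) then riem_nf3 c d a b else riem_nf3 a b c d.
Definition riem_nf1 (a b c d : 'I_7) : spoly :=
  if (c < d)%N then riem_nf2 a b c d else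
  if (d < c)%N then popp (riem_nf2 a b d c) else [::].
Definition riem_nf (a b c d : 'I_7) : spoly :=
  if (a < b)%N then riem_nf1 a b c d else
  if (b < a)%N then popp (riem_nf1 b a c d) else [::].

Definition pt_norm (k : nat) (s w : seq 'I_7) : spoly :=
  match k, s, w with
  | 0%N, [:: i; j], _ => patom 0 (w ++ s)
  | 1%N, [:: i; j; l], [::] => pcst (phi0 i j l)
  | 1%N, [:: i; j; l], [:: c] => phi_d1 c i j l
  | 1%N, [:: i; j; l], [:: c; d] => phi_d2 c d i j l
  | 1%N, [:: i; j; l], _ => patom 1 (w ++ s)
  | 2%N, [:: i; j; l; m], [::] => pcst (psi0 i j l m)
  | 2%N, [:: i; j; l; m], [:: c] => psi_d1 c i j l m
  | 2%N, [:: i; j; l; m], _ => patom 2 (w ++ s)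
  | 3%N, [:: i; j; l; m], [::] => riem_nf i j l m
  | 3%N, [:: i; j; l; m], _ => patom 3 (w ++ s)
  | 5%N, [:: i], [::] => V_d0 i
  | 5%N, [:: i], [:: c] => V_d1 c i
  | 5%N, [:: i], _ => patom 5 (w ++ s)
  | 4%N, [:: i; j], [::] => pcst (zif (eqn i j))
  | _, _, _ => [::]
  end.

Local Arguments padd : simpl never.
Local Arguments pmul : simpl never.
Local Arguments pscale : simpl never.
Local Arguments patom : simpl never.
Local Notation pev := (peval pt_val).

Lemma psi_nil i j k l : jeval (psi i j k l) = zR R (psi0 i j k l).
Proof.
rewrite psiE psi0E /psi0_def -[Z.sub _ _]/(Z.add _ (Z.opp _)) -[Z.sub _ _]/(Z.add _ (Z.opp _)).
rewrite !zRD !zRN !zRM !zR_zif -zR_sum 2!rmorphB /= !rmorphM /= !rmorph_nat rmorph_sum.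
by congr (_ - _); apply: eq_bigr => p _; rewrite zRM rmorphM /= !phi_nil.
Qed.

Lemma phi_d1P c i j k : phi i j k [:: c] = pev (phi_d1 c i j k).
Proof.
rewrite -[LHS]/(jeval (jshift c (phi i j k))) Dphi rmorph_sum peval_sum7.
by apply: eq_bigr => l _; rewrite rmorphM /= psi_nil peval_scale peval_atom mulrC.
Qed.

Lemma psi_d1P c i j k l : psi i j k l [:: c] = pev (psi_d1 c i j k l).
Proof.
have Db (b : bool) : jshift c (b%:R : J) = 0.
  have -> : b%:R = jcst b%:R :> J by case: b.
  exact: jshift_cst.
rewrite -[LHS]/(jeval (jshift c (psi i j k l))) psiE !jshiftB !jshiftM !Db.
rewrite !(mul0r, mulr0) addr0 subrr sub0r jshift_sum rmorphN rmorph_sum peval_opp peval_sum7.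
congr (- _); apply: eq_bigr => p _; rewrite jshiftM rmorphD !rmorphM /= !phi_nil.
rewrite -[jeval (jshift _ _)]/(phi i j p [:: c]) -[jeval (jshift _ _)]/(phi k l p [:: c]).
by rewrite !phi_d1P peval_add !peval_scale mulrC.
Qed.

Lemma phi_d2P c d i j k : phi i j k [:: c; d] = pev (phi_d2 c d i j k).
Proof.
rewrite -[LHS]/(jeval (jshift d (jshift c (phi i j k)))) Dphi jshift_sum rmorph_sum peval_sum7.
apply: eq_bigr => l _; rewrite jshiftM rmorphD !rmorphM /= psi_nil.
rewrite -[jeval (jshift d (psi _ _ _ _))]/(psi l i j k [:: d]) psi_d1P.
by rewrite peval_add peval_scale peval_mul !peval_atom mulrC.
Qed.

Lemma V_d0P k : V k [::] = pev (V_d0 k).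
Proof.
rewrite -[LHS]/(jeval (V k)) VE rmorph_sum peval_sum7; apply: eq_bigr => i _.
rewrite rmorph_sum peval_sum7; apply: eq_bigr => j _.
by rewrite rmorphM /= phi_nil peval_scale peval_atom.
Qed.

Lemma V_d1P c k : V k [:: c] = pev (V_d1 c k).
Proof.
rewrite -[LHS]/(jeval (jshift c (V k))) VE jshift_sum rmorph_sum peval_sum7.
apply: eq_bigr => i _; rewrite jshift_sum rmorph_sum peval_sum7; apply: eq_bigr => j _.
rewrite jshiftM rmorphD !rmorphM /= phi_nil peval_add peval_scale peval_mul !peval_atom.
by rewrite -phi_d1P addrC.
Qed.

(** The symmetry in the two pairs of indices follows from the other three. *)
Lemma riem_nfP a b c d : jeval (Rm a b c d) = pev (riem_nf a b c d).
Proof.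
pose r i j k l := jeval (Rm i j k l).
have r12 i j k l : r i j k l = - r j i k l by rewrite /r Rm12 rmorphN.
have r34 i j k l : r i j k l = - r i j l k by rewrite /r Rm34 rmorphN.
have rB i j k l : r i j k l + r j k i l + r k i j l = 0.
  by have := congr1 (@jeval _ _) (RmB i j k l); rewrite !rmorphD.
have r0 i k l : r i i k l = 0 by have := r12 i i k l; lra.
have r0' i j k : r i j k k = 0 by have := r34 i j k k; lra.
have pair i j k l : r i j k l = r k l i j.
  have := rB i j k l; have := rB j k l i; have := rB k l i j; have := rB l i j k.
  rewrite (r34 j k l i) (r34 k l j i) (r34 l i k j) (r12 l j k i) (r34 j l k i).
  rewrite (r12 i k l j) (r34 k i l j) (r34 i j l k); lra.
have vR i j k l : pev (patom 3 [:: i; j; k; l]) = r i j k l by rewrite peval_atom.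
have P3 i j k l : pev (riem_nf3 i j k l) = r i j k l.
  rewrite /riem_nf3; case: ifP => // _; rewrite peval_add !vR.
  have := rB i j k l; rewrite [r j k i l]pair (r12 k i j l) (r34 i l j k); lra.
have P2 i j k l : pev (riem_nf2 i j k l) = r i j k l.
  by rewrite /riem_nf2; case: ifP => _; rewrite P3 // pair.
have P1 i j k l : pev (riem_nf1 i j k l) = r i j k l.
  rewrite /riem_nf1; case: ltngtP => [_|_|/val_inj ->]; first exact: P2.
    by rewrite peval_opp P2 [RHS]r34.
  by rewrite peval_nil r0'.
rewrite -[LHS]/(r a b c d) /riem_nf; case: ltngtP => [_|_|/val_inj ->].
- by rewrite P1.
- by rewrite peval_opp P1 r12.
- by rewrite peval_nil r0.
Qed.

Lemma pt_normP k s w : pt_atom k s w = pev (pt_norm k s w).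
Proof.
have R0 : (0 : J) w = 0 by case: w.
case: k => [|[|[|[|[|[|k]]]]]]; last by rewrite peval_nil.
- case: s => [|i [|j [|? ?]]]; rewrite ?peval_nil // peval_atom.
  by rewrite /pt_val rev_cat /= revK.
- case: s => [|i [|j [|l [|? ?]]]]; rewrite ?peval_nil //.
  case: w R0 => [|c [|d [|e w]]] _; rewrite /pt_norm.
  + by rewrite peval_cst -phi_nil.
  + exact: phi_d1P.
  + exact: phi_d2P.
  + by rewrite peval_atom /pt_val rev_cat /= revK.
- case: s => [|i [|j [|l [|m [|? ?]]]]]; rewrite ?peval_nil //.
  case: w R0 => [|c [|e w]] _; rewrite /pt_norm.
  + by rewrite peval_cst -psi_nil.
  + exact: psi_d1P.
  + by rewrite peval_atom /pt_val rev_cat /= revK.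
- case: s => [|i [|j [|l [|m [|? ?]]]]]; rewrite ?peval_nil //.
  case: w R0 => [|c w] _; rewrite /pt_norm.
  + exact: riem_nfP.
  + by rewrite peval_atom /pt_val rev_cat /= revK.
- case: s => [|i [|j [|? ?]]]; rewrite ?peval_nil //.
  have -> : pt_atom 4 [:: i; j] = jcst (i == j)%:R by rewrite /=; case: (i == j).
  case: w R0 => [|c w] _; rewrite /pt_norm ?peval_nil // peval_cst.
  by rewrite -[eqn i j]/(i == j); case: (i == j).
- case: s => [|i [|? ?]]; rewrite ?peval_nil //.
  case: w R0 => [|c [|e w]] _; rewrite /pt_norm.
  + exact: V_d0P.
  + exact: V_d1P.
  + by rewrite peval_atom /pt_val rev_cat /= revK.
Qed.

Definition pt_sound n e1 e2 r :=
  @checkP R J (idfun : {rmorphism J -> J}) (@jshift R 'I_7) (fun _ _ => erefl)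
    pt_atom pt_val pt_norm pt_normP n e1 e2 r.

Ltac pt_reify t :=
  lazymatch t with
  | fun r : env => @GRing.natmul _ _ (nat_of_bool (@?i r == @?j r)) =>
      constr:(CAtom 4 (fun r => [:: i r; j r]))
  | fun r : env => T (@?i r) (@?j r) => constr:(CAtom 0 (fun r => [:: i r; j r]))
  | fun r : env => phi (@?i r) (@?j r) (@?k r) => constr:(CAtom 1 (fun r => [:: i r; j r; k r]))
  | fun r : env => psi (@?i r) (@?j r) (@?k r) (@?l r) =>
      constr:(CAtom 2 (fun r => [:: i r; j r; k r; l r]))
  | fun r : env => Rm (@?i r) (@?j r) (@?k r) (@?l r) =>
      constr:(CAtom 3 (fun r => [:: i r; j r; k r; l r]))
  | fun r : env => V (@?i r) => constr:(CAtom 5 (fun r => [:: i r]))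
  end.
Ltac pt_decide := decide_with pt_reify pt_sound (@jeval R 'I_7).

Local Notation D := (@jshift R 'I_7).
Local Notation "''C' [ a , b ] x" := (jshift a (jshift b x) - jshift b (jshift a x))
  (at level 9, a, b at level 99, x at level 8).

Definition ptr : J := \sum_i T i i.
Definition pP i j : J := \sum_a \sum_b psi a b i j * T a b.

(** The expression of the Ricci tensor through the torsion, with [V = VT]. *)
Definition pRic a l : J :=
  - D a (V l) + \sum_b \sum_m phi b m l * D b (T a m)
  - \sum_b T a b * T b l + ptr * T a l.

(** The trace of [pRic], in a form without derivatives of [phi]
    (see [pRic_trace]). *)
Definition pScal : J :=
  - (2%:R * \sum_a D a (V a)) + \sum_a \sum_b \sum_m \sum_l psi l a m b * (T a m * T b l)
  - \sum_a \sum_b T a b * T b a + ptr * ptr.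

(** Contracted with [psi], this is the commutator [D_a D_b phi - D_b D_a phi]. *)
Definition pF a b l : J :=
  D a (T b l) - D b (T a l) - \sum_i \sum_j phi i j l * (T a i * T b j).

(** For each [l], a triple [ijk] with [psi_lijk = 1].  Since [psi_mijk] vanishes
    for the other values of [m], the component [ijk] of the contraction of a
    vector [X] with [psi] is [X_l]. *)
Definition psi_triple (l : 'I_7) : 'I_7 * 'I_7 * 'I_7 :=
  head (ord0, ord0, ord0)
   [seq t <- [seq (i, jk.1, jk.2) | i <- ords7, jk <- [seq (j, k) | j <- ords7, k <- ords7]]
    | Z.eqb (psi0 l t.1.1 t.1.2 t.2) Z.one].
Definition psi_triple_table := Eval vm_compute in [seq psi_triple l | l <- ords7].
Definition tri (l : 'I_7) := nth (ord0, ord0, ord0) psi_triple_table l.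
Local Notation t1 l := (tri l).1.1.
Local Notation t2 l := (tri l).1.2.
Local Notation t3 l := (tri l).2.

(** The commutator of the derivatives of [phi] is a vector-valued 2-form
    contracted with [psi], because [nabla phi] is and the remaining terms,
    quadratic in [T], combine with the help of the G2 identities; one component
    of it recovers the vector. *)
Lemma comm_phi_F : forall a b l,
  jeval ('C[a, b] (phi (t1 l) (t2 l) (t3 l))) = jeval (pF a b l).
Proof.
rewrite /pF.
pt_decide.
Qed.

(** The same component of the action of the curvature on [phi]: the action of a
    skew matrix on [phi] only sees its part in the 7-dimensional
    representation. *)
Lemma curv_phi_F : forall a b l, jeval (2%:R *
    (- (\sum_m phi m (t2 l) (t3 l) * Rm a b (t1 l) m) - (\sum_m phi (t1 l) m (t3 l) * Rm a b (t2 l) m)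
     - (\sum_m phi (t1 l) (t2 l) m * Rm a b (t3 l) m))) =
  jeval (\sum_i \sum_j phi i j l * Rm a b i j).
Proof.
pt_decide.
Qed.

Lemma Ric_sym : forall a l, jeval (\sum_b Rm b a l b) = jeval (\sum_b Rm b l a b).
Proof. pt_decide. Qed.

(** The algebraic Bianchi identity allows one to recover the Ricci tensor from
    the 7-dimensional part of the curvature: on the complementary part, with
    values in the Lie algebra of G2, the Ricci contraction vanishes. *)
Lemma Ric_from_F : forall a l, jeval (2%:R * \sum_b Rm b a l b) =
  jeval (- \sum_b \sum_m phi b m l * (\sum_i \sum_j phi i j m * Rm a b i j)).
Proof.
pt_decide.
Qed.

Lemma pRic_from_F : forall a l, jeval (pRic a l) =
  jeval (- \sum_b \sum_m phi b m l * pF a b m).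
Proof.
rewrite /pRic /ptr /pF.
pt_decide.
Qed.

(** The four definitions below are the ingredients of the Bianchi operator,
    multiplied by constants that clear the denominators.  [pS] is the
    composition of [T] with the contraction of [VT] into [phi]; [pN] is
    [18 (Ptilde1 + Ric)]; [pX] is [3 P2]. *)
Definition pS a b : J := \sum_p T a p * \sum_i phi i p b * V i.
Definition pN a b : J :=
  - (6%:R * (D a (V b) + D b (V a))) - 6%:R * (pS a b + pS b a)
  + 9%:R * (ptr * (T a b + T b a))
  + (a == b)%:R * (6%:R * (\sum_i \sum_j T i j * T i j) - 2%:R * \sum_i V i * V i).
Definition pX k : J := 2%:R * \sum_a D a (T a k) + D k ptr + ptr * V k.

(** [72 Btilde (Ptilde1, P2)], with the Ricci tensor replaced by [pRic].  The
    divergence of [18 pRic] is written as [12 pRic k a + 6 pRic a k]: [pRic] is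
    symmetric, and this weighting makes all second derivatives of [T] cancel up
    to commutators. *)
Definition pBianchi k : J :=
  4%:R * (\sum_a D a (pN a k) - \sum_a D a (12%:R * pRic k a + 6%:R * pRic a k))
  - D k (\sum_a pN a a - 18%:R * pScal)
  + 12%:R * (\sum_a \sum_b phi a b k * D a (pX b))
  - 12%:R * (\sum_i pX i * pP i k) - 24%:R * \sum_j T k j * pX j.

(** What remains of [pBianchi] when its second derivatives are collected into
    commutators.  [CV] and [CT] stand for the commutators on [V] and [T], [Rc]
    for the Ricci tensor, and [F2] for [2 pF], that is for the part
    [phi_ijl R_abij] of the curvature. *)
Definition pRest (CV : 'I_7 -> 'I_7 -> 'I_7 -> J) (CT : 'I_7 -> 'I_7 -> 'I_7 -> 'I_7 -> J)
    (Rc : 'I_7 -> 'I_7 -> J) (F2 : 'I_7 -> 'I_7 -> 'I_7 -> J) (k : 'I_7) : J :=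
  24%:R * (\sum_l CV l k l - \sum_l \sum_b \sum_m phi b m l * CT l b k m
           + \sum_a \sum_b phi a b k * \sum_c CT a c c b)
  + 6%:R * (\sum_a \sum_b phi a b k * \sum_i CT a b i i)
  - 24%:R * (\sum_m Rc k m * V m + \sum_n \sum_m F2 k n m * T n m
             - \sum_a \sum_b phi a b k * \sum_n Rc n a * T n b)
  + 12%:R * (\sum_c \sum_n F2 c n k * T c n)
  - 18%:R * (\sum_a T k a * \sum_l F2 a l l) + 3%:R * (ptr * \sum_l F2 k l l)
  + 6%:R * (\sum_c T k c * \sum_a \sum_b phi a b c * (Rc a b - Rc b a))
  - 3%:R * (ptr * \sum_a \sum_b phi a b k * (Rc a b - Rc b a)).

Lemma pBianchi_rest : forall k, jeval (pBianchi k) =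
  jeval (pRest (fun a b c => 'C[a, b] (V c)) (fun a b c d => 'C[a, b] (T c d)) pRic
     (fun a b l => 2%:R * pF a b l) k).
Proof.
rewrite /pBianchi /pRest /pN /pX /pS /pRic /pF /pP /pScal /ptr.
pt_decide.
Qed.

(** Once commutators are replaced by curvature, everything is linear in the
    Riemann tensor, and cancels by its algebraic symmetries. *)
Lemma pRest_curv : forall k, jeval (pRest (fun a b c => - \sum_m Rm a b c m * V m)
   (fun a b c d => - (\sum_m Rm a b c m * T m d) - \sum_m Rm a b d m * T c m)
   (fun a l => \sum_b Rm b a l b) (fun a b l => \sum_i \sum_j phi i j l * Rm a b i j) k) =
 jeval (0 : J).
Proof.
rewrite /pRest /ptr.
pt_decide.
Qed.

Hypothesis comm_phi : forall a b i j k, 'C[a, b] (phi i j k) =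
  - \sum_m Rm a b i m * phi m j k - \sum_m Rm a b j m * phi i m k
  - \sum_m Rm a b k m * phi i j m.
Hypothesis comm_T : forall a b c d, 'C[a, b] (T c d) =
  - \sum_m Rm a b c m * T m d - \sum_m Rm a b d m * T c m.
Hypothesis comm_V : forall a b c, 'C[a, b] (V c) = - \sum_m Rm a b c m * V m.

(** The two ways of computing the commutator on [phi] are compared. *)
Lemma jeval_F a b l :
  jeval (2%:R * pF a b l) = jeval (\sum_i \sum_j phi i j l * Rm a b i j).
Proof.
rewrite -curv_phi_F 2!rmorphM /=; congr (_ * _); rewrite -comm_phi_F comm_phi.
by do ![congr jeval || congr (_ + _) || congr (- _)]; apply: eq_bigr => m _; rewrite mulrC.
Qed.

(** Equality at the base point is a congruence, which lets the four kinds of terms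
    in [pRest] be replaced one by one. *)
Definition jeqv (x y : J) := jeval x = jeval y.
Lemma jeqvD x x' y y' : jeqv x x' -> jeqv y y' -> jeqv (x + y) (x' + y').
Proof. by rewrite /jeqv !rmorphD /= => -> ->. Qed.
Lemma jeqvM x x' y y' : jeqv x x' -> jeqv y y' -> jeqv (x * y) (x' * y').
Proof. by rewrite /jeqv !rmorphM /= => -> ->. Qed.
Lemma jeqvN x x' : jeqv x x' -> jeqv (- x) (- x').
Proof. by rewrite /jeqv !rmorphN /= => ->. Qed.
Lemma jeqv_sum (F G : 'I_7 -> J) :
  (forall i, jeqv (F i) (G i)) -> jeqv (\sum_i F i) (\sum_i G i).
Proof. by move=> FG; rewrite /jeqv !rmorph_sum; apply: eq_bigr => i _; exact: FG. Qed.

Lemma jeval_Ric a l : jeval (\sum_b Rm b a l b) = jeval (pRic a l).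
Proof.
have two : (2%:R : R) != 0 by rewrite pnatr_eq0.
apply: (mulfI two).
transitivity (jeval (2%:R * \sum_b Rm b a l b)); first by rewrite rmorphM /= rmorph_nat.
transitivity (jeval (2%:R * pRic a l)); last by rewrite rmorphM /= rmorph_nat.
rewrite Ric_from_F [RHS]rmorphM /= pRic_from_F -rmorphM /= mulrN mulr_sumr.
rewrite -![jeval _ = jeval _]/(jeqv _ _); apply: jeqvN; apply: jeqv_sum => b.
rewrite mulr_sumr; apply: jeqv_sum => m; rewrite mulrCA; apply: jeqvM => //.
exact/esym/jeval_F.
Qed.

Lemma jeval_Ric_sym a l : jeval (pRic a l) = jeval (pRic l a).
Proof. by rewrite -!jeval_Ric Ric_sym. Qed.

Lemma pBianchi0 k : jeval (pBianchi k) = 0.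
Proof.
rewrite pBianchi_rest -[RHS]/(jeval (0 : J)) -(pRest_curv k) -[jeval _ = _]/(jeqv _ _) /pRest.
repeat match goal with
| |- jeqv (pRic _ _) _ => exact/esym/jeval_Ric
| |- jeqv (2%:R * pF _ _ _) _ => exact: jeval_F
| |- jeqv ('C[_, _] (V _)) _ => by rewrite comm_V
| |- jeqv ('C[_, _] (T _ _)) _ => by rewrite comm_T
| |- jeqv ?x ?x => reflexivity
| |- jeqv (\sum_i _) _ => apply: jeqv_sum => ?
| |- jeqv (_ * _) _ => apply: jeqvM
| |- jeqv (- _) _ => apply: jeqvN
| |- jeqv (_ + _) _ => apply: jeqvD
end.
Qed.

(** An identity of jets and not only of values, as it is going to be
    differentiated. *)
Lemma pRic_trace : \sum_a pRic a a = pScal.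
Proof.
rewrite /pRic /pScal !big_split /= !sumrN -mulr_sumr.
have -> : \sum_a \sum_b \sum_m phi b m a * D b (T a m) =
  - (\sum_a D a (V a)) + \sum_a \sum_b \sum_m \sum_l psi l a m b * (T a m * T b l).
  have -> : \sum_a D a (V a) = \sum_b \sum_a \sum_m phi a m b * D b (T a m)
     + \sum_b \sum_a \sum_m D b (phi a m b) * T a m.
    rewrite -big_split; apply: eq_bigr => b _ /=; rewrite VE jshift_sum -big_split.
    apply: eq_bigr => a _; rewrite jshift_sum -big_split; apply: eq_bigr => m _ /=.
    by rewrite jshiftM addrC.
  have -> : \sum_b \sum_a \sum_m D b (phi a m b) * T a m =
            \sum_a \sum_b \sum_m \sum_l psi l a m b * (T a m * T b l).
    rewrite exchange_big; apply: eq_bigr => a _; apply: eq_bigr => b _.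
    apply: eq_bigr => m _; rewrite Dphi mulr_suml; apply: eq_bigr => l _ /=; ring.
  rewrite opprD addrNK exchange_big -sumrN; apply: eq_bigr => b _; rewrite -sumrN.
  apply: eq_bigr => a _; rewrite -sumrN; apply: eq_bigr => m _.
  by rewrite phi23 phi12 phi23 !mulNr !opprK.
rewrite -/ptr; ring.
Qed.

End G2Point.

(** * The Levi-Civita symbol *)

Section TupleSums.
Variables (T : finType).

Lemma sum_tuple_cons (V : nmodType) n (G : n.+1.-tuple T -> V) :
  \sum_t G t = \sum_x \sum_(t : n.-tuple T) G [tuple of x :: t].
Proof.
rewrite pair_big /=.
rewrite (reindex (fun p : T * n.-tuple T => [tuple of p.1 :: p.2])) //=.
exists (fun t : n.+1.-tuple T => (thead t, [tuple of behead t])).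
  by move=> [x t] _ /=; rewrite theadE; congr (_, _); apply: val_inj.
by move=> t _ /=; rewrite [RHS]tuple_eta.
Qed.

Lemma sum_tuple0 (V : nmodType) (G : 0.-tuple T -> V) : \sum_t G t = G [tuple].
Proof. by rewrite (big_pred1 [tuple]) // => t; apply/esym/eqP; exact: tuple0. Qed.

Lemma sum_tuple_prod (R : comNzRingType) n (F : 'I_n -> T -> R) :
  \sum_(t : n.-tuple T) \prod_(r < n) F r (tnth t r) = \prod_(r < n) \sum_a F r a.
Proof.
elim: n F => [|n IH] F; first by rewrite sum_tuple0 !big_ord0.
rewrite sum_tuple_cons big_ord_recl /= -IH mulr_suml; apply: eq_bigr => x _.
rewrite mulr_sumr; apply: eq_bigr => t _; rewrite big_ord_recl tnth0; congr (_ * _).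
by apply: eq_bigr => i _; rewrite tnthS.
Qed.

Lemma sum_tuple7 (V : nmodType) (G : 7.-tuple T -> V) :
  \sum_t G t = \sum_a \sum_b \sum_c \sum_d \sum_e \sum_f \sum_h G [tuple a; b; c; d; e; f; h].
Proof.
do ![rewrite sum_tuple_cons; apply: eq_bigr => ? _].
by rewrite sum_tuple0; congr G; apply: val_inj.
Qed.
End TupleSums.

Section LeviCivitaSymbol.
Variable R : realType.

Definition levi (t : 7.-tuple 'I_7) : R := \det (\matrix_(r < 7, s < 7) (tnth t r == s)%:R).

(** The rows of [F] selected by [t] form the product of the selection matrix and
    [F]. *)
Lemma levi_sum (F : 'M[R]_7) t :
  \sum_(p : 7.-tuple 'I_7) levi p * \prod_(r < 7) F (tnth t r) (tnth p r) = levi t * \det F.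
Proof.
have -> : levi t * \det F = \det (\matrix_(r < 7, s < 7) F (tnth t r) s).
  rewrite -det_mulmx; congr (\det _); apply/matrixP => r s; rewrite !mxE.
  rewrite (bigD1 (tnth t r)) //= !mxE eqxx mul1r big1 ?addr0 // => k kt.
  by rewrite !mxE eq_sym (negbTE kt) mul0r.
rewrite /levi /determinant; under eq_bigr => p _ do rewrite mulr_suml.
rewrite exchange_big; apply: eq_bigr => s _ /=.
under eq_bigr => p _ do rewrite -mulrA -big_split /=.
rewrite -mulr_sumr; congr (_ * _).
apply: etrans (etrans _ (sum_tuple_prod (fun r a => (a == s r)%:R * F (tnth t r) a))) _.
  by apply: eq_bigr => p _; apply: eq_bigr => r _; rewrite mxE.
apply: eq_bigr => r _; rewrite mxE (bigD1 (s r)) //= eqxx mul1r big1 ?addr0 // => k ks.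
by rewrite (negbTE ks) mul0r.
Qed.

(** The sign of a sequence is the product of the signs of the differences of its
    entries; with integers it can be computed. *)
Fixpoint sgn_row (x : 'I_7) (s : seq 'I_7) : Z :=
  if s is y :: u then
    match Nat.compare x y with Eq => Z0 | Lt => sgn_row x u | Gt => Z.opp (sgn_row x u) end
  else Z.one.

Fixpoint epsZ (s : seq 'I_7) : Z :=
  if s is x :: u then
    match sgn_row x u with Z0 => Z0 | z => Z.mul z (epsZ u) end
  else Z.one.

Lemma sgn_rowE x s : zR R (sgn_row x s) = \prod_(y <- s) Num.sg ((y : nat)%:R - (x : nat)%:R).
Proof.
elim: s => [|y s IH]; first by rewrite big_nil.
rewrite big_cons /=; case: (PeanoNat.Nat.compare_spec x y) => xy.
- by rewrite (val_inj xy) subrr sgr0 mul0r.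
- by rewrite IH gtr0_sg ?mul1r // subr_gt0 ltr_nat; lia.
- by rewrite zRN IH ltr0_sg ?mulN1r // subr_lt0 ltr_nat; lia.
Qed.

Fixpoint sg_pairs (s : seq 'I_7) : R :=
  if s is x :: u then (\prod_(y <- u) Num.sg ((y : nat)%:R - (x : nat)%:R)) * sg_pairs u else 1.

Lemma epsZE s : zR R (epsZ s) = sg_pairs s.
Proof.
elim: s => [|x s IH] //=; rewrite -sgn_rowE -IH.
by case: (sgn_row x s) => [|p|p]; rewrite -?zRM // /zR mul0r.
Qed.

Lemma sg_pairsE s : sg_pairs s =
  Num.sg (\prod_(i < size s) \prod_(j < size s | (i < j)%N)
    ((nth ord0 s j : nat)%:R - (nth ord0 s i : nat)%:R : R)).
Proof.
elim: s => [|x s IH] /=; first by rewrite big_ord0 sgr1.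
rewrite big_ord_recl /= sgrM; congr (_ * _).
  rewrite (big_morph _ (@sgrM R) (@sgr1 R)) (big_nth ord0) big_mkord.
  by rewrite [RHS]big_mkcond [RHS]big_ord_recl /= mul1r.
rewrite IH; congr Num.sg; apply: eq_bigr => i _.
by rewrite [RHS]big_mkcond [RHS]big_ord_recl /= mul1r -big_mkcond.
Qed.

(** Multiplying the selection matrix by the Vandermonde matrix of [0 .. 6] gives
    the Vandermonde matrix of the indices, whose determinant is the product of
    their differences; the symbol is the sign of this product. *)
Lemma leviE a b c d e f h :
  levi_civita R a b c d e f h = zR R (epsZ [:: a; b; c; d; e; f; h]).
Proof.
set t := [tuple a; b; c; d; e; f; h].
rewrite epsZE sg_pairsE -[LHS]/(levi t).
have lsg : levi t = Num.sg (levi t).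
  have [inj|] := boolP (injectiveb (tnth t)).
    have -> : levi t = \det (perm_mx (perm (injectiveP _ inj))).
      congr (\det _); apply/matrixP => r s; rewrite !mxE permE; congr (_%:R).
    by rewrite det_perm; case: odd_perm; rewrite ?expr0 ?expr1 ?sgr1 ?sgrN1.
  move=> /injectivePn [r [s rs E]].
  by rewrite /levi (determinant_alternate rs) ?sgr0 // => k; rewrite !mxE E.
pose v : 'rV[R]_7 := \row_r (tnth t r : nat)%:R.
pose w : 'rV[R]_7 := \row_r (r : nat)%:R.
have V : levi t * \det (Vandermonde 7 w)^T = \det (Vandermonde 7 v)^T.
  rewrite /levi -det_mulmx; congr (\det _); apply/matrixP => r s; rewrite !mxE.
  rewrite (bigD1 (tnth t r)) //= !mxE eqxx mul1r big1 ?addr0 // => k kt.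
  by rewrite !mxE eq_sym (negbTE kt) mul0r.
have w0 : 0 < \det (Vandermonde 7 w)^T.
  rewrite det_tr det_Vandermonde; apply: prodr_gt0 => i _; apply: prodr_gt0 => j ij.
  by rewrite !mxE subr_gt0 ltr_nat.
rewrite lsg -[LHS]mulr1 -[X in _ * X = _](gtr0_sg w0) -sgrM V det_tr det_Vandermonde; congr Num.sg.
apply: eq_bigr => i _; apply: eq_bigr => j _; rewrite !mxE !(tnth_nth ord0) //.
Qed.

End LeviCivitaSymbol.

(** * Change of frame *)

Section FrameChange.
Variables (R : realType).
Local Notation I := 'I_7.
Implicit Types (F : 'M[R]_7) (phi : I -> I -> I -> R).

Definition slot3 F (X : I -> I -> I -> R) p q r : R :=
  slot F (fun a => slot F (fun b => slot F (fun c => X a b c) r) q) p.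
Definition slot4 F (X : I -> I -> I -> I -> R) p q r s : R :=
  slot F (fun a => slot3 F (X a) q r s) p.
Definition slot7 F (X : I -> I -> I -> I -> I -> I -> I -> R) p q r s t u v : R :=
  slot3 F (fun a b c => slot4 F (X a b c) s t u v) p q r.

Lemma slot3C F (X : I -> I -> I -> I -> R) z p q r :
  slot F (fun i => slot3 F (X i) p q r) z =
  slot3 F (fun a b c => slot F (fun i => X i a b c) z) p q r.
Proof.
rewrite /slot3 slotC; apply: eq_slot => a; rewrite slotC; apply: eq_slot => b.
by rewrite slotC.
Qed.

Lemma slot7_sum F X p q r s t u v :
  slot7 F X p q r s t u v =
  \sum_(z : 7.-tuple I) (\prod_(i < 7) F (tnth [tuple p; q; r; s; t; u; v] i) (tnth z i)) *
    X (tnth z (@Ordinal 7 0 isT)) (tnth z (@Ordinal 7 1 isT)) (tnth z (@Ordinal 7 2 isT))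
      (tnth z (@Ordinal 7 3 isT)) (tnth z (@Ordinal 7 4 isT)) (tnth z (@Ordinal 7 5 isT))
      (tnth z (@Ordinal 7 6 isT)).
Proof.
rewrite sum_tuple7 /slot7 /slot3 /slot4 /slot3 /slot.
apply: eq_bigr => a _; rewrite mulr_sumr; apply: eq_bigr => b _.
rewrite !mulr_sumr; apply: eq_bigr => c _; rewrite !mulr_sumr; apply: eq_bigr => d _.
rewrite !mulr_sumr; apply: eq_bigr => e _; rewrite !mulr_sumr; apply: eq_bigr => f _.
rewrite !mulr_sumr; apply: eq_bigr => h _.
by rewrite !big_ord_recl big_ord0 /= /tnth /= mulr1 !mulrA.
Qed.

Lemma slot7_levi F p q r s t u v :
  slot7 F (levi_civita R) p q r s t u v = levi_civita R p q r s t u v * \det F.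
Proof.
rewrite slot7_sum -[levi_civita R _ _ _ _ _ _ _]/(levi R [tuple p; q; r; s; t; u; v]) -levi_sum.
apply: eq_bigr => z _; rewrite mulrC; congr (levi R _ * _).
apply: eq_from_tnth => i; rewrite (tnth_nth ord0).
by case: i => -[|[|[|[|[|[|[|//]]]]]]] Hi; rewrite /=; congr (tnth z _); apply: val_inj.
Qed.

(** The coefficient of the top form [al /\ be /\ ga], up to the factor 24. *)
Definition Wsum (al be : I -> I -> R) (ga : I -> I -> I -> R) : R :=
  \sum_a \sum_b \sum_c \sum_d \sum_e \sum_f \sum_h
    levi_civita R a b c d e f h * al a b * be c d * ga e f h.

Definition slot_2 F (X : I -> I -> R) p q : R := slot F (fun a => slot F (X a) q) p.

(** A top form is multiplied by the determinant. *)
Lemma Wsum_slot F al be ga :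
  Wsum (slot_2 F al) (slot_2 F be) (slot3 F ga) = \det F * Wsum al be ga.
Proof.
have S (G : 7.-tuple I -> R) (H : I -> I -> I -> I -> I -> I -> I -> R) :
   (forall a b c d e f h, H a b c d e f h = G [tuple a; b; c; d; e; f; h]) ->
   \sum_a \sum_b \sum_c \sum_d \sum_e \sum_f \sum_h H a b c d e f h = \sum_t G t.
  move=> HG; rewrite sum_tuple7; do 7 (apply: eq_bigr => ? _); exact: HG.
pose o k (Hk : (k < 7)%N) := @Ordinal 7 k Hk.
pose M (z : 7.-tuple I) :=
  al (tnth z (@Ordinal 7 0 isT)) (tnth z (@Ordinal 7 1 isT)) *
  be (tnth z (@Ordinal 7 2 isT)) (tnth z (@Ordinal 7 3 isT)) *
  ga (tnth z (@Ordinal 7 4 isT)) (tnth z (@Ordinal 7 5 isT)) (tnth z (@Ordinal 7 6 isT)).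
have ME a b c d e f h : M [tuple a; b; c; d; e; f; h] = al a b * be c d * ga e f h by [].
have leviT a b c d e f h :
  levi_civita R a b c d e f h = levi R [tuple a; b; c; d; e; f; h] by [].
have MF a b c d e f h : slot_2 F al a b * slot_2 F be c d * slot3 F ga e f h =
    \sum_(y : 7.-tuple I)
      (\prod_(i < 7) F (tnth [tuple a; b; c; d; e; f; h] i) (tnth y i)) * M y.
  rewrite -(slot7_sum F (fun a b c d e f h => al a b * be c d * ga e f h)).
  rewrite /slot7 /slot4 /slot3 /slot_2 -slotZr -slotZr.
  apply: eq_slot => i /=; rewrite -slotZr -slotZr; apply: eq_slot => j /=.
  rewrite -(slotZ F (al i j)) -slotZr; apply: eq_slot => k /=; rewrite -(slotZ F (al i j)) -slotZr; apply: eq_slot => l /=.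
  rewrite -slotZ; apply: eq_slot => m /=; rewrite -slotZ; apply: eq_slot => u /=.
  by rewrite -slotZ.
rewrite /Wsum (S (fun z => levi R z * \sum_(y : 7.-tuple I)
     (\prod_(i < 7) F (tnth z i) (tnth y i)) * M y)); last first.
  by move=> *; rewrite -MF leviT !mulrA.
rewrite (S (fun z => levi R z * M z)); last by move=> *; rewrite ME leviT !mulrA.
under eq_bigr => z _ do rewrite mulr_sumr.
rewrite exchange_big mulr_sumr; apply: eq_bigr => y _ /=.
under eq_bigr => z _ do rewrite mulrA.
rewrite -mulr_suml [RHS]mulrA [\det F * _]mulrC -[\det F]det_tr -levi_sum; congr (_ * _).
by apply: eq_bigr => z _; congr (_ * _); apply: eq_bigr => i _; rewrite mxE.
Qed.

Section Contraction.
Variables (G Gi F : 'M[R]_7).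
Hypothesis GiG : Gi *m G = 1%:M.
Hypothesis FGF : F *m G *m F^T = 1%:M.

(** The inverse metric is the sum of the squares of the vectors of an orthonormal
    frame. *)
Lemma ginv_FF : Gi = F^T *m F.
Proof.
have /mulmx1C H : F *m (G *m F^T) = 1%:M by rewrite mulmxA.
by rewrite -[LHS]mulmx1 -H mulmxA mulmxA GiG mul1mx.
Qed.

Definition ctr (X : I -> I -> R) := \sum_a \sum_b Gi a b * X a b.

Lemma ctr_slot X : ctr X = \sum_p slot_2 F X p p.
Proof.
rewrite /ctr /slot_2 /slot ginv_FF exchange_big.
under eq_bigr => b _ do under eq_bigr => a _ do rewrite mxE mulr_suml.
rewrite exchange_big; under eq_bigr => b _ do rewrite exchange_big.
rewrite exchange_big; apply: eq_bigr => p _ /=.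
apply: eq_bigr => a _; rewrite mulr_sumr; apply: eq_bigr => b _.
by rewrite !mxE mulrA.
Qed.

Lemma ctrM (u v : I -> R) : ctr (fun a b => u a * v b) = \sum_p slot F u p * slot F v p.
Proof.
rewrite ctr_slot; apply: eq_bigr => p _; rewrite /slot_2 -slotZr.
by apply: eq_slot => a; rewrite slotZ.
Qed.

Lemma eq_ctr X Y : (forall a b, X a b = Y a b) -> ctr X = ctr Y.
Proof. by move=> XY; apply: eq_bigr => a _; apply: eq_bigr => b _; rewrite XY. Qed.

Lemma ctr_sum (X : I -> I -> I -> R) : ctr (fun a b => \sum_p X p a b) = \sum_p ctr (X p).
Proof.
rewrite /ctr [RHS]exchange_big; apply: eq_bigr => a _ /=; rewrite [RHS]exchange_big.
by apply: eq_bigr => b _; rewrite mulr_sumr.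
Qed.

Lemma det_sqr : (\det F) ^+ 2 * \det G = 1.
Proof. by have := congr1 determinant FGF; rewrite !det_mulmx det_tr det1 => <-; ring. Qed.

(** The components in the frame of the dual of [phi] with respect to the volume
    form with coefficient [vol]: all contractions become sums, and the four free
    indices of the Levi-Civita symbol together with the three summed ones
    produce the determinant of the frame. *)
Lemma slot4_dual phi (vol : R) i j k l :
  slot4 F (fun i j k l => ctr (fun a a' => ctr (fun b b' => ctr (fun d d' =>
     phi a b d * (vol * levi_civita R a' b' d' i j k l))))) i j k l =
  \sum_p \sum_q \sum_r slot3 F phi p q r * (vol * \det F * levi_civita R p q r i j k l).
Proof.
pose Lp p q r i j k l := slot3 F (fun a b d => levi_civita R a b d i j k l) p q r.
have E i' j' k' l' : ctr (fun a a' => ctr (fun b b' => ctr (fun d d' =>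
     phi a b d * (vol * levi_civita R a' b' d' i' j' k' l')))) =
     \sum_p \sum_q \sum_r (slot3 F phi p q r * vol) * Lp p q r i' j' k' l'.
  pose Y a' b' r := slot F (fun d' => levi_civita R a' b' d' i' j' k' l') r.
  transitivity (ctr (fun a a' => \sum_q \sum_r slot F (fun b => slot F (phi a b) r) q * (vol * slot F (fun b' => Y a' b' r) q))).
    apply: eq_ctr => a a'.
    transitivity (ctr (fun b b' => \sum_r slot F (phi a b) r * (vol * Y a' b' r))).
      apply: eq_ctr => b b'; rewrite ctrM; apply: eq_bigr => r _.
      by rewrite slotZ.
    rewrite ctr_sum [RHS]exchange_big; apply: eq_bigr => r _ /=; rewrite ctrM.
    by apply: eq_bigr => q _; rewrite slotZ.
  rewrite ctr_sum; under eq_bigr => q _ do rewrite ctr_sum.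
  transitivity (\sum_q \sum_r \sum_p slot3 F phi p q r * vol * Lp p q r i' j' k' l').
    apply: eq_bigr => q _; apply: eq_bigr => r _; rewrite ctrM; apply: eq_bigr => p _.
    by rewrite slotZ mulrA.
  by under eq_bigr => q _ do rewrite exchange_big; rewrite exchange_big.
rewrite /slot4 /slot3.
under eq_slot => a do under eq_slot => b do under eq_slot => c do under eq_slot => d do rewrite E.
have L1 (u : I -> I -> I -> R) (X : I -> I -> I -> I -> R) z :
   slot F (fun i => \sum_p \sum_q \sum_r u p q r * X p q r i) z =
   \sum_p \sum_q \sum_r u p q r * slot F (X p q r) z.
  rewrite slot_sum; apply: eq_bigr => p _; rewrite slot_sum; apply: eq_bigr => q _.
  by rewrite slot_sum; apply: eq_bigr => r _; rewrite slotZ.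
under eq_slot => a do under eq_slot => b do under eq_slot => c do rewrite L1.
under eq_slot => a do under eq_slot => b do rewrite L1.
under eq_slot => a do rewrite L1.
rewrite L1; apply: eq_bigr => p _; apply: eq_bigr => q _; apply: eq_bigr => r _.
rewrite -!mulrA; congr (_ * (_ * _)); rewrite [RHS]mulrC -slot7_levi.
change (slot F (fun i' => slot F (fun j' => slot F (fun k' => slot F (fun l' =>
    slot3 F (fun a b d => levi_civita R a b d i' j' k' l') p q r) l) k) j) i =
  slot3 F (fun a b d => slot F (fun i' => slot F (fun j' => slot F (fun k' => slot F
    (levi_civita R a b d i' j' k') l) k) j) i) p q r).
rewrite -slot3C; apply: eq_slot => i'; rewrite -slot3C; apply: eq_slot => j'.
by rewrite -slot3C; apply: eq_slot => k'; rewrite -slot3C.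
Qed.

End Contraction.
End FrameChange.

(** * The square of the cross product with a unit vector *)

Section DefiniteForm.
Variables (R : realType) (phi : 'I_7 -> 'I_7 -> 'I_7 -> R).
Local Notation I := 'I_7.
Hypothesis phi12 : forall i j k, phi i j k = - phi j i k.
Hypothesis phi23 : forall i j k, phi i j k = - phi i k j.

(** A marker for the goals that the decision procedure is applied to. *)
Definition rid (x : R) := x.
Local Notation levi7 := (levi_civita R).

(** The complement of four indices; only these three indices contribute to
    [Gd]. *)
Definition co4 (a b c d : I) : seq I :=
  seq.filter (fun x : I => ~~ has (fun y : I => eqn x y) [:: a; b; c; d]) ords7.
Definition co4n n a b c d : I := nth ord0 (co4 a b c d) n.

(** Six times the dual 4-form, without the volume. *)
Definition Gd a b c d : R := \sum_e \sum_f \sum_h levi7 a b c d e f h * phi e f h.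

(** A first set of unknowns is used to evaluate [Gd]; with [Gd] as a further
    unknown the identities below have fewer terms. *)
Definition df_atom1 (k : nat) (s : seq I) : R :=
  match k, s with
  | 0%N, [:: i; j; l] => phi i j l
  | 1%N, [:: a; b; c; d; e; f; h] => levi7 a b c d e f h
  | _, _ => 0
  end.

Definition df_atom (k : nat) (s : seq I) : R :=
  match k, s with
  | 2%N, [:: a; b; c; d] => Gd a b c d
  | 3%N, [:: a; b] => (a == b)%:R
  | _, _ => df_atom1 k s
  end.

(** The normal form of a component of [phi] has increasing indices. *)
Definition phi_nf_pos (i j k : I) : spoly :=
  (* for i < j *)
  if (j < k)%N then patom 0 [:: i; j; k] else
  if (k < i)%N then patom 0 [:: k; i; j] else
  if (i < k)%N && (k < j)%N then popp (patom 0 [:: i; k; j]) else [::].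
Definition phi_nf (i j k : I) : spoly :=
  if (i < j)%N then phi_nf_pos i j k else
  if (j < i)%N then popp (phi_nf_pos j i k) else [::].

Definition df_norm1 (k : nat) (s w : seq I) : spoly :=
  match k, s, w with
  | 0%N, [:: i; j; l], [::] => phi_nf i j l
  | 1%N, [:: a; b; c; d; e; f; h], [::] => pcst (epsZ [:: a; b; c; d; e; f; h])
  | _, _, _ => [::]
  end.

Definition df_norm (k : nat) (s w : seq I) : spoly :=
  match k, s, w with
  | 2%N, [:: a; b; c; d], [::] =>
     pscale (Z.mul (Z.of_nat 6)
               (epsZ [:: a; b; c; d; co4n 0 a b c d; co4n 1 a b c d; co4n 2 a b c d]))
            (fun=> patom 0 [:: co4n 0 a b c d; co4n 1 a b c d; co4n 2 a b c d])
  | 3%N, [:: a; b], [::] => pcst (zif (eqn a b))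
  | _, _, _ => df_norm1 k s w
  end.

Ltac df_reify t :=
  lazymatch t with
  | fun r : env => levi_civita R (@?a r) (@?b r) (@?c r) (@?d r) (@?e r) (@?f r) (@?h r) =>
      constr:(CAtom 1 (fun r => [:: a r; b r; c r; d r; e r; f r; h r]))
  | fun r : env => @GRing.natmul _ _ (nat_of_bool (@?i r == @?j r)) =>
      constr:(CAtom 3 (fun r => [:: i r; j r]))
  | fun r : env => phi (@?i r) (@?j r) (@?k r) => constr:(CAtom 0 (fun r => [:: i r; j r; k r]))
  | fun r : env => Gd (@?i r) (@?j r) (@?k r) (@?l r) =>
      constr:(CAtom 2 (fun r => [:: i r; j r; k r; l r]))
  end.

Lemma phi_ii i k : phi i i k = 0.
Proof. by have := phi12 i i k; lra. Qed.
Lemma phi_jj i j : phi i j j = 0.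
Proof. by have := phi23 i j j; lra. Qed.

Local Notation pev := (peval df_atom1).

Lemma phi_nfP i j k : phi i j k = pev (phi_nf i j k).
Proof.
have P (a b c : I) : (a < b)%N -> phi a b c = pev (phi_nf_pos a b c).
  move=> ab; rewrite /phi_nf_pos; case: (ltngtP b c) => [_|cb|/val_inj <-].
  - by rewrite peval_atom.
  - case: (ltngtP c a) => [_|_|/val_inj ->] /=; last by rewrite phi12 phi_jj oppr0 peval_nil.
      by rewrite peval_atom /= [LHS]phi23 [phi a c b]phi12 opprK.
    by rewrite -[X in pev X]/(popp (patom 0 [:: a; c; b])) peval_opp peval_atom /= [LHS]phi23.
  - by rewrite phi_jj ltnNge (ltnW ab) /= ?ltnn ?andbF peval_nil.
rewrite /phi_nf; case: (ltngtP i j) => [ij|ji|/val_inj ->].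
- exact: P.
- by rewrite peval_opp -P // phi12.
- by rewrite phi_ii peval_nil.
Qed.

(** The entries are numbers here, so the jets are constant. *)
Definition const_jet : {rmorphism R -> jet R I} := @jcst R I.

Lemma df_norm1P k s w : const_jet (df_atom1 k s) w = pev (df_norm1 k s w).
Proof.
have c0 (v : seq I) : const_jet 0 v = 0 by case: v.
case: k => [|[|k]]; last by rewrite c0 peval_nil.
- case: s => [|i [|j [|l [|? ?]]]]; rewrite ?c0 ?peval_nil //.
  by case: w => [|c w]; rewrite /df_norm1 ?peval_nil // -phi_nfP.
- case: s => [|a [|b [|c [|d [|e [|f [|h [|? ?]]]]]]]]; rewrite ?c0 ?peval_nil //.
  by case: w => [|i w]; rewrite /df_norm1 ?peval_nil // peval_cst -leviE.
Qed.

Definition df_sound1 n e1 e2 r :=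
  @checkP R R const_jet (fun _ _ => 0) (fun c a => esym (jshift_cst c a)) df_atom1 df_atom1
    df_norm1 df_norm1P n e1 e2 r.
Ltac df_decide1 := decide_with df_reify df_sound1 rid.

Lemma Gd_co : forall a b c d, rid (Gd a b c d) =
  rid (6%:R * (levi7 a b c d (co4n 0 a b c d) (co4n 1 a b c d) (co4n 2 a b c d) *
               phi (co4n 0 a b c d) (co4n 1 a b c d) (co4n 2 a b c d))).
Proof.
rewrite /Gd.
df_decide1.
Qed.

Lemma df_normP k s w : const_jet (df_atom k s) w = pev (df_norm k s w).
Proof.
case: k => [|[|[|[|k]]]]; try exact: df_norm1P.
- case: s => [|a [|b [|c [|d [|? ?]]]]]; try exact: df_norm1P.
  case: w => [|i w]; last by rewrite /df_norm /df_norm1 peval_nil.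
  rewrite /df_norm -[LHS]/(rid (Gd a b c d)) Gd_co.
  by rewrite peval_scale peval_atom zRM zR_nat -leviE mulrA.
- case: s => [|a [|b [|? ?]]]; try exact: df_norm1P.
  case: w => [|i w]; last by rewrite /df_norm /df_norm1 peval_nil.
  by rewrite /df_norm peval_cst -[eqn a b]/(a == b) /=; case: (a == b).
Qed.

Definition df_sound n e1 e2 r :=
  @checkP R R const_jet (fun _ _ => 0) (fun c a => esym (jshift_cst c a)) df_atom df_atom1
    df_norm df_normP n e1 e2 r.
Ltac df_decide := decide_with df_reify df_sound rid.

Local Notation o0 := (ord0 : I).

(** The coefficient of [(e_i _| phi) /\ (e_j _| phi) /\ phi], up to the factor
    24. *)
Definition Wf i j : R := \sum_a \sum_b phi i a b * \sum_c \sum_d phi j c d * Gd a b c d.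

(** On the complement of [e_0] this is Hitchin's endomorphism of a 3-form in
    dimension six, for the restriction of [phi]. *)
Definition Kf k m : R := \sum_a \sum_b phi k a b * Gd o0 m a b.

(** The index [j], or 1 if [j] is 0: with it a universally quantified index
    runs over the indices different from 0. *)
Definition nz (j : I) : I := if nat_of_ord j is 0%N then @Ordinal 7 1 isT else j.

Lemma Wf_0 : forall j, rid (Wf o0 (nz j)) = rid (- (6%:R * \sum_m phi o0 (nz j) m * Kf o0 m)).
Proof.
rewrite /Wf /Kf.
df_decide.
Qed.

Lemma Wf_nz : forall j k, rid (Wf (nz j) (nz k)) =
  rid (6%:R * \sum_m (phi (nz j) (nz k) m * Kf o0 m - phi o0 (nz j) m * Kf (nz k) m)).
Proof.
rewrite /Wf /Kf.
df_decide.
Qed.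

(** The square of Hitchin's endomorphism is scalar, for every 3-form. *)
Lemma Kf_sqr : forall j k, rid (6%:R * \sum_m Kf (nz j) m * Kf m (nz k)) =
  rid ((nz j == nz k)%:R * \sum_p \sum_q Kf p q * Kf q p).
Proof.
rewrite /Kf.
df_decide.
Qed.

Local Notation n1 := (@Ordinal 7 1 isT).
Local Notation n2 := (@Ordinal 7 2 isT).
Local Notation n3 := (@Ordinal 7 3 isT).
Local Notation n4 := (@Ordinal 7 4 isT).
Local Notation n5 := (@Ordinal 7 5 isT).
Local Notation n6 := (@Ordinal 7 6 isT).

(** [Wf 0 0] is [144] times the Pfaffian of the skew 6 x 6 matrix [phi 0 j k],
    so its square is [144^2] times the determinant. *)
Lemma Wf_pfaffian : rid (Wf o0 o0 * Wf o0 o0) = rid (20736%:R *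
  \sum_b phi o0 n1 b * \sum_c phi o0 n2 c * \sum_d phi o0 n3 d * \sum_e phi o0 n4 e *
  \sum_f phi o0 n5 f * \sum_h phi o0 n6 h * levi7 o0 b c d e f h).
Proof.
rewrite /Wf.
df_decide.
Qed.

Variable sigma : R.
Hypothesis sigma2 : sigma ^+ 2 = 1.
Hypothesis phi_W : forall i j, Wf i j = - (144%:R * sigma) * (i == j)%:R.

Let A : 'M[R]_7 := \matrix_(j, m) phi o0 j m.
Let Km : 'M[R]_7 := \matrix_(k, m) Kf k m.
Let E00 : 'M[R]_7 := delta_mx o0 o0.

Lemma nz_id (j : I) : j != o0 -> nz j = j.
Proof. by rewrite /nz; case: j => -[|j] Hj. Qed.

Lemma Kf_k0 k : Kf k o0 = 0.
Proof.
rewrite /Kf big1 // => a _; rewrite big1 // => b _.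
by rewrite [Gd _ _ _ _]big1 ?mulr0 // => e _; rewrite big1 // => f _; rewrite big1 // => h _;
   rewrite leviE /zR mul0r.
Qed.

Lemma AE : A *m E00 = 0 /\ E00 *m A = 0.
Proof.
split; apply/matrixP => i j; rewrite !mxE big1 // => k _; rewrite !mxE.
  by case: eqVneq => [->|_]; rewrite ?mul0r ?mulr0 // phi23 phi_ii oppr0 mul0r.
by case: (eqVneq k o0) => [->|_]; rewrite ?phi_ii ?mulr0 // andbF mul0r.
Qed.

Lemma det_AE : \det (A + E00) = 1.
Proof.
have n0 : (20736%:R : R) != 0 by rewrite pnatr_eq0.
apply: (mulfI n0); rewrite mulr1.
have S2 : Wf o0 o0 * Wf o0 o0 = 20736%:R.
  rewrite phi_W eqxx mulr1 mulrNN mulrACA -[sigma * _]expr2 sigma2 mulr1 -natrM; congr (_%:R).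
rewrite -[RHS]S2 -[RHS]/(rid (Wf o0 o0 * Wf o0 o0)) Wf_pfaffian /rid; congr (_ * _).
pose t := [tuple o0; n1; n2; n3; n4; n5; n6].
have L : levi R t = 1 by rewrite -[LHS]/(levi7 o0 n1 n2 n3 n4 n5 n6) leviE.
rewrite -[LHS]mul1r -L -levi_sum sum_tuple7 (bigD1 o0) //= [X in _ + X]big1 ?addr0; last first.
  move=> i i0; do 6 (rewrite big1 // => ? _).
  by rewrite big_ord_recl /= /tnth /= !mxE phi_ii (negbTE i0) andbF add0r mul0r mulr0.
have Xr (r b : I) : r != o0 -> (A + E00) r b = phi o0 r b.
  by move=> r0; rewrite !mxE (negbTE r0) addr0.
have X00 : (A + E00) o0 o0 = 1 by rewrite !mxE phi_ii !eqxx add0r.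
apply: eq_bigr => b _; rewrite mulr_sumr; apply: eq_bigr => c _.
rewrite !mulr_sumr; apply: eq_bigr => d _; rewrite !mulr_sumr; apply: eq_bigr => e _.
rewrite !mulr_sumr; apply: eq_bigr => f _; rewrite !mulr_sumr; apply: eq_bigr => h _.
rewrite !big_ord_recl big_ord0 /= /tnth /= X00 mul1r mulr1 !Xr //.
rewrite [LHS]mulrC -!mulrA; congr (_ * (_ * (_ * (_ * (_ * (_ * _)))))).
Qed.

(** The row 0 of [K] is annihilated by the invertible matrix [A + E00]. *)
Lemma Kf_0m m : Kf o0 m = 0.
Proof.
have AK (j : I) : \sum_m phi o0 j m * Kf o0 m = 0.
  have [->|j0] := eqVneq j o0; first by rewrite big1 // => k _; rewrite phi_ii mul0r.
  have := Wf_0 j; rewrite /rid nz_id // phi_W eq_sym (negbTE j0) mulr0.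
  by move=> /esym/eqP; rewrite oppr_eq0 mulf_eq0 pnatr_eq0 /= => /eqP.
pose v : 'cV[R]_7 := \col_m Kf o0 m.
have Xv : (A + E00) *m v = 0.
  apply/matrixP => i j; rewrite mulmxDl !mxE.
  under eq_bigr => k _ do rewrite !mxE.
  rewrite AK add0r big1 // => k _; rewrite !mxE.
  by case: (eqVneq k o0) => [->|_]; rewrite ?Kf_k0 ?mulr0 // andbF mul0r.
have uX : A + E00 \in unitmx by rewrite unitmxE det_AE unitr1.
have /matrixP/(_ m ord0) : v = 0 by rewrite -(mulKmx uX v) Xv mulmx0.
by rewrite !mxE.
Qed.

(** The cross product with the first vector of an orthonormal frame, [A], is a
    complex structure on its orthogonal complement.  On this complement [A] and
    [K] are inverse to each other up to a scalar and [K K] is scalar, so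
    [A A = mu P] for the projection [P]; the determinant gives [mu^6 = 1], and
    [mu <= 0] as [A] is skew. *)
Lemma cross_sqr : A *m A = E00 - 1%:M.
Proof.
pose P : 'M[R]_7 := 1%:M - E00.
have Pjk j k : P j k = ((j == k) && (j != o0))%:R.
  rewrite !mxE; case: (eqVneq j k) => [<-|jk] /=; last first.
    by case: (eqVneq j o0) => [j0|] /=; rewrite ?subr0 // -j0 eq_sym (negbTE jk) subr0.
  by rewrite andbb; case: (j == o0); rewrite ?subrr ?subr0.
pose kap : R := 24%:R * sigma.
have At : A^T = - A by apply/matrixP => i j; rewrite !mxE phi23.
have AKt : A *m Km^T = kap *: P.
  apply/matrixP => j k; rewrite [RHS]mxE Pjk !mxE; under eq_bigr => m _ do rewrite !mxE.
  have [->|j0] := eqVneq j o0.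
    by rewrite andbF mulr0 big1 // => m _; rewrite phi_ii mul0r.
  rewrite andbT; have [->|k0] := eqVneq k o0.
    by rewrite (negbTE j0) mulr0 big1 // => m _; rewrite Kf_0m mulr0.
  have := Wf_nz j k; rewrite /rid !nz_id // phi_W.
  rewrite sumrB [X in X - _]big1 ?sub0r => [E|m _]; last by rewrite Kf_0m mulr0.
  rewrite /kap; lra.
have KA : Km *m A = - kap *: P.
  apply: oppr_inj; rewrite -mulmxN -At -[Km]trmxK -trmx_mul AKt scaleNr opprK linearZ /=.
  by congr (_ *: _); apply/matrixP => j k; rewrite mxE !Pjk eq_sym; case: eqVneq => [->|].
pose lam : R := 6%:R^-1 * \sum_p \sum_q Kf p q * Kf q p.
have KK : Km *m Km = lam *: P.
  apply/matrixP => j k; rewrite [RHS]mxE Pjk !mxE; under eq_bigr => m _ do rewrite !mxE.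
  have [->|j0] := eqVneq j o0.
    by rewrite andbF mulr0 big1 // => m _; rewrite Kf_0m mul0r.
  rewrite andbT; have [->|k0] := eqVneq k o0.
    by rewrite (negbTE j0) mulr0 big1 // => m _; rewrite Kf_k0 mulr0.
  have := Kf_sqr j k; rewrite /rid !nz_id // => E.
  have n6 : (6%:R : R) != 0 by rewrite pnatr_eq0.
  by apply: (mulfI n6); rewrite E /lam [RHS]mulrA [6%:R * (_ * _)]mulrA divff // mul1r mulrC.
have [AE0 EA0] := AE.
have PA : P *m A = A by rewrite mulmxBl EA0 mul1mx subr0.
have AP : A *m P = A by rewrite mulmxBr AE0 mulmx1 subr0.
have lamA : lam *: (A *m A) = 576%:R *: P.
  rewrite -{1}PA -mulmxA scalemxAl -KK -mulmxA [Km *m (A *m A)]mulmxA KA.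
  rewrite -scalemxAl PA -scalemxAr KA scalerA; congr (_ *: _).
  by rewrite mulrNN /kap mulrACA -[sigma * _]expr2 sigma2 mulr1 -natrM; congr (_%:R).
have lam0 : lam != 0.
  apply: contraTneq isT => l0; move: lamA; rewrite l0 scale0r => /matrixP/(_ n1 n1).
  by rewrite [LHS]mxE [RHS]mxE Pjk /= mulr1 => /eqP; rewrite eq_sym pnatr_eq0.
pose mu := lam^-1 * 576%:R.
have AA : A *m A = mu *: P by rewrite /mu -scalerA -lamA scalerA mulVf // scale1r.
have mu6 : mu ^+ 6 = 1.
  rewrite -[RHS](mulr1 1) -{1 2}det_AE -det_mulmx mulmxDl !mulmxDr AE0 EA0 AA addr0 add0r.
  have -> : E00 *m E00 = E00 by rewrite mul_delta_mx.
  have -> : mu *: P + E00 = diag_mx (\row_j if j == o0 then 1 else mu).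
    apply/matrixP => j k; rewrite mxE [X in X + _]mxE Pjk !mxE.
    case: (eqVneq j k) => [<-|jk] /=.
      by case: (j == o0); rewrite ?mulr0 ?mulr1 ?add0r ?addr0.
    rewrite mulr0 add0r; case: (eqVneq j o0) => //= j0.
    by rewrite -j0 eq_sym (negbTE jk).
  rewrite det_diag !big_ord_recl big_ord0 !mxE /=; ring.
have mu0 : 0 <= - mu.
  have : 0 <= - \tr (A *m A).
    rewrite /mxtrace -sumrN sumr_ge0 // => i _; rewrite mxE -sumrN sumr_ge0 // => k _.
    by rewrite !mxE [phi o0 k i]phi23 mulrN opprK -expr2 sqr_ge0.
  rewrite AA mxtraceZ -mulNr pmulr_lge0 //.
  rewrite /mxtrace !big_ord_recl big_ord0 !Pjk /=; lra.
have /eqP mu1 : - mu == 1.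
  by rewrite -(@pexpr_eq1 _ (- mu) 6%N isT mu0); apply/eqP; rewrite -mu6; ring.
by rewrite AA -[mu]opprK mu1 scaleN1r opprB.
Qed.

End DefiniteForm.

(** * Orthonormal frames *)

Section Orthonormal.
Variables (R : realType) (n : nat) (G : 'M[R]_n).
Implicit Types u v w : 'rV[R]_n.
Definition ip u v : R := (u *m G *m v^T) ord0 ord0.
Hypothesis G_sym : G^T = G.
Hypothesis G_pos : forall v, v != 0 -> 0 < ip v v.

Lemma ipC u v : ip u v = ip v u.
Proof.
rewrite /ip; have -> : u *m G *m v^T = (v *m G *m u^T)^T; last by rewrite [LHS]mxE.
by rewrite !trmx_mul trmxK G_sym mulmxA.
Qed.

(** Fewer than n linear conditions have a non-zero solution, which is then
    normalised. *)
Lemma ortho_unit k (B : 'I_k -> 'rV[R]_n) : (k < n)%N ->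
  exists u, ip u u = 1 /\ forall i, ip (B i) u = 0.
Proof.
move=> kn; pose C : 'M[R]_(k, n) := \matrix_(i < k) B i.
have : kermx (G *m C^T) != 0.
  rewrite -mxrank_eq0 mxrank_ker subn_eq0 -ltnNge (leq_ltn_trans _ kn) //.
  exact: rank_leq_col.
case/rowV0Pn => v /sub_kermxP vK v0; pose nv := Num.sqrt (ip v v).
have nv0 : nv != 0 by rewrite sqrtr_eq0 -ltNge G_pos.
exists (nv^-1 *: v); split.
  rewrite /ip linearZ /= -scalemxAr -!scalemxAl scalerA mxE -[X in _ * X]/(ip v v).
  rewrite -[ip v v]sqr_sqrtr ?(ltW (G_pos v0)) // -/nv expr2.
  by field.
move=> i; rewrite ipC /ip -!scalemxAl mxE.
have /matrixP/(_ ord0 i) := vK; rewrite [X in _ = X]mxE mulmxA => E.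
suff -> : (v *m G *m (B i)^T) ord0 ord0 = 0 by rewrite mulr0.
rewrite -{}E !mxE; apply: eq_bigr => j _; rewrite !mxE; congr (_ * _).
Qed.

Lemma ortho_family u : ip u u = 1 -> forall k, (k < n)%N ->
  exists E : nat -> 'rV[R]_n, E 0%N = u /\
    forall i j, (i <= k)%N -> (j <= k)%N -> ip (E i) (E j) = (i == j)%:R.
Proof.
move=> uu; elim=> [|k IH] kn.
  by exists (fun _ => u); split=> // i j; rewrite !leqn0 => /eqP -> /eqP ->.
have [E [E0 EE]] := IH (ltnW kn).
have [v [vv Bv]] := @ortho_unit k.+1 (fun i => E i) kn.
exists (fun i => if i == k.+1 then v else E i); split=> // i j.
rewrite [(i <= _)%N]leq_eqVlt [(j <= _)%N]leq_eqVlt !ltnS; case: eqVneq => [->|ik] /= ik'.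
  case: eqVneq => [->|jk] /= jk'; first by rewrite vv.
  by rewrite ipC (Bv (Ordinal (jk' : (j < k.+1)%N))).
case: (eqVneq j k.+1) => [->|jk] /= jk'.
  by rewrite (Bv (Ordinal (ik' : (i < k.+1)%N))) (negbTE ik).
exact: EE.
Qed.

End Orthonormal.

Lemma orthonormal_frame (R : realType) n (G : 'M[R]_n.+1) (u : 'rV[R]_n.+1) :
    G^T = G -> (forall v, v != 0 -> 0 < ip G v v) -> ip G u u = 1 ->
  exists F : 'M[R]_n.+1, F *m G *m F^T = 1%:M /\ row ord0 F = u.
Proof.
move=> G_sym G_pos uu; have [E [E0 EE]] := ortho_family G_sym G_pos uu (ltnSn n).
exists (\matrix_(i < n.+1) E i); split; last by rewrite rowK.
apply/matrixP => i j; rewrite [RHS]mxE -[RHS]EE ?leq_ord //.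
rewrite /ip !mxE; apply: eq_bigr => k _; rewrite !mxE; congr (_ * _).
by apply: eq_bigr => l _; rewrite mxE.
Qed.

(** * The octonionic basis *)

Lemma alt3_ext (R : realFieldType) n (X : 'I_n -> 'I_n -> 'I_n -> R) :
    (forall i j k, X i j k = - X j i k) -> (forall i j k, X i j k = - X i k j) ->
    (forall i j k : 'I_n, (i < j < k)%N -> X i j k = 0) ->
  forall i j k, X i j k = 0.
Proof.
move=> X12 X23 X0.
have lt (i j k : 'I_n) : (i < j)%N -> X i j k = 0.
  move=> ij; case: (ltngtP j k) => [jk|kj|/val_inj <-].
  - by rewrite X0 ?ij.
  - case: (ltngtP i k) => [ik|ki|/val_inj <-].
    + by rewrite X23 X0 ?oppr0 ?ik.
    + by rewrite X23 X12 X0 ?opprK ?ki.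
    + by rewrite X23; have := X12 i i j; lra.
  - by have := X23 i j j; lra.
move=> i j k; case: (ltngtP i j) => [/lt //|/lt ji|/val_inj <-].
  by rewrite X12 ji oppr0.
by have := X12 i i k; lra.
Qed.

Section CrossProduct.
Variables (R : realType) (f : 'I_7 -> 'I_7 -> 'I_7 -> R).
Hypothesis f12 : forall i j k, f i j k = - f j i k.
Hypothesis f23 : forall i j k, f i j k = - f i k j.
Implicit Types u v w : 'rV[R]_7.

Definition dot u v : R := (u *m v^T) ord0 ord0.

(** Vectors are rows, so [w *m cross_mx u] is the cross product of [u] and [w]. *)
Definition cross_mx u : 'M[R]_7 := \matrix_(j, k) \sum_i u ord0 i * f i j k.
Definition cross u v : 'rV[R]_7 := v *m cross_mx u.

Hypothesis frame_sqr : forall Q : 'M[R]_7, Q *m Q^T = 1%:M -> forall j k,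
  \sum_m slot3 Q f ord0 j m * slot3 Q f ord0 m k =
  (j == ord0)%:R * (k == ord0)%:R - (j == k)%:R.

Lemma dotC u v : dot u v = dot v u.
Proof. by rewrite /dot -[u *m v^T]trmxK trmx_mul trmxK mxE. Qed.
Lemma dotDl u v w : dot (u + v) w = dot u w + dot v w.
Proof. by rewrite /dot mulmxDl mxE. Qed.
Lemma dotZl a u v : dot (a *: u) v = a * dot u v.
Proof. by rewrite /dot -scalemxAl mxE. Qed.
Lemma dotNl u v : dot (- u) v = - dot u v.
Proof. by rewrite /dot mulNmx mxE. Qed.
Lemma dotDr u v w : dot w (u + v) = dot w u + dot w v.
Proof. by rewrite ![dot w _]dotC dotDl. Qed.
Lemma dotZr a u v : dot v (a *: u) = a * dot v u.
Proof. by rewrite ![dot v _]dotC dotZl. Qed.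
Lemma dotNr u v : dot v (- u) = - dot v u.
Proof. by rewrite ![dot v _]dotC dotNl. Qed.
Lemma dot_mx u v : u *m v^T = (dot u v)%:M.
Proof. exact: mx11_scalar. Qed.
Lemma dot_ge0 u : 0 <= dot u u.
Proof. by rewrite /dot mxE sumr_ge0 // => i _; rewrite mxE -expr2 sqr_ge0. Qed.
Lemma dot_gt0 u : u != 0 -> 0 < dot u u.
Proof.
move=> u0; rewrite lt_def dot_ge0 andbT; apply: contra u0 => /eqP E.
have P i : true -> 0 <= u ord0 i * u^T i ord0 by rewrite mxE -expr2 sqr_ge0.
apply/eqP/rowP => i; rewrite mxE; move: E; rewrite /dot mxE => /(psumr_eq0P P)/(_ i isT).
by rewrite mxE -expr2 => /eqP; rewrite sqrf_eq0 => /eqP.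
Qed.

Lemma cross_mxD u v : cross_mx (u + v) = cross_mx u + cross_mx v.
Proof.
apply/matrixP => j k; rewrite !mxE -big_split; apply: eq_bigr => i _.
by rewrite mxE mulrDl.
Qed.
Lemma cross_mxZ a u : cross_mx (a *: u) = a *: cross_mx u.
Proof.
apply/matrixP => j k; rewrite !mxE mulr_sumr; apply: eq_bigr => i _.
by rewrite mxE mulrA.
Qed.

Lemma triple_slot Q i j k : dot (cross (row i Q) (row j Q)) (row k Q) = slot3 Q f i j k.
Proof.
rewrite /dot /cross mxE /slot3 /slot.
under eq_bigr => c _ do rewrite !mxE mulr_suml.
under eq_bigr => c _ do under eq_bigr => b _ do rewrite !mxE mulr_sumr mulr_suml.
rewrite exchange_big; under eq_bigr => b _ do rewrite exchange_big.
rewrite exchange_big; apply: eq_bigr => a _ /=; rewrite mulr_sumr.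
apply: eq_bigr => b _; rewrite !mulr_sumr; apply: eq_bigr => c _; rewrite !mxE; ring.
Qed.

Lemma cross_mx_tr u : (cross_mx u)^T = - cross_mx u.
Proof.
by apply/matrixP => j k; rewrite !mxE -sumrN; apply: eq_bigr => i _; rewrite f23 mulrN.
Qed.

Lemma crossC u v : cross u v = - cross v u.
Proof.
apply/rowP => k; rewrite !mxE -sumrN.
under eq_bigr => j _ do rewrite mxE mulr_sumr.
rewrite exchange_big; apply: eq_bigr => i _ /=; rewrite mxE mulr_sumr -sumrN.
by apply: eq_bigr => j _; rewrite [f i j k]f12; ring.
Qed.

Lemma triple23 u v w : dot (cross u v) w = - dot (cross u w) v.
Proof.
suff -> : dot (cross u w) v = - dot (cross u v) w by rewrite opprK.
by rewrite dotC /dot /cross trmx_mul cross_mx_tr mulNmx mulmxN mulmxA mxE.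
Qed.

(** The hypothesis concerns the first vector of a frame, and every unit vector is
    the first vector of an orthonormal frame. *)
Lemma cross_mx_unit u : dot u u = 1 -> cross_mx u *m cross_mx u = u^T *m u - 1%:M.
Proof.
move=> uu.
have [Q [QQ Q0]] : exists Q : 'M[R]_7, Q *m Q^T = 1%:M /\ row ord0 Q = u.
  have [||| F [FF F0]] := @orthonormal_frame R 6 1%:M u.
  - by rewrite trmx1.
  - by move=> v v0; rewrite /ip mulmx1 dot_gt0.
  - by rewrite /ip mulmx1.
  by exists F; rewrite mulmx1 in FF.
have E j k : (Q *m cross_mx u *m Q^T) j k = slot3 Q f ord0 j k.
  rewrite -triple_slot Q0 /dot /cross -row_mul !mxE; apply: eq_bigr => l _.
  by rewrite !mxE.
have Q'Q : Q^T *m Q = 1%:M by apply: mulmx1C.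
have [B [BE BB]] : exists B, cross_mx u = Q^T *m B *m Q /\ B *m B = delta_mx ord0 ord0 - 1%:M.
  exists (Q *m cross_mx u *m Q^T); split.
    by rewrite !mulmxA Q'Q mul1mx -mulmxA Q'Q mulmx1.
  apply/matrixP => j k; rewrite mxE; under eq_bigr => m _ do rewrite !E.
  rewrite frame_sqr // !mxE; congr (_ - _).
  by case: (j == ord0); case: (k == ord0); rewrite ?mulr1 ?mulr0 ?mul0r.
rewrite BE !mulmxA -[Q^T *m B *m Q *m Q^T]mulmxA QQ mulmx1 -[Q^T *m B *m B]mulmxA BB.
rewrite mulmxBr mulmxBl mulmx1 Q'Q -Q0; congr (_ - _).
rewrite rowE trmx_mul trmx_delta !mulmxA -[X in _ = X *m Q]mulmxA.
by rewrite (mul_delta_mx (R := R) (ord0 : 'I_1) (ord0 : 'I_7)).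
Qed.

Lemma cross_mx_sqr u : cross_mx u *m cross_mx u = u^T *m u - (dot u u)%:M.
Proof.
have [->|u0] := eqVneq u 0.
  have -> : cross_mx 0 = 0 by rewrite -[X in cross_mx X](scale0r 0) cross_mxZ scale0r.
  have -> : dot 0 0 = 0 by rewrite /dot mul0mx mxE.
  by rewrite trmx0 !mulmx0 raddf0 subr0.
pose r := Num.sqrt (dot u u).
have r2 : r ^+ 2 = dot u u by rewrite sqr_sqrtr ?dot_ge0.
have r0 : r != 0 by rewrite sqrtr_eq0 -ltNge dot_gt0.
have rr : r^-1 * r^-1 * r ^+ 2 = 1 by field.
have := @cross_mx_unit (r^-1 *: u).
rewrite dotZl dotZr -r2 mulrA rr => /(_ erefl).
rewrite cross_mxZ [(_ *: u)^T]linearZ -!scalemxAl -!scalemxAr !scalerA => H.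
apply: (@scalerI _ _ (r^-1 * r^-1)); first by rewrite mulf_neq0 ?invr_eq0.
by rewrite H scalerBr scale_scalar_mx rr.
Qed.

(** Polarisation of the previous identity. *)
Lemma cross_mx_anti u v : cross_mx u *m cross_mx v + cross_mx v *m cross_mx u =
  u^T *m v + v^T *m u - (2%:R * dot u v)%:M.
Proof.
have aux (a b c d p q s t w : 'M[R]_7) :
    (a - c) + p + (q + (b - d)) = a + s + (t + b) + (- c - w + (- w - d)) ->
    p + q = s + t - (w + w).
  by move=> /matrixP H; apply/matrixP => i j; move: (H i j); rewrite !mxE; lra.
have := cross_mx_sqr (u + v); rewrite cross_mxD dotDl !dotDr [dot v u]dotC.
rewrite [(u + v)^T]linearD !mulmxDl !mulmxDr !cross_mx_sqr !raddfD /= => /aux ->.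
by rewrite -raddfD; congr (_ - _%:M); ring.
Qed.

Lemma cross_anti u v w : cross u (cross v w) + cross v (cross u w) =
  dot v w *: u + dot u w *: v - (2%:R * dot u v) *: w.
Proof.
rewrite /cross -!mulmxA -mulmxDr addrC cross_mx_anti !mulmxDr mulmxN !mulmxA !dot_mx.
by rewrite !mul_scalar_mx mul_mx_scalar ![dot w _]dotC addrC [X in X - _]addrC addrC.
Qed.

Lemma cross_sqr_vec u w : cross u (cross u w) = dot u w *: u - dot u u *: w.
Proof.
rewrite /cross -mulmxA cross_mx_sqr mulmxBr mulmxA dot_mx mul_scalar_mx mul_mx_scalar.
by rewrite dotC.
Qed.

Lemma triple_iij u v : dot (cross u u) v = 0.
Proof. by have := dotNl (cross u u) v; rewrite -crossC; lra. Qed.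

Lemma triple_iji u v : dot (cross u v) u = 0.
Proof. by rewrite triple23 triple_iij oppr0. Qed.

Lemma triple_ijj u v : dot (cross u v) v = 0.
Proof. by rewrite crossC dotNl triple_iji oppr0. Qed.

Lemma dot_cross u v w : dot (cross u v) (cross u w) = dot u u * dot v w - dot u v * dot u w.
Proof.
rewrite triple23 cross_sqr_vec dotDl dotNl !dotZl [dot w v]dotC; ring.
Qed.

(** The basis is the one of the octonions built by doubling twice: two
    orthogonal units [e1], [e2], their product [e3], a unit [e4] orthogonal to
    all three, and the products [e5], [e6], [- e7] of these three with [e4].  Up
    to sign, [u x (v x w)] is alternating in three orthogonal vectors; with
    [u x (u x w) = - w] for orthogonal units this yields the whole
    multiplication table. *)
Lemma octonion_frame : exists Q : 'M[R]_7, Q *m Q^T = 1%:M /\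
  forall i j k, slot3 Q f i j k = zR R (phi0 i j k).
Proof.
have G_sym : (1%:M : 'M[R]_7)^T = 1%:M by rewrite trmx1.
have ipE u v : ip 1%:M u v = dot u v by rewrite /ip mulmx1.
have G_pos v : v != 0 -> 0 < ip 1%:M v v by rewrite ipE; apply: dot_gt0.
have new k (B : 'I_k -> 'rV[R]_7) : (k < 7)%N ->
    exists u, dot u u = 1 /\ forall i, dot (B i) u = 0.
  move=> k7; have [u [uu Bu]] := ortho_unit G_sym G_pos B k7.
  by exists u; rewrite -ipE; split=> // i; rewrite -ipE.
have [e1 [d11 _]] := new 0%N (fun _ => 0) isT.
have [e2 [d22 /(_ ord0) d12]] := new 1%N (fun _ => e1) isT.
pose e3 := cross e1 e2.
have [e4 [d44 B4]] := new 3%N (fun i => nth 0 [:: e1; e2; e3] i) isT.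
have d14 : dot e1 e4 = 0 := B4 (@Ordinal 3 0 isT).
have d24 : dot e2 e4 = 0 := B4 (@Ordinal 3 1 isT).
have d34 : dot e3 e4 = 0 := B4 (@Ordinal 3 2 isT).
pose e5 := cross e1 e4; pose e6 := cross e2 e4; pose e7 := - cross e3 e4.
have d13 : dot e1 e3 = 0 by rewrite dotC triple_iji.
have d23 : dot e2 e3 = 0 by rewrite dotC triple_ijj.
have d33 : dot e3 e3 = 1 by rewrite dot_cross d11 d22 d12; ring.
have sw u v w : dot u v = 0 -> dot u w = 0 -> dot v w = 0 ->
    cross u (cross v w) = - cross v (cross u w).
  move=> uv uw vw; apply/eqP; rewrite -addr_eq0 cross_anti uv uw vw mulr0 !scale0r.
  by rewrite addr0 subr0.
have sq u w : dot u u = 1 -> dot u w = 0 -> cross u (cross u w) = - w.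
  by move=> uu uw; rewrite cross_sqr_vec uu uw scale0r sub0r scale1r.
have cN u v : cross u (- v) = - cross u v by rewrite /cross mulNmx.
have c12 : cross e1 e2 = e3 by [].
have c13 : cross e1 e3 = - e2 by exact: sq.
have d21 : dot e2 e1 = 0 by rewrite dotC.
have d31 : dot e3 e1 = 0 by rewrite dotC.
have d32 : dot e3 e2 = 0 by rewrite dotC.
have d41 : dot e4 e1 = 0 by rewrite dotC.
have d42 : dot e4 e2 = 0 by rewrite dotC.
have d43 : dot e4 e3 = 0 by rewrite dotC.
have c23 : cross e2 e3 = e1 by rewrite /e3 [cross e1 e2]crossC cN sq ?opprK.
have c14 : cross e1 e4 = e5 by [].
have c15 : cross e1 e5 = - e4 by exact: sq.
have c24 : cross e2 e4 = e6 by [].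
have c26 : cross e2 e6 = - e4 by exact: sq.
have c34 : cross e3 e4 = - e7 by rewrite opprK.
have c37 : cross e3 e7 = e4 by rewrite cN sq ?opprK.
have c45 : cross e4 e5 = e1 by rewrite /e5 [cross e1 e4]crossC cN sq ?opprK.
have c46 : cross e4 e6 = e2 by rewrite /e6 [cross e2 e4]crossC cN sq ?opprK.
have c47 : cross e4 e7 = - e3 by rewrite /e7 [cross e3 e4]crossC opprK sq.
have d15 : dot e1 e5 = 0 by rewrite dotC triple_iji.
have d25 : dot e2 e5 = 0 by rewrite dotC triple23 c12 d34 oppr0.
have d35 : dot e3 e5 = 0 by rewrite dotC triple23 c13 dotNl opprK d24.
have d45 : dot e4 e5 = 0 by rewrite dotC triple_ijj.
have d55 : dot e5 e5 = 1 by rewrite dot_cross d11 d44 d14; ring.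
have d16 : dot e1 e6 = 0 by rewrite dotC triple23 [cross e2 e1]crossC dotNl opprK d34.
have d26 : dot e2 e6 = 0 by rewrite dotC triple_iji.
have d36 : dot e3 e6 = 0 by rewrite dotC triple23 c23 d14 oppr0.
have d46 : dot e4 e6 = 0 by rewrite dotC triple_ijj.
have d56 : dot e5 e6 = 0.
  by rewrite /e5 /e6 crossC [cross e2 e4]crossC dotNl dotNr opprK dot_cross d41 d12; ring.
have d66 : dot e6 e6 = 1 by rewrite dot_cross d22 d44 d24; ring.
have d17 : dot e1 e7 = 0.
  by rewrite dotNr dotC triple23 [cross e3 e1]crossC c13 !opprK d24.
have d27 : dot e2 e7 = 0.
  by rewrite dotNr dotC triple23 [cross e3 e2]crossC c23 dotNl !opprK d14 oppr0.
have d37 : dot e3 e7 = 0 by rewrite dotNr dotC triple_iji oppr0.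
have d47 : dot e4 e7 = 0 by rewrite dotNr dotC triple_ijj oppr0.
have d57 : dot e5 e7 = 0.
  by rewrite /e5 /e7 crossC [cross e3 e4]crossC opprK dotNl dot_cross d13 d41; ring.
have d67 : dot e6 e7 = 0.
  by rewrite /e6 /e7 crossC [cross e3 e4]crossC opprK dotNl dot_cross d23 d42; ring.
have d77 : dot e7 e7 = 1 by rewrite dotNl dotNr opprK dot_cross d33 d44 d34; ring.
have c16 : cross e1 e6 = e7.
  by rewrite /e7 [cross e3 e4]crossC opprK /e3 sw // [cross e4 e2]crossC cN opprK.
have c17 : cross e1 e7 = - e6 by rewrite -c16 sq.
have c25 : cross e2 e5 = - e7 by rewrite sw // c16.
have c27 : cross e2 e7 = e5 by rewrite -[e7]opprK -c25 cN sq ?opprK.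
have c35 : cross e3 e5 = - e6 by rewrite sw // c34 cN opprK c17.
have c36 : cross e3 e6 = e5 by rewrite sw // c34 cN opprK c27.
have t567 : dot (cross e5 e6) e7 = 0.
  by rewrite -c16 [cross e5 e6]crossC [cross e1 e6]crossC dotNl dotNr opprK dot_cross
       d66 [dot e5 e1]dotC d15 [dot e6 e1]dotC d16; ring.
pose dotE := (d11, d12, d13, d14, d15, d16, d17, d22, d23, d24, d25, d26, d27, d33, d34, d35,
  d36, d37, d44, d45, d46, d47, d55, d56, d57, d66, d67, d77).
clearbody e3 e5 e6 e7.
pose e (i : 'I_7) := nth 0 [:: e1; e2; e3; e4; e5; e6; e7] i.
have ee i j : dot (e i) (e j) = (i == j)%:R.
  have le (a b : 'I_7) : (a <= b)%N -> dot (e a) (e b) = (a == b)%:R.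
    rewrite -[a == b]/(a == b :> nat).
    by case: a b => [[|[|[|[|[|[|[|//]]]]]]] ?] [[|[|[|[|[|[|[|//]]]]]]] ?] //= _;
       rewrite /e //=.
  have [/le //|/ltnW ji] := leqP i j.
  by rewrite dotC le // eq_sym.
exists (\matrix_(i < 7) e i); split.
  apply/matrixP => i j; rewrite [RHS]mxE -ee.
  by rewrite /dot !mxE; apply: eq_bigr => k _; rewrite !mxE.
have lt (i j k : 'I_7) : (i < j < k)%N -> dot (cross (e i) (e j)) (e k) = zR R (phi0 i j k).
  case: i j k => [[|[|[|[|[|[|[|//]]]]]]] Hi] [[|[|[|[|[|[|[|//]]]]]]] Hj]
                 [[|[|[|[|[|[|[|//]]]]]]] Hk] //= _;
  rewrite /e /= ?(c12, c13, c14, c15, c16, c17, c23, c24, c25, c26, c27, c34, c35, c36, c37,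
     c45, c46, c47, t567) ?dotNl;
  first [ by rewrite ?dotE ?oppr0 | by rewrite dotC ?dotE ?oppr0 ].
move=> i j k; rewrite -triple_slot !rowK.
pose X a b c := dot (cross (e a) (e b)) (e c) - zR R (phi0 a b c).
suff : X i j k = 0 by move/eqP; rewrite subr_eq0 => /eqP.
apply: (alt3_ext (X := X)) => a b c.
- by rewrite /X crossC dotNl phi0_alt12 zRN opprB opprK addrC.
- by rewrite /X triple23 phi0_alt23 zRN opprB opprK addrC.
by move=> abc; rewrite /X lt // subrr.
Qed.

End CrossProduct.

(** * Adapted frames *)

Section AdaptedFrame.
Variables (R : realType).
Local Notation I := 'I_7.
Local Notation o0 := (ord0 : I).

(** A cyclic permutation of an odd number of entries is even: here it is the
    square of another one. *)
Lemma levi_rot (p q r i j k l : I) : levi_civita R p q r i j k l = levi_civita R i j k l p q r.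
Proof.
have inj5 : injective (fun x : I => x + inord 5) by move=> x y; apply: addIr.
pose s := perm inj5.
pose A : 'M[R]_7 := \matrix_(a, b) (tnth [tuple p; q; r; i; j; k; l] a == b)%:R.
rewrite /levi_civita -/A.
have -> : \matrix_(a < 7, b < 7) (tnth [tuple i; j; k; l; p; q; r] a == b)%:R =
          row_perm (s * s)%g A.
  apply/matrixP => a b; rewrite !mxE; congr (_ == _)%:R; rewrite permM !permE.
  have E (x : I) : (x + inord 5 + inord 5 = inZp (x + 10) :> I).
    by apply: val_inj; rewrite /= inordK // modnDml -addnA.
  rewrite E (tnth_nth o0) [RHS](tnth_nth o0) /=.
  by case: a => [[|[|[|[|[|[|[|//]]]]]]] Ha].
by rewrite row_permE det_mulmx det_perm odd_permM addbb mul1r.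
Qed.

Lemma Wf_Wsum (phi : I -> I -> I -> R) i j : Wf phi i j = Wsum (phi i) (phi j) phi.
Proof.
rewrite /Wf /Wsum; apply: eq_bigr => a _; apply: eq_bigr => b _.
rewrite mulr_sumr; apply: eq_bigr => c _; rewrite mulr_sumr; apply: eq_bigr => d _.
rewrite /Gd mulr_sumr; rewrite mulr_sumr; apply: eq_bigr => e _.
rewrite !mulr_sumr; apply: eq_bigr => f _; rewrite !mulr_sumr; apply: eq_bigr => h _.
ring.
Qed.

Lemma Wf_ext (f h : I -> I -> I -> R) i j : (forall a b c, f a b c = h a b c) ->
  Wf f i j = Wf h i j.
Proof.
move=> fh; rewrite !Wf_Wsum /Wsum; do 7 (apply: eq_bigr => ? _).
by rewrite !fh.
Qed.

Local Notation zphi0 := (fun i j k => zR R (phi0 i j k)).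

Definition co_phi0 (a b c d : I) : Z :=
  Z.mul (phi0 (co4n 0 a b c d) (co4n 1 a b c d) (co4n 2 a b c d))
    (Z.mul (Z.of_nat 6)
      (epsZ [:: a; b; c; d; co4n 0 a b c d; co4n 1 a b c d; co4n 2 a b c d])).

Lemma Gd_co_phi0 a b c d : Gd zphi0 a b c d = zR R (co_phi0 a b c d).
Proof.
have p12 i j k : zphi0 i j k = - zphi0 j i k by rewrite phi0_alt12 zRN.
have p23 i j k : zphi0 i j k = - zphi0 i k j by rewrite phi0_alt23 zRN.
have := Gd_co p12 p23 a b c d; rewrite /rid => ->; rewrite leviE.
by rewrite /co_phi0 !zRM zR_nat mulrA mulrC.
Qed.

Lemma Gd_phi0 a b c d : - Gd zphi0 a b c d = (3`!)%:R * zR R (psi0 a b c d).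
Proof.
have H : all (fun a => all (fun b => all (fun c => all (fun d =>
    Z.opp (co_phi0 a b c d) == Z.mul (Z.of_nat 6) (psi0 a b c d))
    ords7) ords7) ords7) ords7 by vm_compute.
have Ha := allP H a (mem_ords7 a); have Hb := allP Ha b (mem_ords7 b).
have Hc := allP Hb c (mem_ords7 c); have /eqP E := allP Hc d (mem_ords7 d).
by rewrite Gd_co_phi0 -zRN E zRM zR_nat.
Qed.

Lemma Wf_phi0 : Wf zphi0 o0 o0 = 144%:R.
Proof.
rewrite /Wf; under eq_bigr => a _ do under eq_bigr => b _ do under eq_bigr => c _ do
  under eq_bigr => d _ do rewrite Gd_co_phi0 -zRM.
under eq_bigr => a _ do under eq_bigr => b _ do under eq_bigr => c _ do rewrite zR_sum.
under eq_bigr => a _ do under eq_bigr => b _ do rewrite zR_sum -zRM.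
under eq_bigr => a _ do rewrite zR_sum.
rewrite zR_sum -zR_nat; congr (zR R _).
Qed.

Section Phi.
Variable phi : I -> I -> I -> R.
Hypothesis phi12 : forall i j k, phi i j k = - phi j i k.
Hypothesis phi23 : forall i j k, phi i j k = - phi i k j.

Lemma slot3_alt12 F i j k : slot3 F phi i j k = - slot3 F phi j i k.
Proof.
rewrite /slot3 slotC -slotN; apply: eq_slot => a; rewrite -slotN; apply: eq_slot => b.
by rewrite -slotN; apply: eq_slot => c.
Qed.

Lemma slot3_alt23 F i j k : slot3 F phi i j k = - slot3 F phi i k j.
Proof.
rewrite /slot3 -slotN; apply: eq_slot => a; rewrite slotC -slotN; apply: eq_slot => b.
by rewrite -slotN; apply: eq_slot => c.
Qed.

Variables (G : 'M[R]_7) (vol : R).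
Hypothesis G_sym : G^T = G.
Hypothesis G_pos : forall v, v != 0 -> 0 < ip G v v.
Hypothesis vol_sqr : vol ^+ 2 = \det G.
Hypothesis phi_g2 : forall V W : I -> R,
  wedge223 (fun j k => \sum_i V i * phi i j k) (fun j k => \sum_i W i * phi i j k) phi =
  - 6 * (\sum_i \sum_j G i j * V i * W j) * vol.

(** The relation that ties metric and volume to [phi], written in an orthonormal
    frame. *)
Lemma Wf_frame F : F *m G *m F^T = 1%:M -> forall i j,
  Wf (slot3 F phi) i j = - (144%:R * (vol * \det F)) * (i == j)%:R.
Proof.
move=> FGF i j; rewrite Wf_Wsum.
pose X i b c := slot F (fun a => phi a b c) i.
have XE l p q : slot3 F phi l p q = slot_2 F (X l) p q.
  rewrite /slot3 /slot_2 slotC; apply: eq_slot => b.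
  by rewrite slotC; apply: eq_slot => c.
have -> : Wsum (slot3 F phi i) (slot3 F phi j) (slot3 F phi) =
          Wsum (slot_2 F (X i)) (slot_2 F (X j)) (slot3 F phi).
  by do 7 (apply: eq_bigr => ? _); rewrite !XE.
rewrite Wsum_slot.
have n24 : ((2`! * 2`! * 3`!)%:R : R) != 0 by rewrite pnatr_eq0.
have := phi_g2 (F i) (F j); rewrite /wedge223.
rewrite -[X in _ * X = _]/(Wsum (X i) (X j) phi).
have -> : \sum_a \sum_b G a b * F i a * F j b = (i == j)%:R.
  have := congr1 (fun M : 'M[R]_7 => M i j) FGF; rewrite !mxE => <-.
  rewrite exchange_big; apply: eq_bigr => b _ /=; rewrite !mxE mulr_suml.
  by apply: eq_bigr => a _; ring.
move/(congr1 (fun z => (2`! * 2`! * 3`!)%:R * z)); rewrite mulrA divff // mul1r => ->.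
rewrite (_ : (2`! * 2`! * 3`!)%N = 24%N) //; ring.
Qed.

Lemma vol_frame F : F *m G *m F^T = 1%:M -> (vol * \det F) ^+ 2 = 1.
Proof. by move=> FGF; rewrite exprMn vol_sqr mulrC (det_sqr FGF). Qed.

(** Start from any orthonormal frame; rotating it by [Q] gives further
    orthonormal frames, to each of which [cross_sqr] applies. *)
Lemma adapted_frame : exists F : 'M[R]_7, F *m G *m F^T = 1%:M /\
  forall i j k, slot3 F phi i j k = zR R (phi0 i j k).
Proof.
have [u [uu _]] := @ortho_unit _ _ G G_sym G_pos 0%N (fun _ => 0) isT.
have [F1 [FGF1 _]] := orthonormal_frame G_sym G_pos uu.
have slotM (Q : 'M[R]_7) p q r : slot3 (Q *m F1) phi p q r = slot3 Q (slot3 F1 phi) p q r.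
  have S1 (h : I -> R) a : slot (Q *m F1) h a = slot Q (slot F1 h) a.
    rewrite /slot; under eq_bigr => i _ do rewrite mxE mulr_suml.
    rewrite exchange_big; apply: eq_bigr => j _ /=; rewrite mulr_sumr.
    by apply: eq_bigr => i _; rewrite mulrA.
  have C (h : I -> I -> R) a b :
      slot F1 (fun i => slot Q (h i) b) a = slot Q (fun j => slot F1 (h^~ j) a) b.
    by rewrite slot_sum; apply: eq_bigr => m _; rewrite slotZ.
  rewrite /slot3 S1; apply: eq_slot => a.
  under eq_slot => a' do rewrite S1.
  rewrite C; apply: eq_slot => b.
  under eq_slot => a' do under eq_slot => b' do rewrite S1.
  under eq_slot => a' do rewrite C.
  by rewrite C.
have QGQ (Q : 'M[R]_7) : Q *m Q^T = 1%:M -> (Q *m F1) *m G *m (Q *m F1)^T = 1%:M.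
  by move=> QQ; rewrite trmx_mul !mulmxA -[Q *m F1 *m G *m F1^T]mulmxA -!mulmxA
       [F1 *m _]mulmxA [F1 *m G *m _]mulmxA FGF1 mul1mx.
have sq (Q : 'M[R]_7) : Q *m Q^T = 1%:M -> forall j k,
    \sum_m slot3 Q (slot3 F1 phi) ord0 j m * slot3 Q (slot3 F1 phi) ord0 m k =
    (j == ord0)%:R * (k == ord0)%:R - (j == k)%:R.
  move=> /QGQ FGF j k.
  have := cross_sqr (slot3_alt12 (Q *m F1)) (slot3_alt23 (Q *m F1)) (vol_frame FGF)
            (Wf_frame FGF).
  move/matrixP/(_ j k); rewrite !mxE => E.
  rewrite -[RHS]/(_ - (j == k)%:R).
  rewrite -natrM mulnb -E; apply: eq_bigr => m _; rewrite !mxE !slotM.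
  by [].
have [Q [QQ Qphi]] := octonion_frame (slot3_alt12 F1) (slot3_alt23 F1) sq.
by exists (Q *m F1); split=> [|i j k]; [exact: QGQ | rewrite slotM].
Qed.

Definition hodge_dual (Gi : 'M[R]_7) i j k l : R := (3`!)%:R^-1 *
  ctr Gi (fun a a' => ctr Gi (fun b b' => ctr Gi (fun d d' =>
    phi a b d * (vol * levi_civita R a' b' d' i j k l)))).

(** The orientation is determined by [phi]: since [Wf] of [phi0] at [(0, 0)] is
    [144] and not [- 144], an adapted frame has [vol * \det F = -1]. *)
Lemma adapted_dual F Gi : Gi *m G = 1%:M -> F *m G *m F^T = 1%:M ->
    (forall i j k, slot3 F phi i j k = zR R (phi0 i j k)) ->
  forall i j k l, slot4 F (hodge_dual Gi) i j k l = zR R (psi0 i j k l).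
Proof.
move=> GiG FGF Fphi i j k l.
have sgm : vol * \det F = -1.
  have := Wf_frame FGF o0 o0; rewrite eqxx mulr1 (_ : Wf _ _ _ = 144%:R) ?Wf_phi0 //; last first.
    by rewrite -Wf_phi0; apply: Wf_ext.
  by move=> E; lra.
rewrite {1}/slot4 /slot3 /hodge_dual.
under eq_slot => a do under eq_slot => b do under eq_slot => c do rewrite slotZ.
under eq_slot => a do under eq_slot => b do rewrite slotZ.
under eq_slot => a do rewrite slotZ.
rewrite slotZ -[X in _ * X]/(slot4 F (fun i j k l => ctr Gi (fun a a' => ctr Gi (fun b b' =>
  ctr Gi (fun d d' => phi a b d * (vol * levi_civita R a' b' d' i j k l))))) i j k l).
rewrite (slot4_dual GiG FGF) sgm.
have n6 : ((3`!)%:R : R) != 0 by rewrite pnatr_eq0.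
apply: (mulfI n6); rewrite mulrA divff // mul1r -(Gd_phi0 i j k l) /Gd -sumrN.
apply: eq_bigr => p _; rewrite -sumrN; apply: eq_bigr => q _; rewrite -sumrN.
by apply: eq_bigr => r _; rewrite levi_rot Fphi; ring.
Qed.
End Phi.
End AdaptedFrame.

Local Open Scope classical_set_scope.
Local Open Scope ring_scope.

(** * Calculus of smooth functions *)

Section SmoothClosure.
Variables (R : realType) (n : nat) (U : set 'rV[R]_n).
Hypothesis openU : open U.
Implicit Types f g : 'rV[R]_n -> R.

Lemma near_open x f g :
  U x -> (forall y, U y -> f y = g y) -> \forall y \near x, f y = g y.
Proof. by move=> Ux fg; apply: (filterS fg); exact: open_nbhs_nbhs. Qed.

Lemma eq_partial i f g x :
  (forall y, U y -> f y = g y) -> U x -> partial i f x = partial i g x.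
Proof. by move=> fg Ux; apply: near_eq_derive; exact: near_open. Qed.

Lemma continuous_eq_open f g x : (forall y, U y -> f y = g y) -> U x ->
  {for x, continuous f} -> {for x, continuous g}.
Proof.
move=> fg Ux fc; change (g @ x --> g x); rewrite -(fg _ Ux).
apply: cvg_trans fc.
exact: (@near_eq_cvg _ _ (nbhs x) _ _ _ (near_open Ux fg)).
Qed.

Lemma eq_Ck_on k f g :
  (forall y, U y -> f y = g y) -> Ck_on k U f -> Ck_on k U g.
Proof.
elim: k f g => [|k IH] f g fg /= [fc fd].
  by split=> // x Ux; exact: (continuous_eq_open fg Ux (fc x Ux)).
split=> [x Ux|i]; first exact: (continuous_eq_open fg Ux (fc x Ux)).
have [fdi Cfi] := fd i; split=> [x Ux|].
  by apply: near_eq_derivable (fdi x Ux); exact: near_open.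
by apply: IH Cfi => y Uy; apply: eq_partial.
Qed.

Lemma eq_smooth_on f g :
  (forall y, U y -> f y = g y) -> smooth_on U f -> smooth_on U g.
Proof. by move=> fg sf k; apply: eq_Ck_on fg (sf k). Qed.

Lemma Ck_onW k f : Ck_on k.+1 U f -> Ck_on k U f.
Proof.
elim: k f => [|k IH] f; first by case.
by move=> [fc fd]; split => // i; have [? ?] := fd i; split => //; exact: IH.
Qed.

Lemma smooth_derivable i f x :
  smooth_on U f -> U x -> derivable f x (delta_mx ord0 i : 'rV[R]_n).
Proof. by move=> /(_ 1%N) [_ /(_ i) [H _]] /H. Qed.

Lemma smooth_continuous f x : smooth_on U f -> U x -> {for x, continuous f}.
Proof. by move=> /(_ 0%N) [H _] /H. Qed.

Lemma smooth_partial i f : smooth_on U f -> smooth_on U (partial i f).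
Proof. by move=> sf k; have [_ /(_ i) []] := sf k.+1. Qed.

Lemma partial_cst i (a : R) (x : 'rV[R]_n) : partial i (fun=> a) x = 0.
Proof. exact: (@derive_val _ _ _ _ _ _ _ (is_derive_cst a x _)). Qed.

Lemma smooth_cst (a : R) : smooth_on U (fun=> a).
Proof.
move=> k; elim: k a => [|k IH] a; (split; first by move=> x _; exact: cst_continuous) => //.
move=> i; split=> [x _|]; first exact: derivable_cst.
by apply: eq_Ck_on (IH 0) => y _; rewrite partial_cst.
Qed.

Lemma partialD i f g x : smooth_on U f -> smooth_on U g -> U x ->
  partial i (fun y => f y + g y) x = partial i f x + partial i g x.
Proof. by move=> sf sg Ux; apply: deriveD; exact: smooth_derivable. Qed.

Lemma partialM i f g x : smooth_on U f -> smooth_on U g -> U x ->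
  partial i (fun y => f y * g y) x = partial i f x * g x + f x * partial i g x.
Proof.
move=> sf sg Ux; rewrite /partial deriveM; [|exact: smooth_derivable..].
by rewrite /GRing.scale /= [RHS]addrC [partial i f x * _]mulrC.
Qed.

Lemma Ck_onD k f g :
  Ck_on k U f -> Ck_on k U g -> Ck_on k U (fun y => f y + g y).
Proof.
elim: k f g => [|k IH] f g [fc fd] [gc gd];
  (split; first by move=> x Ux; exact: (cvgD (fc x Ux) (gc x Ux))) => //.
move=> i; have [dfi Cfi] := fd i; have [dgi Cgi] := gd i.
split=> [x Ux|]; first by apply: derivableD; [exact: dfi|exact: dgi].
apply: eq_Ck_on (IH _ _ Cfi Cgi) => y Uy.
by rewrite /partial deriveD //; [exact: dfi|exact: dgi].
Qed.

Lemma Ck_onM k f g :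
  Ck_on k U f -> Ck_on k U g -> Ck_on k U (fun y => f y * g y).
Proof.
elim: k f g => [|k IH] f g Cf Cg; have [fc fd] := Cf; have [gc gd] := Cg;
  (split; first by move=> x Ux; exact: (cvgM (fc x Ux) (gc x Ux))) => //.
move=> i; have [dfi Cfi] := fd i; have [dgi Cgi] := gd i.
split=> [x Ux|]; first by apply: derivableM; [exact: dfi|exact: dgi].
apply: eq_Ck_on
  (Ck_onD (IH _ _ Cfi (Ck_onW Cg)) (IH _ _ (Ck_onW Cf) Cgi)) => y Uy.
rewrite /partial deriveM //; [|exact: dfi|exact: dgi].
by rewrite /GRing.scale /= [RHS]addrC [partial i f y * _]mulrC.
Qed.

Lemma smoothD f g :
  smooth_on U f -> smooth_on U g -> smooth_on U (fun y => f y + g y).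
Proof. by move=> sf sg k; exact: Ck_onD. Qed.

Lemma smoothM f g :
  smooth_on U f -> smooth_on U g -> smooth_on U (fun y => f y * g y).
Proof. by move=> sf sg k; exact: Ck_onM. Qed.

Lemma smoothN f : smooth_on U f -> smooth_on U (fun y => - f y).
Proof.
move=> sf; apply: (@eq_smooth_on (fun y => -1 * f y)).
  by move=> y _; rewrite mulN1r.
by apply: smoothM => //; exact: smooth_cst.
Qed.

Lemma smooth_sum (I : Type) (r : seq I) (P : pred I) (F : I -> 'rV[R]_n -> R) :
  (forall i, smooth_on U (F i)) ->
  smooth_on U (fun y => \sum_(i <- r | P i) F i y).
Proof.
move=> sF; elim: r => [|i r IH].
  by apply: (@eq_smooth_on (fun=> 0)); [move=> y _; rewrite big_nil|exact: smooth_cst].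
case Pi: (P i).
  apply: (@eq_smooth_on (fun y => F i y + \sum_(i <- r | P i) F i y)).
    by move=> y _; rewrite big_cons Pi.
  exact: smoothD.
by apply: eq_smooth_on IH => y _; rewrite big_cons Pi.
Qed.

Lemma smooth_prod (I : Type) (r : seq I) (F : I -> 'rV[R]_n -> R) :
  (forall i, smooth_on U (F i)) ->
  smooth_on U (fun y => \prod_(i <- r) F i y).
Proof.
move=> sF; elim: r => [|i r IH].
  by apply: (@eq_smooth_on (fun=> 1)); [move=> y _; rewrite big_nil|exact: smooth_cst].
apply: (@eq_smooth_on (fun y => F i y * \prod_(i <- r) F i y)).
  by move=> y _; rewrite big_cons.
exact: smoothM.
Qed.

Lemma partial_sum (I : Type) (r : seq I) (P : pred I) i (F : I -> 'rV[R]_n -> R) x :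
  (forall j, smooth_on U (F j)) -> U x ->
  partial i (fun y => \sum_(j <- r | P j) F j y) x = \sum_(j <- r | P j) partial i (F j) x.
Proof.
move=> sF Ux; elim: r => [|j r IH].
  by rewrite big_nil -[RHS](partial_cst i 0 x); apply: eq_partial => // y _; rewrite big_nil.
rewrite big_cons -IH; case Pj: (P j); last first.
  by apply: eq_partial => // y _; rewrite big_cons Pj.
rewrite -partialD//; last exact: smooth_sum.
by apply: eq_partial => // y _; rewrite big_cons Pj.
Qed.

Lemma smoothV f : smooth_on U f -> (forall x, U x -> f x != 0) ->
  smooth_on U (fun y => (f y)^-1).
Proof.
move=> sf f0 k; elim: k => [|k IH];
  (split; first by move=> x Ux; exact: (cvgV (f0 x Ux) (smooth_continuous sf Ux))) => //.
move=> i; split=> [x Ux|].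
  by apply: derivableV; [exact: f0|exact: smooth_derivable].
have E y : U y -> - partial i f y * (f y)^-1 * (f y)^-1 = partial i (fun y => (f y)^-1) y.
  move=> Uy; rewrite /partial deriveV ?f0//; last exact: smooth_derivable.
  by rewrite /GRing.scale /= -exprVn expr2; ring.
apply: eq_Ck_on E _.
by apply: Ck_onM => //; apply: Ck_onM => //; apply: smoothN; exact: smooth_partial.
Qed.

End SmoothClosure.

(** * Symmetry of second derivatives *)

Section Schwarz.
Variables (R : realType) (n : nat) (U : set 'rV[R]_n).
Hypothesis openU : open U.
Implicit Types f g : 'rV[R]_n -> R.

Local Notation e_ i := (delta_mx ord0 i : 'rV[R]_n).

Lemma is_derive_line i f a t : smooth_on U f -> U (t *: e_ i + a) ->
  is_derive t (1 : R) (fun s : R => f (s *: e_ i + a)) (partial i f (t *: e_ i + a)).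
Proof.
move=> sf Ut; have := smooth_derivable (i := i) sf Ut.
rewrite /partial /derive /derivable => df.
have E : (fun h : R => h^-1 *: (((fun s : R => f (s *: e_ i + a)) \o shift t) (h *: (1 : R))
            - f (t *: e_ i + a))) =
         (fun h : R => h^-1 *: ((f \o shift (t *: e_ i + a)) (h *: e_ i) - f (t *: e_ i + a))).
  apply/funext => h /=; congr (_ *: (f _ - _)).
  by rewrite [_%:A]mulr1 scalerDl addrA.
by split; rewrite /derivable /derive E.
Qed.

Lemma MVT_line i f a h : smooth_on U f -> 0 <= h ->
  (forall t, 0 <= t <= h -> U (t *: e_ i + a)) ->
  exists2 c, 0 <= c <= h &
    f (h *: e_ i + a) - f a = partial i f (c *: e_ i + a) * h.
Proof.
move=> sf h0 HU.
have [||c] := @MVT_segment R (fun s : R => f (s *: e_ i + a))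
   (fun t => partial i f (t *: e_ i + a)) 0 h h0.
- move=> t; rewrite in_itv /= => /andP[t0 th].
  by apply: is_derive_line sf _; apply: HU; rewrite !ltW.
- apply: derivable_within_continuous => t; rewrite in_itv /= => tI.
  have H := is_derive_line sf (HU _ tI); exact: (@ex_derive _ _ _ _ _ _ _ H).
by rewrite in_itv /= subr0 scale0r add0r => cI ->; exists c.
Qed.

(** The mean value theorem, applied first to a difference of [f] in direction
    [i] and then in direction [j]. *)
Lemma MVT_square i j f x h : smooth_on U f -> 0 <= h ->
  (forall s t, 0 <= s <= h -> 0 <= t <= h -> U (s *: e_ i + (t *: e_ j + x))) ->
  exists s t, [/\ 0 <= s <= h, 0 <= t <= h &
    f (h *: e_ i + (h *: e_ j + x)) - f (h *: e_ i + x) - f (h *: e_ j + x) + f x =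
    partial j (partial i f) (s *: e_ i + (t *: e_ j + x)) * h * h].
Proof.
move=> sf h0 HU.
have h00 : 0 <= (0 : R) <= h by rewrite lexx h0.
have hh : 0 <= h <= h by rewrite h0 lexx.
have [||s sI E] := @MVT_segment R
    (fun s : R => f (s *: e_ i + (h *: e_ j + x)) - f (s *: e_ i + (0 *: e_ j + x)))
    (fun s => partial i f (s *: e_ i + (h *: e_ j + x))
              - partial i f (s *: e_ i + (0 *: e_ j + x))) 0 h h0.
- move=> s; rewrite in_itv /= => /andP[s0 sh].
  have sI : 0 <= s <= h by rewrite !ltW.
  by apply: is_deriveB; [exact: is_derive_line sf (HU s h sI hh)|exact: is_derive_line sf (HU s 0 sI h00)].
- apply: derivable_within_continuous => s; rewrite in_itv /= => sI.
  by apply: derivableB; [have H := is_derive_line sf (HU s h sI hh)|have H := is_derive_line sf (HU s 0 sI h00)];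
     exact: (@ex_derive _ _ _ _ _ _ _ H).
move: E; rewrite in_itv /= in sI; rewrite subr0 !scale0r !add0r => E.
have [|t tI F] := @MVT_line j (partial i f) (s *: e_ i + x) h (smooth_partial i sf) h0.
  by move=> t tI; rewrite addrCA; exact: HU.
exists s, t; split=> //; rewrite [s *: _ + _]addrCA -F [h *: e_ j + (s *: _ + _)]addrCA -E; ring.
Qed.

Lemma small_square i j x : U x -> forall e : R, 0 < e ->
  exists2 h : R, 0 < h & forall s t, 0 <= s <= h -> 0 <= t <= h ->
    U (s *: e_ i + (t *: e_ j + x)) /\ `|s *: e_ i + (t *: e_ j + x) - x| < e.
Proof.
move=> Ux e e0.
have /nbhs_normP[d /= d0 dU] : nbhs x U by exact: open_nbhs_nbhs.
set C := `|e_ i| + `|e_ j| + 1.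
have C0 : 0 < C by rewrite ltr_wpDl// addr_ge0.
exists (Num.min d e / C / 2).
  by rewrite !divr_gt0// lt_min d0.
move=> s t /andP[s0 sh] /andP[t0 th].
have H : `|s *: e_ i + (t *: e_ j + x) - x| < Num.min d e.
  rewrite addrA addrK (le_lt_trans (ler_normD _ _))// !normrZ !ger0_norm//.
  have m0 : 0 < Num.min d e by rewrite lt_min d0.
  apply: (@le_lt_trans _ _ (Num.min d e / C / 2 * (`|e_ i| + `|e_ j|))).
    by rewrite mulrDr lerD// ler_wpM2r.
  apply: (@lt_le_trans _ _ (Num.min d e / C * C)); last by rewrite divfK ?gt_eqF.
  rewrite -mulrA ltr_pM2l ?divr_gt0// /C; have := normr_ge0 (e_ i); have := normr_ge0 (e_ j); lra.
move: H; rewrite lt_min => /andP[Hd He]; split=> //.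
by apply: dU; rewrite /ball_/= distrC.
Qed.

(** Symmetry of second derivatives: by the mean value theorem both mixed
    derivatives occur, at points arbitrarily close to [x], as the same second
    difference quotient of [f]; continuity does the rest. *)
Lemma partialC i j f x : smooth_on U f -> U x ->
  partial i (partial j f) x = partial j (partial i f) x.
Proof.
move=> sf Ux; apply/eqP; rewrite -subr_eq0 -normr_le0; apply/ler_addgt0Pl => e e0.
rewrite addr0.
have e2 : 0 < e / 2 by rewrite divr_gt0.
have cont g : smooth_on U g -> exists2 d : R, 0 < d & forall y, `|y - x| < d -> `|g x - g y| < e / 2.
  move=> sg; have /cvgrPdist_lt /(_ _ e2) := smooth_continuous sg Ux.
  move=> /nbhs_normP[d /= d0 dU]; exists d => // y xy.
  by apply: dU; rewrite /ball_/= distrC.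
have [d1 d10 H1] := cont _ (smooth_partial i (smooth_partial j sf)).
have [d2 d20 H2] := cont _ (smooth_partial j (smooth_partial i sf)).
have [|h h0 Hh] := @small_square i j x Ux (Num.min d1 d2); first by rewrite lt_min d10.
have [s1 [t1 [s1I t1I E1]]] := @MVT_square i j f x h sf (ltW h0) (fun s t hs ht => (Hh s t hs ht).1).
have [|s2 [t2 [s2I t2I E2]]] := @MVT_square j i f x h sf (ltW h0).
  by move=> s t hs ht; rewrite addrCA; exact: (Hh t s ht hs).1.
have P2 := addrCA (s2 *: e_ j) (t2 *: e_ i) x.
have Ph := addrCA (h *: e_ j) (h *: e_ i) x.
rewrite P2 Ph in E2.
have [_] := Hh _ _ s1I t1I; rewrite lt_min => /andP[_ /H2 K2].
have [_] := Hh _ _ t2I s2I; rewrite lt_min => /andP[/H1 K1 _].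
have E : partial j (partial i f) (s1 *: e_ i + (t1 *: e_ j + x)) =
         partial i (partial j f) (t2 *: e_ i + (s2 *: e_ j + x)).
  apply: (mulIf (lt0r_neq0 h0)); apply: (mulIf (lt0r_neq0 h0)).
  apply: etrans (esym E1) _; apply: etrans _ E2; congr (_ + _); exact: addrAC.
rewrite -E in K1.
move: {E} K1 K2; move: (partial j (partial i f) (_ + _)) => p K1 K2.
apply: le_trans (ler_distD p _ _) _.
rewrite [e]splitr; apply: ltW; apply: ltrD; first exact: K1.
by rewrite distrC; exact: K2.
Qed.

End Schwarz.

(** * Smoothness of inverse matrices *)

Section SmoothMatrix.
Variables (R : realType) (n : nat) (U : set 'rV[R]_n).
Hypothesis openU : open U.

Lemma smooth_det m (A : 'rV[R]_n -> 'M[R]_m) :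
  (forall i j, smooth_on U (fun y => A y i j)) ->
  smooth_on U (fun y => \det (A y)).
Proof.
move=> sA; apply: smooth_sum => // s; apply: smoothM => //; first exact: smooth_cst.
exact: smooth_prod.
Qed.

(** By Cramer's rule. *)
Lemma smooth_invmx m (A : 'rV[R]_n -> 'M[R]_m) i j :
  (forall i j, smooth_on U (fun y => A y i j)) ->
  (forall y, U y -> A y \in unitmx) ->
  smooth_on U (fun y => invmx (A y) i j).
Proof.
move=> sA uA.
apply: (eq_smooth_on openU (f := fun y => (\det (A y))^-1 * cofactor (A y) j i)) => //.
  by move=> y Uy; rewrite /invmx uA// !mxE.
apply: smoothM => //.
  apply: smoothV => //; first exact: smooth_det.
  by move=> y /uA; rewrite unitmxE unitfE.
apply: smoothM => //; first exact: smooth_cst.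
apply: smooth_det => k l.
by apply: (eq_smooth_on openU (f := fun y => A y (lift j k) (lift i l))) => // y _; rewrite !mxE.
Qed.
End SmoothMatrix.

Ltac smooth_step :=
  match goal with
  | H : _ |- _ => exact: H
  | |- smooth_on _ (fun _ => ?a) => apply: smooth_cst
  | |- smooth_on _ (fun y => @?f y + @?g y) => apply: smoothD
  | |- smooth_on _ (fun y => - @?f y) => apply: smoothN
  | |- smooth_on _ (fun y => @?f y * @?g y) => apply: smoothM
  | |- smooth_on _ (fun y => \sum_(i <- _ | _) @?F i y) =>
      apply: smooth_sum; last move=> ?
  | |- smooth_on _ (partial _ _) => apply: smooth_partial
  | |- smooth_on _ (fun y => partial _ _ y) => apply: smooth_partial
  end.
Ltac smooth := repeat smooth_step.

(** * Horizontal jets *)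

Section JeqPrinciple.
Variables (R : comNzRingType) (I : Type).
Implicit Types f g : jet R I.

Lemma jeqS m f g : f [::] = g [::] ->
  (forall c, jeq m (jshift c f) (jshift c g)) -> jeq m.+1 f g.
Proof. by move=> fg0 fgS [|c w] //= sw; apply: fgS. Qed.

Lemma jeqP f g : (forall m, jeq m f g) -> f = g.
Proof. by move=> fg; apply/funext => w; exact: (fg (size w)). Qed.

Lemma jeqD m f f' g g' : jeq m f f' -> jeq m g g' -> jeq m (f + g) (f' + g').
Proof. by move=> ff gg w sw; congr (_ + _); [exact: ff|exact: gg]. Qed.
End JeqPrinciple.

Section HorizontalJets.
Variables (R : realType) (n : nat) (U : set 'rV[R]_n).
Hypothesis openU : open U.
Variable x : 'rV[R]_n.
Hypothesis Ux : U x.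
Variable Gam : 'rV[R]_n -> 'I_n -> 'I_n -> 'I_n -> R.
Variable E0 : 'M[R]_n.
Implicit Types A B : 'rV[R]_n -> R.
Local Notation J := (jet R 'I_n).

(** The horizontal lift of the coordinate direction [p], weighted by the frame,
    acts on functions of the base point by [fr c p * partial p] and on the frame
    itself by parallel transport, [- Gam^k_pi fr_c^p fr_a^i].  This
    defines the jets of functions and of the frame by mutual recursion on the
    order. *)
Fixpoint hjet_upto N : (('rV[R]_n -> R) -> J) * ('I_n -> 'I_n -> J) :=
  if N is N'.+1 then
    let: (F, fr) := hjet_upto N' in
    (fun A w => if w is c :: u then (\sum_p fr c p * F (partial p A)) u else A x,
     fun a k w => if w is c :: u then
       (- \sum_p \sum_i F (fun y => Gam y k p i) * fr c p * fr a i) u else E0 a k)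
  else (fun A _ => A x, fun a k _ => E0 a k).

Definition hjet A : J := fun w => (hjet_upto (size w)).1 A w.
Definition frame a k : J := fun w => (hjet_upto (size w)).2 a k w.

Lemma hjet_uptoS N :
  (forall A, jeq N ((hjet_upto N.+1).1 A) ((hjet_upto N).1 A)) /\
  (forall a k, jeq N ((hjet_upto N.+1).2 a k) ((hjet_upto N).2 a k)).
Proof.
elim: N => [|N [IH1 IH2]]; first by split=> [A|a k] [].
have EN M : hjet_upto M.+1 = let: (F, fr) := hjet_upto M in
    (fun A w => if w is c :: u then (\sum_p fr c p * F (partial p A)) u else A x,
     fun a k w => if w is c :: u then
       (- \sum_p \sum_i F (fun y => Gam y k p i) * fr c p * fr a i) u else E0 a k) by [].
move: IH1 IH2; rewrite (EN N.+1) (EN N).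
case: (hjet_upto N) => F fr /= IH1 IH2.
split=> [A|a k] [|c u] //= su.
  apply: (@jeq_sum _ _ _ _ _ N) => // p; apply: jeqM; [exact: IH2|exact: IH1].
congr (- _); apply: (@jeq_sum _ _ _ _ _ N) => // p; apply: jeq_sum => i.
by apply: jeqM; [apply: jeqM; [exact: IH1|exact: IH2]|exact: IH2].
Qed.

(** Computing to a higher order does not change the lower orders, so that
    [hjet] and [frame] satisfy the recursion as equations of jets. *)
Lemma hjet_upto_stable N :
  (forall A, jeq N (hjet A) ((hjet_upto N).1 A)) /\
  (forall a k, jeq N (frame a k) ((hjet_upto N).2 a k)).
Proof.
have H w M : (size w <= M)%N ->
    (forall A, (hjet_upto M).1 A w = hjet A w) /\
    (forall a k, (hjet_upto M).2 a k w = frame a k w).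
  elim: M => [|M IH]; first by rewrite leqn0 => /eqP w0; rewrite /hjet /frame w0.
  rewrite leq_eqVlt => /orP[/eqP w0|]; first by rewrite /hjet /frame w0.
  rewrite ltnS => wM; have [I1 I2] := IH wM; have [H1 H2] := hjet_uptoS M.
  by split=> [A|a k]; rewrite (H1, H2).
by split=> [A|a k] w /H[H1 H2]; rewrite (H1, H2).
Qed.

Lemma hjet_nil A : hjet A [::] = A x. Proof. by []. Qed.
Lemma jshift_hjet c A :
  jshift c (hjet A) = \sum_p frame c p * hjet (partial p A).
Proof.
apply/funext => u; rewrite /jshift /hjet /=.
have [] := hjet_upto_stable (size u); case: (hjet_upto (size u)) => F fr /= HF Hfr.
apply/esym; apply: (@jeq_sum _ _ _ _ _ (size u)) => // p.
by apply: jeqM; [exact: Hfr|exact: HF].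
Qed.

Lemma jshift_frame c a k : jshift c (frame a k) =
  - \sum_p \sum_i hjet (fun y => Gam y k p i) * frame c p * frame a i.
Proof.
apply/funext => u; rewrite /jshift [LHS]/frame /=.
have [] := hjet_upto_stable (size u); case: (hjet_upto (size u)) => F fr /= HF Hfr.
apply/esym; congr (- _); apply: (@jeq_sum _ _ _ _ _ (size u)) => // p.
apply: jeq_sum => i; apply: jeqM; last exact: Hfr.
by apply: jeqM; [exact: HF|exact: Hfr].
Qed.

Lemma eq_hjet A B : (forall y, U y -> A y = B y) -> hjet A = hjet B.
Proof.
move=> AB; apply: jeqP => m; elim: m A B AB => [|m IH] A B AB.
  by case=> // _; rewrite !hjet_nil AB.
apply: jeqS; first by rewrite !hjet_nil AB.
move=> c; rewrite !jshift_hjet; apply: jeq_sum => p; apply: jeqM => //.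
by apply: IH => y Uy; exact: (eq_partial openU p AB Uy).
Qed.

Lemma hjetD A B : smooth_on U A -> smooth_on U B ->
  hjet (fun y => A y + B y) = hjet A + hjet B.
Proof.
move=> sA sB; apply: jeqP => m; elim: m A B sA sB => [|m IH] A B sA sB; first by case.
apply: jeqS => // c; rewrite jshiftD !jshift_hjet -big_split /=.
apply: jeq_sum => p; rewrite -mulrDr; apply: jeqM => //.
have -> : hjet (partial p (fun y => A y + B y)) = hjet (fun y => partial p A y + partial p B y).
  by apply: eq_hjet => y Uy; exact: partialD.
by apply: IH; exact: smooth_partial.
Qed.

(** By induction on the order: both sides have the same value and, by the
    Leibniz rule on either side, the same derivatives. *)
Lemma hjetM A B : smooth_on U A -> smooth_on U B ->
  hjet (fun y => A y * B y) = hjet A * hjet B.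
Proof.
move=> sA sB; apply: jeqP => m; elim: m A B sA sB => [|m IH] A B sA sB; first by case.
apply: jeqS => // c; rewrite jshiftM !jshift_hjet mulr_suml mulr_sumr -big_split /=.
apply: jeq_sum => p.
have -> : hjet (partial p (fun y => A y * B y)) =
    hjet (fun y => partial p A y * B y) + hjet (fun y => A y * partial p B y).
  rewrite -hjetD; [|exact: smoothM (smooth_partial p sA) sB|
                    exact: smoothM sA (smooth_partial p sB)].
  by apply: eq_hjet => y Uy; exact: partialM.
rewrite mulrDr; apply: jeqD.
  by rewrite -mulrA; apply: jeqM => //; apply: IH => //; exact: smooth_partial.
by rewrite mulrCA; apply: jeqM => //; apply: IH => //; exact: smooth_partial.
Qed.

Lemma hjet_cst (a : R) : hjet (fun=> a) = jcst a.
Proof.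
suff H m b : jeq m (hjet (fun=> b)) (jcst b : J) by apply: jeqP => m.
elim: m b => [|m IH] b; first by case.
apply: jeqS => // c; rewrite jshift_hjet jshift_cst.
have Z : \sum_(p < n) (0 : J) = 0 by rewrite big1.
rewrite -[X in jeq _ _ X]Z.
apply: jeq_sum => p.
rewrite -[X in jeq _ _ X](mulr0 (frame c p)); apply: jeqM => //.
have -> : hjet (partial p (fun=> b)) = hjet (fun=> 0).
  by apply: eq_hjet => y Uy; exact: partial_cst.
by move=> w sw; rewrite IH//; case: w {sw}.
Qed.

Lemma hjet0 : hjet (fun=> 0) = 0. Proof. exact: hjet_cst. Qed.

Lemma hjetN A : smooth_on U A -> hjet (fun y => - A y) = - hjet A.
Proof.
move=> sA; apply/eqP; rewrite -addr_eq0 -hjetD//; last exact: smoothN.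
by apply/eqP; rewrite -hjet0; apply: eq_hjet => y _; rewrite addNr.
Qed.

Lemma hjetB A B : smooth_on U A -> smooth_on U B ->
  hjet (fun y => A y - B y) = hjet A - hjet B.
Proof. by move=> sA sB; rewrite hjetD ?hjetN//; exact: smoothN. Qed.

Lemma hjetZ a A : smooth_on U A -> hjet (fun y => a * A y) = jcst a * hjet A.
Proof. by move=> sA; rewrite hjetM ?hjet_cst//; exact: smooth_cst. Qed.

Lemma hjet_sum (K : Type) (r : seq K) (P : pred K) (F : K -> 'rV[R]_n -> R) :
  (forall i, smooth_on U (F i)) ->
  hjet (fun y => \sum_(i <- r | P i) F i y) = \sum_(i <- r | P i) hjet (F i).
Proof.
move=> sF; elim: r => [|i r IH].
  by rewrite big_nil -hjet0; apply: eq_hjet => y _; rewrite big_nil.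
rewrite big_cons -IH; case Pi: (P i); last by apply: eq_hjet => y _; rewrite big_cons Pi.
rewrite -hjetD//; last exact: smooth_sum.
by apply: eq_hjet => y _; rewrite big_cons Pi.
Qed.

End HorizontalJets.

(** * Covariant derivatives and curvature in a frame *)

Section LeviCivita.
Variables (R : realType) (n : nat) (U : set 'rV[R]_n).
Hypothesis openU : open U.
Variable g : 'rV[R]_n -> 'M[R]_n.
Hypothesis smooth_g : forall i j, smooth_on U (fun y => g y i j).
Hypothesis sym_g : forall y i j, U y -> g y i j = g y j i.
Hypothesis unit_g : forall y, U y -> g y \in unitmx.

Lemma smooth_ginv i j : smooth_on U (fun y => invmx (g y) i j).
Proof. exact: smooth_invmx. Qed.

Lemma smooth_christoffel k i j : smooth_on U (fun y => christoffel g y k i j).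
Proof. by rewrite /christoffel; smooth; exact: smooth_ginv. Qed.

Lemma smooth_riemann i j k l : smooth_on U (fun y => riemann g y i j k l).
Proof. by rewrite /riemann; smooth; exact: smooth_christoffel. Qed.

Lemma smooth_nabla1 (X : 'rV[R]_n -> 'I_n -> R) p i :
  (forall i, smooth_on U (fun y => X y i)) -> smooth_on U (fun y => nabla1 g X y p i).
Proof. by move=> sX; rewrite /nabla1; smooth; exact: smooth_christoffel. Qed.

Lemma smooth_nabla2 (A : 'rV[R]_n -> 'I_n -> 'I_n -> R) p i j :
  (forall i j, smooth_on U (fun y => A y i j)) ->
  smooth_on U (fun y => nabla2 g A y p i j).
Proof. by move=> sX; rewrite /nabla2; smooth; exact: smooth_christoffel. Qed.

Lemma smooth_contract (F : 'rV[R]_n -> 'I_n -> 'I_n -> R) :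
  (forall i j, smooth_on U (fun y => F y i j)) ->
  smooth_on U (fun y => contract g y (F y)).
Proof. by move=> sF; rewrite /contract; smooth; exact: smooth_ginv. Qed.

Lemma partial_sym_g p i j y : U y ->
  partial p (fun z => g z i j) y = partial p (fun z => g z j i) y.
Proof. by move=> Uy; apply: (eq_partial openU) => // z Uz; exact: sym_g. Qed.

Lemma christoffel_sym k i j y : U y -> christoffel g y k i j = christoffel g y k j i.
Proof.
move=> Uy; rewrite /christoffel; congr (_ * _); apply: eq_bigr => l _; congr (_ * _).
by rewrite (partial_sym_g l i j Uy) [X in X - _]addrC.
Qed.

Lemma ginvK i j y : U y -> \sum_k g y i k * invmx (g y) k j = (i == j)%:R.
Proof.
by move=> Uy; have /matrixP/(_ i j) := mulmxV (unit_g Uy); rewrite !mxE.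
Qed.

Lemma christoffel_lower p i j y : U y ->
  \sum_m christoffel g y m p i * g y m j =
  2^-1 * (partial p (fun z => g z i j) y + partial i (fun z => g z p j) y
          - partial j (fun z => g z p i) y).
Proof.
move=> Uy; rewrite /christoffel.
under eq_bigr => m _ do rewrite -mulrA mulr_suml.
rewrite -mulr_sumr exchange_big /=; congr (_ * _).
under eq_bigr => l _.
  under eq_bigr => m _ do rewrite mulrAC [_ * g y m j]mulrC (sym_g m j Uy).
  rewrite -mulr_suml ginvK //; over.
rewrite (bigD1 j) //= eqxx mul1r big1 ?addr0 // => l /negbTE lj.
by rewrite eq_sym lj mul0r.
Qed.

Lemma nabla_g p i j y : U y -> nabla2 g (fun z i j => g z i j) y p i j = 0.
Proof.
move=> Uy; rewrite /nabla2 christoffel_lower //.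
under [X in _ - _ - X]eq_bigr => m _ do rewrite (sym_g i m Uy).
rewrite christoffel_lower // (partial_sym_g p j i Uy) (partial_sym_g i p j Uy).
by rewrite (partial_sym_g j p i Uy); field.
Qed.

Lemma riemann_Bianchi i j m k y : U y ->
  riemann g y i j m k + riemann g y j m i k + riemann g y m i j k = 0.
Proof.
move=> Uy; rewrite /riemann.
have S a b c d : partial a (fun z => christoffel g z b c d) y =
                 partial a (fun z => christoffel g z b d c) y.
  by apply: (eq_partial openU) => // z Uz; exact: christoffel_sym.
have C a b c := christoffel_sym a b c Uy.
rewrite (S i k m j) (S j k m i) (S m k j i) !sumrB.
have E1 : \sum_l christoffel g y k i l * christoffel g y l j m =
          \sum_l christoffel g y k i l * christoffel g y l m j.
  by apply: eq_bigr => l _; rewrite (C l j m).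
have E2 : \sum_l christoffel g y k j l * christoffel g y l i m =
          \sum_l christoffel g y k j l * christoffel g y l m i.
  by apply: eq_bigr => l _; rewrite (C l i m).
have E3 : \sum_l christoffel g y k m l * christoffel g y l i j =
          \sum_l christoffel g y k m l * christoffel g y l j i.
  by apply: eq_bigr => l _; rewrite (C l i j).
have cyc (a b c p q r : R) : a - b + (p - q) + (b - c + (q - r)) + (c - a + (r - p)) = 0.
  by ring.
by rewrite E1 E2 E3; exact: cyc.
Qed.

Variable x : 'rV[R]_n.
Hypothesis Ux : U x.
Variable E0 : 'M[R]_n.
Hypothesis orthonormal_E0 : E0 *m g x *m E0^T = 1%:M.

Local Notation J := (jet R 'I_n).
Local Notation hj := (hjet x (christoffel g) E0).
Local Notation fr := (frame x (christoffel g) E0).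

Local Notation slot := (slot fr).

(** The frame components, as jets, of tensor fields of rank 1 to 4. *)
Definition hat1 (X : 'rV[R]_n -> 'I_n -> R) a := slot (fun i => hj (fun y => X y i)) a.
Definition hat2 (A : 'rV[R]_n -> 'I_n -> 'I_n -> R) a b :=
  slot (fun i => hat1 (fun y => A y i) b) a.
Definition hat3 (C : 'rV[R]_n -> 'I_n -> 'I_n -> 'I_n -> R) a b c :=
  slot (fun i => hat2 (fun y => C y i) b c) a.
Definition hat4 (C : 'rV[R]_n -> 'I_n -> 'I_n -> 'I_n -> 'I_n -> R) a b c d :=
  slot (fun i => hat3 (fun y => C y i) b c d) a.

(** A derivative of frame components is a derivative of coordinate components,
    corrected by the derivative of the frame, which contributes the Christoffel
    term of the covariant derivative. *)
Lemma jshift_slot c (F : 'I_n -> J) (F' : 'I_n -> 'I_n -> J) a :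
  (forall i, jshift c (F i) = slot (F'^~ i) c) ->
  jshift c (slot F a) =
  slot (fun p => slot (fun i => F' p i - \sum_m hj (fun y => christoffel g y m p i) * F m) a) c.
Proof.
move=> DF; rewrite [LHS]jshift_sum.
under eq_bigr => i _ do rewrite jshiftM jshift_frame DF mulNr.
rewrite big_split /= sumrN addrC.
rewrite (eq_slot _ _ (fun p => slotB _ (F' p) (fun i => \sum_m hj (fun y => christoffel g y m p i) * F m) a)).
rewrite slotB; congr (_ - _); first exact: slotC.
rewrite /slot; under eq_bigr => i _ do
  (rewrite mulr_suml; under eq_bigr => p _ do rewrite mulr_suml).
rewrite exchange_big /=; apply: eq_bigr => p _.
rewrite exchange_big mulr_sumr /=; apply: eq_bigr => l _.
rewrite !mulr_sumr; apply: eq_bigr => m _; ring.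
Qed.

(** In the frame bundle, covariant derivatives are plain derivatives. *)
Lemma jshift_hat1 c X a : (forall i, smooth_on U (fun y => X y i)) ->
  jshift c (hat1 X a) = hat2 (nabla1 g X) c a.
Proof.
move=> sX; rewrite /hat1 (@jshift_slot c _ (fun p i => hj (partial p (fun y => X y i)))).
  apply: eq_slot => p; apply: eq_slot => i; rewrite /nabla1.
  rewrite (hjetB openU Ux); [|by smooth|by smooth; exact: smooth_christoffel].
  congr (_ - _); rewrite (hjet_sum openU Ux); last by move=> m; smooth; exact: smooth_christoffel.
  by apply: eq_bigr => m _; rewrite (hjetM openU Ux)//; exact: smooth_christoffel.
by move=> i; exact: jshift_hjet.
Qed.

Lemma eq_hat1 X Y a : (forall y i, U y -> X y i = Y y i) -> hat1 X a = hat1 Y a.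
Proof. by move=> XY; apply: eq_slot => i; apply: (eq_hjet openU Ux) => y /XY. Qed.

Lemma eq_hat2 A B a b : (forall y i j, U y -> A y i j = B y i j) -> hat2 A a b = hat2 B a b.
Proof. by move=> XY; apply: eq_slot => i; apply: eq_hat1 => y j /XY. Qed.

Lemma eq_hat3 A B a b c :
  (forall y i j k, U y -> A y i j k = B y i j k) -> hat3 A a b c = hat3 B a b c.
Proof. by move=> XY; apply: eq_slot => i; apply: eq_hat2 => y j k /XY. Qed.

Lemma hat1_lin X (f : 'I_n -> 'rV[R]_n -> R) Y a :
  (forall i, smooth_on U (fun y => X y i)) -> (forall m, smooth_on U (f m)) ->
  (forall m i, smooth_on U (fun y => Y y m i)) ->
  hat1 (fun y i => X y i - \sum_m f m y * Y y m i) a =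
  hat1 X a - \sum_m hj (f m) * hat1 (fun y => Y y m) a.
Proof.
move=> sX sf sY; rewrite -(eq_bigr _ (fun m _ => slotZ _ _ _ _)) -slot_sum -slotB.
apply: eq_slot => i; rewrite (hjetB openU Ux); [|by smooth|by smooth].
congr (_ - _); rewrite (hjet_sum openU Ux); last by move=> m; smooth.
by apply: eq_bigr => m _; rewrite (hjetM openU Ux).
Qed.

Lemma hat2_lin A (f : 'I_n -> 'rV[R]_n -> R) B a b :
  (forall i j, smooth_on U (fun y => A y i j)) -> (forall m, smooth_on U (f m)) ->
  (forall m i j, smooth_on U (fun y => B y m i j)) ->
  hat2 (fun y i j => A y i j - \sum_m f m y * B y m i j) a b =
  hat2 A a b - \sum_m hj (f m) * hat2 (fun y => B y m) a b.
Proof.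
move=> sX sf sY; rewrite -(eq_bigr _ (fun m _ => slotZ _ _ _ _)) -slot_sum -slotB.
by apply: eq_slot => i; rewrite (hat1_lin _ (Y := fun y m => B y m i)).
Qed.

Lemma jshift_hat2 c A a b : (forall i j, smooth_on U (fun y => A y i j)) ->
  jshift c (hat2 A a b) = hat3 (nabla2 g A) c a b.
Proof.
move=> sA; rewrite /hat2.
rewrite (@jshift_slot c _ (fun p i => hat1 (fun y => nabla1 g (fun y => A y i) y p) b)).
  apply: eq_slot => p; apply: eq_slot => i; rewrite -hat1_lin => [|j|m|m j].
  - by apply: eq_hat1 => y j Uy; rewrite /nabla2 addrAC.
  - exact: smooth_nabla1.
  - exact: smooth_christoffel.
  - exact: sA.
by move=> i; rewrite jshift_hat1.
Qed.

Lemma jshift_hat3 d C a b c : (forall i j k, smooth_on U (fun y => C y i j k)) ->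
  jshift d (hat3 C a b c) = hat4 (nabla3 g C) d a b c.
Proof.
move=> sC; rewrite /hat3.
rewrite (@jshift_slot d _ (fun p i => hat2 (fun y => nabla2 g (fun y => C y i) y p) b c)).
  apply: eq_slot => p; apply: eq_slot => i; rewrite -hat2_lin => [|j k|m|m j k].
  - by apply: eq_hat2 => y j k Uy; rewrite /nabla3 /nabla2; ring.
  - exact: smooth_nabla2.
  - exact: smooth_christoffel.
  - exact: sC.
by move=> i; rewrite jshift_hat2.
Qed.

Lemma jeval_slot F a : jeval (slot F a) = \sum_i E0 a i * jeval (F i).
Proof. by rewrite /slot rmorph_sum; apply: eq_bigr => i _; rewrite rmorphM. Qed.

(** Orthonormality at the base point suffices, as the metric is parallel. *)
Lemma hat2_g a b : hat2 (fun y i j => g y i j) a b = (a == b)%:R.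
Proof.
have -> : (a == b)%:R = jcst (a == b)%:R :> J by case: (a == b).
rewrite [LHS]jet_constP; last first.
  move=> c; rewrite jshift_hat2//.
  rewrite (eq_hat3 _ _ _ (B := fun _ _ _ _ => 0)); last by move=> y p i j Uy; exact: nabla_g.
  rewrite /hat3 /slot big1 // => i _; rewrite /hat2 /slot big1 ?mulr0 // => j _.
  by rewrite /hat1 /slot big1 ?mulr0 // => k _; rewrite (hjet0 openU Ux) mulr0.
congr jcst; have /matrixP/(_ a b) := orthonormal_E0; rewrite !mxE => <-.
rewrite -[LHS]/(jeval _) jeval_slot.
under eq_bigr => i _ do rewrite jeval_slot mulr_sumr.
rewrite exchange_big; apply: eq_bigr => j _; rewrite !mxE mulr_suml.
by apply: eq_bigr => i _; rewrite -[jeval _]/(g x i j) mulrA mulrAC.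
Qed.

(** The inverse of the matrix of the frame. *)
Definition lower_frame k a : J := slot (fun m => hj (fun y => g y k m)) a.

Lemma lower_frameK k l : \sum_a lower_frame k a * fr a l = (k == l)%:R.
Proof.
pose F : 'M[J]_n := \matrix_(a, i) fr a i.
pose L : 'M[J]_n := \matrix_(k, a) lower_frame k a.
have : F *m L = 1%:M.
  by apply/matrixP => a b; rewrite !mxE -hat2_g; apply: eq_bigr => i _; rewrite !mxE.
move=> /mulmx1C /matrixP /(_ k l); rewrite !mxE => <-.
by apply: eq_bigr => a _; rewrite !mxE.
Qed.

Lemma sum_delta_l (F : 'I_n -> J) i : \sum_k (i == k)%:R * F k = F i.
Proof.
rewrite (bigD1 i) //= eqxx mul1r big1 ?addr0 // => k ki.
by rewrite eq_sym (negbTE ki) mul0r.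
Qed.

Lemma ginv_frame i j : hj (fun y => invmx (g y) i j) = \sum_a fr a i * fr a j.
Proof.
pose Gi k := hj (fun y => invmx (g y) i k).
have K l : \sum_k Gi k * hj (fun y => g y k l) = (i == l)%:R.
  transitivity (hj (fun y => \sum_k invmx (g y) i k * g y k l)).
    rewrite (hjet_sum openU Ux); last by move=> k; smooth; exact: smooth_ginv.
    by apply: eq_bigr => k _; rewrite (hjetM openU Ux)//; exact: smooth_ginv.
  have -> : (i == l)%:R = hj (fun=> (i == l)%:R) by rewrite (hjet_cst openU Ux); case: (i == l).
  apply: (eq_hjet openU Ux) => y Uy; have /matrixP/(_ i l) := mulVmx (unit_g Uy).
  by rewrite !mxE.
transitivity (\sum_k Gi k * \sum_a lower_frame k a * fr a j).
  by rewrite (bigD1 j) //= lower_frameK eqxx mulr1 big1 ?addr0 // => k kj; rewrite lower_frameK (negbTE kj) mulr0.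
under eq_bigr => k _ do rewrite mulr_sumr.
rewrite exchange_big; apply: eq_bigr => a _ /=.
under eq_bigr => k _ do rewrite mulrA.
rewrite -mulr_suml; congr (_ * _).
transitivity (\sum_m fr a m * \sum_k Gi k * hj (fun y => g y k m)).
  under [RHS]eq_bigr => m _ do rewrite mulr_sumr.
  rewrite [RHS]exchange_big; apply: eq_bigr => k _ /=.
  by rewrite /lower_frame /slot mulr_sumr; apply: eq_bigr => m _; rewrite mulrCA.
by under eq_bigr => m _ do rewrite K mulrC; rewrite sum_delta_l.
Qed.

Lemma hjet_contract (F : 'rV[R]_n -> 'I_n -> 'I_n -> R) :
  (forall i j, smooth_on U (fun y => F y i j)) ->
  hj (fun y => contract g y (F y)) = \sum_a hat2 F a a.
Proof.
move=> sF; rewrite /contract (hjet_sum openU Ux); last first.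
  by move=> i; smooth; exact: smooth_ginv.
transitivity (\sum_i \sum_j \sum_a fr a i * (fr a j * hj (fun y => F y i j))).
  apply: eq_bigr => i _; rewrite (hjet_sum openU Ux); last by move=> j; smooth; exact: smooth_ginv.
  apply: eq_bigr => j _; rewrite (hjetM openU Ux) //; last exact: smooth_ginv.
  by rewrite ginv_frame mulr_suml; apply: eq_bigr => a _; rewrite mulrA.
under eq_bigr => i _ do rewrite exchange_big.
rewrite exchange_big; apply: eq_bigr => a _ /=; apply: eq_bigr => i _.
by rewrite /hat1 /slot mulr_sumr.
Qed.

Definition jcomm a b (f : J) : J := jshift a (jshift b f) - jshift b (jshift a f).

Lemma jcommM a b f h : jcomm a b (f * h) = jcomm a b f * h + f * jcomm a b h.
Proof. by rewrite /jcomm !(jshiftM, jshiftD); ring. Qed.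

Lemma jcomm_sum a b (K : Type) (r : seq K) (P : pred K) (F : K -> J) :
  jcomm a b (\sum_(i <- r | P i) F i) = \sum_(i <- r | P i) jcomm a b (F i).
Proof. by rewrite /jcomm !jshift_sum -sumrB. Qed.

(** Horizontal derivatives of functions of the base point commute since the
    connection is free of torsion. *)
Lemma jcomm_hjet a b A : smooth_on U A -> jcomm a b (hj A) = 0.
Proof.
move=> sA.
have E c d : jshift c (jshift d (hj A)) =
   \sum_q \sum_p fr c p * fr d q * hj (partial p (partial q A))
   - \sum_q \sum_p \sum_i hj (fun y => christoffel g y q p i) * fr c p * fr d i * hj (partial q A).
  rewrite jshift_hjet jshift_sum -sumrB; apply: eq_bigr => q _.
  rewrite jshiftM jshift_hjet jshift_frame mulNr addrC mulr_sumr mulr_suml; congr (_ - _).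
    by apply: eq_bigr => p _; rewrite mulrA [fr d q * _]mulrC.
  by apply: eq_bigr => p _; rewrite mulr_suml.
rewrite /jcomm !E; apply/eqP; rewrite subr_eq0; apply/eqP; congr (_ - _).
  rewrite exchange_big; apply: eq_bigr => p _; apply: eq_bigr => q _ /=.
  rewrite [fr a p * _]mulrC.
  apply: (congr1 (GRing.mul (fr b q * fr a p))).
  by apply: (eq_hjet openU Ux) => y Uy; exact: (@partialC _ _ _ openU p q _ _ sA Uy).
apply: eq_bigr => q _; rewrite exchange_big; apply: eq_bigr => p _; apply: eq_bigr => i _ /=.
rewrite (mulrAC _ (fr a i) (fr b p)).
apply: (congr1 (fun z => z * fr b p * fr a i * hj (partial q A))).
by apply: (eq_hjet openU Ux) => y Uy; exact: christoffel_sym.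
Qed.

Lemma hat3B A B a b c : (forall i j k, smooth_on U (fun y => A y i j k)) ->
  (forall i j k, smooth_on U (fun y => B y i j k)) ->
  hat3 (fun y i j k => A y i j k - B y i j k) a b c = hat3 A a b c - hat3 B a b c.
Proof.
move=> sA sB; rewrite -slotB; apply: eq_slot => i.
rewrite -slotB; apply: eq_slot => j; rewrite -slotB; apply: eq_slot => k.
by rewrite (hjetB openU Ux).
Qed.

Lemma hat3_swap A a b c : hat3 A a b c = hat3 (fun y i j => A y j i) b a c.
Proof. exact: slotC. Qed.

Definition curv_frame a b c k : J := hat3 (fun y i j m => riemann g y i j m k) a b c.

(** On the frame the commutator is the curvature, by its very definition. *)
Lemma jcomm_frame a b c k : jcomm a b (fr c k) = - curv_frame a b c k.
Proof.
pose A y q m := christoffel g y k q m.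
have D e : jshift e (fr c k) = - hat2 A e c.
  rewrite jshift_frame; congr (- _); apply: eq_bigr => q _.
  by rewrite /hat1 /slot mulr_sumr; apply: eq_bigr => m _; rewrite [hj _ * _]mulrC -mulrA [hj _ * _]mulrC.
have sA q m : smooth_on U (fun y => A y q m) by exact: smooth_christoffel.
have sN i j m : smooth_on U (fun y => nabla2 g A y i j m) by exact: smooth_nabla2.
rewrite /jcomm !D !jshiftN !jshift_hat2 // (hat3_swap _ b a) opprK addrC -opprB.
congr (- _); rewrite -hat3B //; apply: eq_hat3 => y i j m Uy.
rewrite /nabla2 /A /riemann sumrB.
under [X in _ - (_ - X - _)]eq_bigr => l _ do rewrite (christoffel_sym l j i Uy).
under [X in _ = _ + (X - _)]eq_bigr => l _ do rewrite mulrC.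
under [X in _ = _ + (_ - X)]eq_bigr => l _ do rewrite mulrC.
have alg (p q r s t : R) : p - r - s - (q - r - t) = p - q + (t - s) by ring.
exact: alg.
Qed.

(** The Riemann tensor in the frame, with all indices lowered. *)
Definition Rh a b c d : J := \sum_k curv_frame a b c k * lower_frame k d.

Lemma curv_slot a b c F : \sum_k curv_frame a b c k * F k = \sum_d Rh a b c d * slot F d.
Proof.
rewrite /Rh; under [RHS]eq_bigr => d _ do rewrite mulr_suml.
rewrite exchange_big; apply: eq_bigr => k _ /=.
under eq_bigr => d _ do rewrite -mulrA.
rewrite -mulr_sumr; congr (_ * _).
under eq_bigr => d _ do rewrite /slot mulr_sumr.
rewrite exchange_big /=; under eq_bigr => l _.
  under eq_bigr => d _ do rewrite mulrA.
  rewrite -mulr_suml lower_frameK; over.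
by rewrite sum_delta_l.
Qed.

(** The Ricci identity, one index at a time. *)
Lemma jcomm_slot a b F c :
  jcomm a b (slot F c) = slot (fun i => jcomm a b (F i)) c - \sum_d Rh a b c d * slot F d.
Proof.
rewrite jcomm_sum -curv_slot -sumrB; apply: eq_bigr => i _.
by rewrite jcommM jcomm_frame mulNr addrC.
Qed.

Lemma jcomm_hat1 a b X c : (forall i, smooth_on U (fun y => X y i)) ->
  jcomm a b (hat1 X c) = - \sum_d Rh a b c d * hat1 X d.
Proof.
move=> sX; rewrite /hat1 jcomm_slot; rewrite [X in X - _]big1 ?sub0r // => i _.
by rewrite jcomm_hjet // mulr0.
Qed.

Lemma jcomm_hat2 a b A c d : (forall i j, smooth_on U (fun y => A y i j)) ->
  jcomm a b (hat2 A c d) =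
  - \sum_m Rh a b c m * hat2 A m d - \sum_m Rh a b d m * hat2 A c m.
Proof.
move=> sA; rewrite /hat2 jcomm_slot addrC; congr (_ + _).
under eq_slot => i do rewrite jcomm_hat1 //.
rewrite slotN slot_sum; congr (- _); apply: eq_bigr => m _; exact: slotZ.
Qed.

Lemma jcomm_hat3 a b A c d e : (forall i j k, smooth_on U (fun y => A y i j k)) ->
  jcomm a b (hat3 A c d e) =
  - \sum_m Rh a b c m * hat3 A m d e - \sum_m Rh a b d m * hat3 A c m e
  - \sum_m Rh a b e m * hat3 A c d m.
Proof.
move=> sA; rewrite /hat3 jcomm_slot addrC -addrA; congr (_ + _).
under eq_slot => i do rewrite jcomm_hat2 //.
rewrite slotB slotN !slot_sum; congr (- _ - _); apply: eq_bigr => m _; exact: slotZ.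
Qed.

Lemma Rh_skew12 a b c d : Rh a b c d = - Rh b a c d.
Proof.
rewrite /Rh -sumrN; apply: eq_bigr => k _; rewrite -mulNr; congr (_ * _).
have E p q : curv_frame p q c k = - jcomm p q (fr c k) by rewrite jcomm_frame opprK.
by rewrite !E opprK /jcomm opprB.
Qed.

(** The commutator annihilates the components of the metric, which are
    constant. *)
Lemma Rh_skew34 a b c d : Rh a b c d = - Rh a b d c.
Proof.
have J0 (P : bool) : jcomm a b P%:R = 0.
  have -> : P%:R = jcst P%:R :> J by case: P.
  by rewrite /jcomm !jshift_cst subrr.
have := jcomm_hat2 a b c d smooth_g.
under eq_bigr => m _ do rewrite hat2_g mulrC eq_sym.
under [X in _ - X]eq_bigr => m _ do rewrite hat2_g mulrC.
by rewrite hat2_g J0 !sum_delta_l => /esym/eqP; rewrite subr_eq0 => /eqP <-; rewrite opprK.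
Qed.

Lemma hat3D A B a b c : (forall i j k, smooth_on U (fun y => A y i j k)) ->
  (forall i j k, smooth_on U (fun y => B y i j k)) ->
  hat3 (fun y i j k => A y i j k + B y i j k) a b c = hat3 A a b c + hat3 B a b c.
Proof.
move=> sA sB; rewrite -slotD; apply: eq_slot => i.
rewrite -slotD; apply: eq_slot => j; rewrite -slotD; apply: eq_slot => k.
by rewrite (hjetD openU Ux).
Qed.

Lemma hat3_cycle A a b c : hat3 A b c a = hat3 (fun y i j k => A y j k i) a b c.
Proof. by rewrite [RHS]hat3_swap; apply: eq_slot => i; exact: slotC. Qed.

Lemma hat3_0 A a b c : (forall y i j k, U y -> A y i j k = 0) -> hat3 A a b c = 0.
Proof.
move=> A0; rewrite (eq_hat3 _ _ _ (B := fun _ _ _ _ => 0)) //.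
rewrite /hat3 /slot big1 // => i _; rewrite /hat2 /slot big1 ?mulr0 // => j _.
by rewrite /hat1 /slot big1 ?mulr0 // => k _; rewrite (hjet0 openU Ux) mulr0.
Qed.

Lemma Rh_Bianchi a b c d : Rh a b c d + Rh b c a d + Rh c a b d = 0.
Proof.
rewrite /Rh -!big_split big1 // => k _ /=; rewrite -!mulrDl.
rewrite /curv_frame (hat3_cycle _ a b c) -(hat3_cycle _ c a b).
rewrite -!hat3D => [|i j m|i j m|i j m|i j m];
  try by smooth; exact: smooth_riemann.
rewrite hat3_0 ?mul0r // => y i j m Uy; exact: riemann_Bianchi.
Qed.

Lemma hat2_Ricci b c : hat2 (Ricci g) b c = \sum_a Rh a b c a.
Proof.
transitivity (\sum_i hat2 (fun y j k => riemann g y i j k i) b c).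
  rewrite -slot_sum; apply: eq_slot => j; rewrite -slot_sum; apply: eq_slot => k.
  rewrite /Ricci (hjet_sum openU Ux) // => i; exact: smooth_riemann.
rewrite /Rh [RHS]exchange_big; apply: eq_bigr => k _ /=.
transitivity (\sum_i (\sum_a lower_frame k a * fr a i) * hat2 (fun y j m => riemann g y i j m k) b c).
  under [RHS]eq_bigr => i _ do rewrite lower_frameK.
  by rewrite (sum_delta_l (fun i => hat2 (fun y j m => riemann g y i j m k) b c)).
under eq_bigr => i _ do rewrite mulr_suml.
rewrite exchange_big; apply: eq_bigr => a _ /=.
rewrite /curv_frame /hat3 /slot mulr_suml; apply: eq_bigr => i _.
by rewrite -mulrA mulrC.
Qed.

End LeviCivita.

(** * Frame components of the operations on tensors *)

Section Dictionary.
Variables (R : realType) (n : nat) (U : set 'rV[R]_n).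
Hypothesis openU : open U.
Variable g : 'rV[R]_n -> 'M[R]_n.
Hypothesis smooth_g : forall i j, smooth_on U (fun y => g y i j).
Hypothesis sym_g : forall y i j, U y -> g y i j = g y j i.
Hypothesis unit_g : forall y, U y -> g y \in unitmx.
Variable x : 'rV[R]_n.
Hypothesis Ux : U x.
Variable E0 : 'M[R]_n.
Hypothesis orthonormal_E0 : E0 *m g x *m E0^T = 1%:M.
Local Notation E := 'rV[R]_n.
Local Notation I := 'I_n.

Local Notation J := (jet R 'I_n).
Local Notation hj := (hjet x (christoffel g) E0).
Local Notation fr := (frame x (christoffel g) E0).
Local Notation slot := (slot fr).
Local Notation hat1 := (hat1 g x E0).
Local Notation hat2 := (hat2 g x E0).
Local Notation hat3 := (hat3 g x E0).
Local Notation hat4 := (hat4 g x E0).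

Definition smooth1 (X : E -> I -> R) := forall i, smooth_on U (fun y => X y i).
Definition smooth2 (X : E -> I -> I -> R) := forall i j, smooth_on U (fun y => X y i j).
Definition smooth3 (X : E -> I -> I -> I -> R) :=
  forall i j k, smooth_on U (fun y => X y i j k).
Definition smooth4 (X : E -> I -> I -> I -> I -> R) :=
  forall i j k l, smooth_on U (fun y => X y i j k l).

Let hjC := hjet_contract openU smooth_g sym_g unit_g Ux orthonormal_E0.
Let hjM := @hjetM R n U openU x Ux (christoffel g) E0.

Lemma hat1M f X a : smooth_on U f -> smooth1 X ->
  hat1 (fun y i => f y * X y i) a = hj f * hat1 X a.
Proof. by move=> sf sX; rewrite -slotZ; apply: eq_slot => i; exact: hjM. Qed.

Lemma hat2_M X Y a b : smooth1 X -> smooth1 Y ->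
  hat2 (fun y i j => X y i * Y y j) a b = hat1 X a * hat1 Y b.
Proof. by move=> sX sY; rewrite -[RHS]slotZr; apply: eq_slot => i; exact: hat1M. Qed.

Lemma hj_contractM X Y : smooth1 X -> smooth1 Y ->
  hj (fun y => contract g y (fun i j => X y i * Y y j)) = \sum_p hat1 X p * hat1 Y p.
Proof.
move=> sX sY; rewrite hjC => [|i j]; last exact: smoothM.
by apply: eq_bigr => p _; exact: hat2_M.
Qed.

(** From here on, contractions with the inverse metric become sums over frame
    indices.  Each lemma treats one shape of contraction. *)
Lemma hj_contract2M A B : smooth2 A -> smooth2 B ->
  hj (fun y => contract g y (fun i i' => contract g y (fun j j' => A y i j * B y i' j'))) =
  \sum_p \sum_q hat2 A p q * hat2 B p q.
Proof.
move=> sA sB; rewrite hjC => [|i i']; last first.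
  by apply: (smooth_contract openU smooth_g unit_g) => j j'; exact: smoothM.
apply: eq_bigr => p _; rewrite /hat2 -/slot.
transitivity (slot (fun i => slot (fun i' => \sum_q hat1 (fun y => A y i) q *
  hat1 (fun y => B y i') q) p) p).
  by apply: eq_slot => i; apply: eq_slot => i'; exact: hj_contractM.
under eq_slot => i do rewrite slot_sum; rewrite slot_sum; apply: eq_bigr => q _.
by rewrite -slotZr; apply: eq_slot => i; rewrite -slotZ.
Qed.

Lemma slot_sumZ (u : I -> J) (w : I -> I -> J) a :
  slot (fun k => \sum_p u p * w p k) a = \sum_p u p * slot (w p) a.
Proof. by rewrite slot_sum; apply: eq_bigr => p _; rewrite slotZ. Qed.

Lemma hat1_apply A X a : smooth2 A -> smooth1 X ->
  hat1 (apply g A X) a = \sum_p hat2 A a p * hat1 X p.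
Proof.
move=> sA sX; rewrite -[RHS]/(\sum_p slot (fun k => hat1 (fun y => A y k) p) a * hat1 X p).
under [RHS]eq_bigr => p _ do rewrite -slotZr.
by rewrite -slot_sum; apply: eq_slot => k; exact: hj_contractM.
Qed.

Lemma hat1_interior2 X A a : smooth1 X -> smooth2 A ->
  hat1 (interior2 g X A) a = \sum_p hat1 X p * hat2 A p a.
Proof.
move=> sX sA; under [RHS]eq_bigr => p _ do rewrite /hat2 [X in _ * X]slotC.
rewrite -slot_sumZ; apply: eq_slot => k.
by rewrite (hj_contractM (X := X) (Y := fun y i => A y i k)).
Qed.

Lemma hat2_compose A B a b : smooth2 A -> smooth2 B ->
  hat2 (compose g A B) a b = \sum_p hat2 A a p * hat2 B p b.
Proof.
move=> sA sB; rewrite -[RHS]/(\sum_p slot (fun k => hat1 (fun y => A y k) p) a * hat2 B p b).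
under [RHS]eq_bigr => p _ do rewrite -slotZr.
rewrite -slot_sum; apply: eq_slot => k.
by rewrite -(hat1_interior2 (X := fun y => A y k)).
Qed.

Lemma hat2_interior3 X (C : E -> I -> I -> I -> R) a b : smooth1 X -> smooth3 C ->
  hat2 (fun y j k => contract g y (fun i i' => X y i * C y i' j k)) a b =
  \sum_p hat1 X p * hat3 C p a b.
Proof.
move=> sX sC; under [RHS]eq_bigr => p _ do rewrite /hat3 [X in _ * X]slotC.
rewrite -slot_sumZ; apply: eq_slot => j.
by rewrite -(hat1_interior2 (A := fun y i k => C y i j k)).
Qed.

Lemma hat3_interior4 X (C : E -> I -> I -> I -> I -> R) a b c : smooth1 X -> smooth4 C ->
  hat3 (fun y j k l => contract g y (fun i i' => X y i * C y i' j k l)) a b c =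
  \sum_p hat1 X p * hat4 C p a b c.
Proof.
move=> sX sC; under [RHS]eq_bigr => p _ do rewrite /hat4 [X in _ * X]slotC.
rewrite -slot_sumZ; apply: eq_slot => j.
by rewrite -(hat2_interior3 (C := fun y i k l => C y i j k l)).
Qed.

(** The shape of the torsion equation. *)
Lemma hat4_contract A (C : E -> I -> I -> I -> I -> R) a b c d : smooth2 A -> smooth4 C ->
  hat4 (fun y p i j k => contract g y (fun l l' => A y p l * C y l' i j k)) a b c d =
  \sum_p hat2 A a p * hat4 C p b c d.
Proof.
move=> sA sC.
rewrite -[RHS]/(\sum_p slot (fun k => hat1 (fun y => A y k) p) a * hat4 C p b c d).
under [RHS]eq_bigr => p _ do rewrite -slotZr.
rewrite -slot_sum; apply: eq_slot => k.
by rewrite -(hat3_interior4 (X := fun y => A y k)).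
Qed.

Lemma hat1_contract2 A (C : E -> I -> I -> I -> R) a : smooth2 A -> smooth3 C ->
  hat1 (fun y k => contract g y (fun i i' => contract g y (fun j j' =>
    A y i j * C y i' j' k))) a = \sum_p \sum_q hat2 A p q * hat3 C p q a.
Proof.
move=> sA sC.
transitivity (\sum_p \sum_q hat2 A p q * slot (fun k => hat2 (fun y i j => C y i j k) p q) a).
  under [RHS]eq_bigr => p _ do rewrite -slot_sumZ.
  by rewrite -slot_sum; apply: eq_slot => k; rewrite hj_contract2M.
apply: eq_bigr => p _; apply: eq_bigr => q _; rewrite /hat2 slotC; congr (_ * _).
by apply: eq_slot => i; rewrite slotC.
Qed.

Lemma hat2_contract2 A (C : E -> I -> I -> I -> I -> R) a b : smooth2 A -> smooth4 C ->
  hat2 (fun y k l => contract g y (fun i i' => contract g y (fun j j' =>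
    A y i j * C y i' j' k l))) a b = \sum_p \sum_q hat2 A p q * hat4 C p q a b.
Proof.
move=> sA sC.
transitivity (\sum_p \sum_q hat2 A p q * slot (fun k => hat3 (fun y i j => C y i j k) p q b) a).
  under [RHS]eq_bigr => p _ do rewrite -slot_sumZ.
  rewrite -slot_sum; apply: eq_slot => k.
  by rewrite -(hat1_contract2 (C := fun y i j l => C y i j k l)).
apply: eq_bigr => p _; apply: eq_bigr => q _; rewrite /hat3 slotC; congr (_ * _).
by apply: eq_slot => i; rewrite slotC.
Qed.

(** The shape of the derivative term in the formula for the Ricci tensor. *)
Lemma hat2_contract3 (N C : E -> I -> I -> I -> R) a b : smooth3 N -> smooth3 C ->
  hat2 (fun y k l => contract g y (fun i i' => contract g y (fun j j' =>
    N y i k j * C y i' j' l))) a b = \sum_p \sum_q hat3 N p a q * hat3 C p q b.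
Proof.
move=> sN sC.
transitivity (\sum_p \sum_q slot (fun k => hat2 (fun y i j => N y i k j) p q) a * hat3 C p q b).
  under [RHS]eq_bigr => p _ do under eq_bigr => q _ do rewrite -slotZr.
  under [RHS]eq_bigr => p _ do rewrite -slot_sum.
  rewrite -slot_sum; apply: eq_slot => k.
  by rewrite -(hat1_contract2 (A := fun y i j => N y i k j)).
apply: eq_bigr => p _; apply: eq_bigr => q _; rewrite /hat2 slotC; congr (_ * _).
Qed.

Lemma hat1_div A a : smooth2 A -> hat1 (div g A) a = \sum_p jshift p (hat2 A p a).
Proof.
move=> sA; have sN := smooth_nabla2 openU smooth_g unit_g _ _ _ sA.
transitivity (slot (fun k => \sum_p hat2 (fun y i j => nabla2 g A y i j k) p p) a).
  by apply: eq_slot => k; exact: hjC.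
rewrite slot_sum; apply: eq_bigr => p _.
rewrite (jshift_hat2 openU smooth_g unit_g Ux) // /hat2 slotC; apply: eq_slot => i.
by rewrite slotC.
Qed.

Lemma hat1D X Y a : smooth1 X -> smooth1 Y ->
  hat1 (fun y i => X y i + Y y i) a = hat1 X a + hat1 Y a.
Proof. by move=> sX sY; rewrite -[RHS]slotD; apply: eq_slot => i; rewrite (hjetD openU Ux). Qed.

Lemma hat1N X a : smooth1 X -> hat1 (fun y i => - X y i) a = - hat1 X a.
Proof. by move=> sX; rewrite -[RHS]slotN; apply: eq_slot => i; rewrite (hjetN openU Ux). Qed.

Lemma hat1Z z X a : smooth1 X -> hat1 (fun y i => z * X y i) a = jcst z * hat1 X a.
Proof. by move=> sX; rewrite -[RHS]slotZ; apply: eq_slot => i; rewrite (hjetZ openU Ux). Qed.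

Lemma hat2D A B a b : smooth2 A -> smooth2 B ->
  hat2 (fun y i j => A y i j + B y i j) a b = hat2 A a b + hat2 B a b.
Proof. by move=> sA sB; rewrite -[RHS]slotD; apply: eq_slot => i; rewrite hat1D. Qed.

Lemma hat2N A a b : smooth2 A -> hat2 (fun y i j => - A y i j) a b = - hat2 A a b.
Proof. by move=> sA; rewrite -[RHS]slotN; apply: eq_slot => i; rewrite hat1N. Qed.

Lemma hat2Z z A a b : smooth2 A -> hat2 (fun y i j => z * A y i j) a b = jcst z * hat2 A a b.
Proof. by move=> sA; rewrite -[RHS]slotZ; apply: eq_slot => i; rewrite hat1Z. Qed.

Lemma hat2Mf f A a b : smooth_on U f -> smooth2 A ->
  hat2 (fun y i j => f y * A y i j) a b = hj f * hat2 A a b.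
Proof. by move=> sf sA; rewrite -[RHS]slotZ; apply: eq_slot => i; rewrite hat1M. Qed.

Lemma hat2_tr A a b : hat2 (fun y i j => A y j i) a b = hat2 A b a.
Proof. exact: slotC. Qed.

Lemma hat1_grad f a : hat1 (grad f) a = jshift a (hj f).
Proof. by rewrite jshift_hjet. Qed.

Lemma frame_unit : E0 \in unitmx.
Proof.
have /mulmx1_unit[+ _] : E0 *m (g x *m E0^T) = 1%:M by rewrite mulmxA.
by [].
Qed.

Lemma jeval_hat1 X a : jeval (hat1 X a) = (E0 *m \col_i X x i) a ord0.
Proof. by rewrite jeval_slot mxE; apply: eq_bigr => i _; rewrite mxE. Qed.

(** Equality of tensors at a point can be tested in a frame. *)
Lemma hat1_inj X Y : (forall a, jeval (hat1 X a) = jeval (hat1 Y a)) ->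
  forall i, X x i = Y x i.
Proof.
move=> XY i; suff /matrixP/(_ i ord0) : \col_i X x i = \col_i Y x i by rewrite !mxE.
apply: (can_inj (mulKmx frame_unit)); apply/matrixP => a j.
by rewrite [j]ord1 -!jeval_hat1.
Qed.

Lemma hat2_inj A B : (forall a b, jeval (hat2 A a b) = jeval (hat2 B a b)) ->
  forall i j, A x i j = B x i j.
Proof.
move=> AB i j; apply: (@hat1_inj (fun y => A y i) (fun y => B y i)) => b {j}.
pose AE (C : E -> I -> I -> R) : 'cV[R]_n := \col_i jeval (hat1 (fun y => C y i) b).
suff /matrixP/(_ i ord0) : AE A = AE B by rewrite !mxE.
apply: (can_inj (mulKmx frame_unit)); apply/matrixP => a j; rewrite [j]ord1 !mxE.
have E C : \sum_k E0 a k * AE C k ord0 = jeval (hat2 C a b).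
  by rewrite jeval_slot; apply: eq_bigr => k _; rewrite mxE.
by rewrite !E.
Qed.

(** As the metric is parallel, the divergence of [f g] is the gradient of
    [f]. *)
Lemma hat1_div_traceless h a : smooth2 h ->
  hat1 (div g (fun y i j => h y i j - trace g h y / 4 * g y i j)) a =
  hat1 (div g h) a - jcst 4^-1 * hat1 (grad (trace g h)) a.
Proof.
move=> sh.
have st : smooth_on U (trace g h) := smooth_contract openU smooth_g unit_g sh.
have st4 : smooth_on U (fun y => trace g h y / 4) by apply: smoothM => //; exact: smooth_cst.
have stg : smooth2 (fun y i j => trace g h y / 4 * g y i j) by move=> i j; exact: smoothM.
rewrite hat1_div; last by move=> i j; apply: smoothD => //; exact: smoothN.
rewrite hat1_div // hat1_grad.
transitivity (\sum_p (jshift p (hat2 h p a) - jshift p (hj (fun y => trace g h y / 4)) * (p == a)%:R)).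
  apply: eq_bigr => p _; rewrite hat2D // ?hat2N // => [|i j]; last exact: smoothN.
  rewrite hat2Mf // (hat2_g openU smooth_g sym_g unit_g Ux orthonormal_E0) jshiftB jshiftM.
  have -> : jshift p ((p == a)%:R : J) = 0 by rewrite -(rmorph_nat (@jcst R 'I_n)) jshift_cst.
  by rewrite mulr0 addr0.
rewrite sumrB; congr (_ - _); rewrite (bigD1 a) //= eqxx mulr1 big1 ?addr0; last first.
  by move=> p pa; rewrite (negbTE pa) mulr0.
have -> : hj (fun y => trace g h y / 4) = jcst 4^-1 * hj (trace g h).
  by rewrite -(hjetZ openU Ux) //; apply: (eq_hjet openU Ux) => y _; rewrite mulrC.
by rewrite jshiftM jshift_cst mul0r add0r.
Qed.

End Dictionary.

Section LieMetric.
Variables (R : realType) (n : nat) (U : set 'rV[R]_n).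
Hypothesis openU : open U.
Variable g : 'rV[R]_n -> 'M[R]_n.
Hypothesis smooth_g : forall i j, smooth_on U (fun y => g y i j).
Hypothesis sym_g : forall y i j, U y -> g y i j = g y j i.
Hypothesis unit_g : forall y, U y -> g y \in unitmx.

Lemma lower_sharp X y j : U y -> X y j = \sum_k g y k j * sharp g X y k.
Proof.
move=> Uy; rewrite /sharp.
under eq_bigr => k _ do rewrite mulr_sumr.
rewrite exchange_big /= (bigD1 j) //= [X in _ = _ + X]big1 => [|l lj]; last first.
  transitivity ((j == l)%:R * X y l); last by rewrite eq_sym (negbTE lj) mul0r.
  rewrite -(ginvK unit_g _ _ Uy) mulr_suml; apply: eq_bigr => k _.
  by rewrite sym_g // mulrA.
rewrite addr0 -[LHS]mul1r -[1](congr1 (fun b : bool => b%:R) (eqxx j)).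
rewrite -(ginvK unit_g _ _ Uy) mulr_suml; apply: eq_bigr => k _.
by rewrite [in RHS]sym_g // mulrA.
Qed.

Lemma smooth_sharp X k : smooth1 U X -> smooth_on U (fun y => sharp g X y k).
Proof.
move=> sX; rewrite /sharp; apply: smooth_sum => // l.
by apply: smoothM => //; exact: smooth_ginv.
Qed.

(** The usual formula for a connection without torsion that preserves the
    metric, obtained here from the coordinate expression of the Lie
    derivative. *)
Lemma lie_metricE X y i j : smooth1 U X -> U y ->
  lie_metric g X y i j = nabla1 g X y i j + nabla1 g X y j i.
Proof.
move=> sX Uy; have sS k := @smooth_sharp X k sX.
have dX p q : partial p (fun z => X z q) y =
    \sum_k (partial p (fun z => g z k q) y * sharp g X y k
            + g y k q * partial p (fun z => sharp g X z k) y).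
  rewrite (eq_partial openU p (g := fun z => \sum_k g z k q * sharp g X z k)) //; last first.
    by move=> z Uz; exact: lower_sharp.
  rewrite (@partial_sum R n U) // => [|k]; last exact: smoothM.
  by apply: eq_bigr => k _; rewrite (@partialM R n U).
have GX : \sum_m christoffel g y m i j * X y m = \sum_k sharp g X y k * (2^-1 *
    (partial i (fun z => g z j k) y + partial j (fun z => g z i k) y
          - partial k (fun z => g z i j) y)).
  transitivity (\sum_k sharp g X y k * \sum_m christoffel g y m i j * g y m k).
    under eq_bigr => m _ do rewrite (lower_sharp X m Uy) mulr_sumr.
    rewrite exchange_big; apply: eq_bigr => k _ /=; rewrite mulr_sumr.
    by apply: eq_bigr => m _; rewrite [g y k m]sym_g // mulrA mulrC.
  by apply: eq_bigr => k _; rewrite (christoffel_lower sym_g unit_g).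
rewrite /nabla1.
have -> : \sum_m christoffel g y m j i * X y m = \sum_m christoffel g y m i j * X y m.
  by apply: eq_bigr => m _; rewrite (christoffel_sym openU sym_g).
rewrite !dX GX /lie_metric.
have aux (a b c u v w s t : R) :
  s * a + u * v + w * t =
    (b * s + u * v - s * (2^-1 * (b + c - a))) + (c * s + w * t - s * (2^-1 * (b + c - a))).
  by field.
rewrite -!sumrB -big_split; apply: eq_bigr => k _ /=.
rewrite (partial_sym_g openU sym_g i k j Uy) (partial_sym_g openU sym_g j k i Uy).
by rewrite [g y k i]sym_g //; exact: aux.
Qed.
End LieMetric.

(** * G2-structures in a chart *)

Section G2Chart.
Variables (R : realType) (M : manifold R 7) (s : g2_structure M) (c : atlas_index M).
Local Notation U := (coord_dom c).
Local Notation g := (g_ s c).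
Local Notation phi := (phi_ s c).
Local Notation psi := (psi_ s c).
Local Notation I := 'I_7.

Lemma open_chart : open U.
Proof. exact: chart_img_open. Qed.
Let openU := open_chart.

Lemma smooth_metric i j : smooth_on U (fun y => g y i j).
Proof.
apply: (eq_smooth_on openU (f := fun y => comp2 (g2_metric s) c y i j)).
  by move=> y _; rewrite mxE.
exact: comp_smooth.
Qed.

Lemma metric_sym y i j : U y -> g y i j = g y j i.
Proof. by move=> Uy; rewrite !mxE metric_sym. Qed.

Lemma metric_tr y : U y -> (g y)^T = g y.
Proof. by move=> Uy; apply/matrixP => i j; rewrite mxE metric_sym. Qed.

Lemma metric_ip y v : U y -> v != 0 -> 0 < ip (g y) v v.
Proof.
move=> Uy v0.
have : exists i, v ord0 i != 0.
  apply: contrapT => nv; case/eqP: v0; apply/rowP => i; rewrite mxE.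
  by apply: contrapT => vi; apply: nv; exists i; exact/eqP.
move/(metric_pos (g2_metric s) Uy); congr (0 < _).
rewrite exchange_big /ip mxE; apply: eq_bigr => j _ /=.
by rewrite !mxE mulr_suml; apply: eq_bigr => i _; rewrite !mxE; congr (_ * _); rewrite mulrC.
Qed.

Lemma metric_frame y : U y -> exists F : 'M[R]_7, F *m g y *m F^T = 1%:M.
Proof.
move=> Uy; have G_pos v := @metric_ip y v Uy.
have [u [uu _]] := @ortho_unit _ _ _ (metric_tr Uy) G_pos 0%N (fun _ => 0) isT.
by have [F [FGF _]] := orthonormal_frame (metric_tr Uy) G_pos uu; exists F.
Qed.

Lemma metric_unit y : U y -> g y \in unitmx.
Proof.
by move=> /metric_frame[F /mulmx1_unit[+ _]]; rewrite unitmx_mul => /andP[].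
Qed.

Lemma volume_sqr y : U y -> volume_coef (g2_metric s) (g2_orient s) c y ^+ 2 = \det (g y).
Proof.
move=> Uy; rewrite /volume_coef exprMn.
have -> : orient_sign (g2_orient s) c y ^+ 2 = 1.
  by have [->|->] := orient_signP (g2_orient s) Uy; rewrite ?sqrrN expr1n.
rewrite mul1r sqr_sqrtr //; have [F FGF] := metric_frame Uy.
have /esym := det_sqr FGF; rewrite -/g => E; rewrite leNgt; apply/negP => d0.
have : (\det F) ^+ 2 * \det (g y) <= 0 by rewrite mulr_ge0_le0 ?sqr_ge0 ?ltW.
by rewrite -E ler10.
Qed.

Lemma phi_alt12 y i j k : U y -> phi y i j k = - phi y j i k.
Proof. exact: form_alt12. Qed.
Lemma phi_alt23 y i j k : U y -> phi y i j k = - phi y i k j.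
Proof. exact: form_alt23. Qed.

(** The relation between form, metric and orientation enters here and nowhere else. *)
Lemma g2_frame y : U y -> exists F : 'M[R]_7, [/\ F *m g y *m F^T = 1%:M,
  forall i j k, slot3 F (phi y) i j k = zR R (phi0 i j k) &
  forall i j k l, slot4 F (psi y) i j k l = zR R (psi0 i j k l)].
Proof.
move=> Uy.
have phi12 i j k := phi_alt12 i j k Uy; have phi23 i j k := phi_alt23 i j k Uy.
have G_pos v := @metric_ip y v Uy.
have phi_g2 (V W : I -> R) :
  wedge223 (fun j k => \sum_i V i * phi y i j k) (fun j k => \sum_i W i * phi y i j k) (phi y) =
  - 6 * (\sum_i \sum_j g y i j * V i * W j) * volume_coef (g2_metric s) (g2_orient s) c y.
  rewrite (g2_induces s V W Uy); congr (_ * _ * _).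
  by apply: eq_bigr => i _; apply: eq_bigr => j _; rewrite !mxE.
have [F [FGF Fphi]] := adapted_frame phi12 phi23 (metric_tr Uy) G_pos (volume_sqr Uy) phi_g2.
exists F; split=> // i j k l.
exact: (adapted_dual phi_g2 (mulVmx (metric_unit Uy)) FGF Fphi).
Qed.

Lemma slot4_inj F (X Y : I -> I -> I -> I -> R) : F \in unitmx ->
    (forall i j k l, slot4 F X i j k l = slot4 F Y i j k l) ->
  forall i j k l, X i j k l = Y i j k l.
Proof.
move=> uF XY.
have inj (u v : I -> R) : (forall a, slot F u a = slot F v a) -> forall i, u i = v i.
  move=> uv i; suff /matrixP/(_ i ord0) : \col_i u i = \col_i v i :> 'cV[R]_7 by rewrite !mxE.
  apply: (can_inj (mulKmx uF)); apply/matrixP => a j; rewrite !mxE.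
  have E (w : I -> R) : \sum_k F a k * (\col_i w i : 'cV[R]_7) k j = slot F w a.
    by apply: eq_bigr => k _; rewrite mxE.
  by rewrite !E.
move=> i j k l; apply: (inj (X i j k) (Y i j k)) => d {l}.
apply: (inj (fun k => slot F (X i j k) d) (fun k => slot F (Y i j k) d)) => e {k}.
apply: (inj (fun j => slot F (fun k => slot F (X i j k) d) e)
            (fun j => slot F (fun k => slot F (Y i j k) d) e)) => f {j}.
apply: (inj (fun i => slot F (fun j => slot F (fun k => slot F (X i j k) d) e) f)
            (fun i => slot F (fun j => slot F (fun k => slot F (Y i j k) d) e) f)) => h {i}.
exact: XY.
Qed.

(** Both sides have the same components in an adapted frame.  The identity makes
    the dual form smooth and allows it to be differentiated; its definition
    contains the orientation and the square root of the determinant. *)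
Lemma psiE y i j k l : U y -> psi y i j k l =
  g y i k * g y j l - g y i l * g y j k
  - contract g y (fun p q => phi y i j p * phi y k l q).
Proof.
move=> Uy; have [F [FGF Fphi Fpsi]] := g2_frame Uy.
pose gg i j k l := g y i k * g y j l - g y i l * g y j k.
pose pp i j k l := contract g y (fun p q => phi y i j p * phi y k l q).
have uF : F \in unitmx.
  by have /mulmx1_unit[] : F *m (g y *m F^T) = 1%:M by rewrite mulmxA.
rewrite -[RHS]/(gg i j k l - pp i j k l).
apply: (slot4_inj uF (Y := fun i j k l => gg i j k l - pp i j k l)) => {}i {}j {}k {}l.
have slot4B (X Y : I -> I -> I -> I -> R) a b d e :
    slot4 F (fun i j k l => X i j k l - Y i j k l) a b d e = slot4 F X a b d e - slot4 F Y a b d e.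
  rewrite /slot4 /slot3 -slotB; apply: eq_slot => ?; rewrite -slotB; apply: eq_slot => ?.
  by rewrite -slotB; apply: eq_slot => ?; rewrite -slotB.
have gd a b : slot_2 F (fun i j => g y i j) a b = (a == b)%:R.
  have := congr1 (fun A : 'M[R]_7 => A a b) FGF; rewrite !mxE => <-.
  rewrite /slot_2 /slot; under eq_bigr => i' _ do rewrite mulr_sumr.
  rewrite exchange_big; apply: eq_bigr => j' _; rewrite !mxE mulr_suml.
  by apply: eq_bigr => i' _; rewrite mulrA mulrAC.
have ggd a b d e : slot4 F (fun i j k l => g y i k * g y j l) a b d e =
    (a == d)%:R * (b == e)%:R.
  rewrite -!gd /slot_2 -slotZr; apply: eq_slot => i'.
  rewrite -slotZ; apply: eq_slot => j'; rewrite -slotZr; apply: eq_slot => k'.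
  by rewrite slotZ.
rewrite Fpsi psi0E slot4B slot4B ggd.
have -> : slot4 F (fun i j k l => g y i l * g y j k) i j k l = (i == l)%:R * (j == k)%:R.
  rewrite -ggd; apply: eq_slot => i'; apply: eq_slot => j'; exact: slotC.
have -> : slot4 F pp i j k l = \sum_p slot3 F (phi y) i j p * slot3 F (phi y) k l p.
  pose A i j p := slot F (phi y i j) p.
  have E i' j' k' l' : pp i' j' k' l' = \sum_p A i' j' p * A k' l' p.
    exact: (ctrM (mulVmx (metric_unit Uy)) FGF).
  transitivity (\sum_p slot_2 F (fun i j => A i j p) i j * slot_2 F (fun k l => A k l p) k l).
    rewrite /slot4 /slot3 /slot_2.
    under [RHS]eq_bigr => p _ do rewrite -slotZr.
    rewrite -slot_sum; apply: eq_slot => i'.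
    under [RHS]eq_bigr => p _ do rewrite -slotZr.
    rewrite -slot_sum; apply: eq_slot => j'.
    under [RHS]eq_bigr => p _ do rewrite -slotZ.
    rewrite -slot_sum; apply: eq_slot => k'.
    under [RHS]eq_bigr => p _ do rewrite -slotZ.
    by rewrite -slot_sum; apply: eq_slot => l'.
  by [].
rewrite /psi0_def -![Z.sub _ _]/(Z.add _ (Z.opp _)) !zRD !zRN !zRM !zR_zif -zR_sum.
congr (_ - _ - _); apply: eq_bigr => p _; by rewrite zRM !Fphi.
Qed.

Lemma smooth_phi i j k : smooth_on U (fun y => phi y i j k).
Proof. exact: comp_smooth. Qed.

Lemma smooth_psi i j k l : smooth_on U (fun y => psi y i j k l).
Proof.
apply: (eq_smooth_on openU (f := fun y => g y i k * g y j l - g y i l * g y j k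
  - contract g y (fun p q => phi y i j p * phi y k l q))).
  by move=> y Uy; rewrite psiE.
have sc : smooth_on U (fun y => contract g y (fun p q => phi y i j p * phi y k l q)).
  apply: (smooth_contract openU smooth_metric metric_unit) => p q.
  by apply: smoothM => //; exact: smooth_phi.
have sm := smooth_metric; smooth.
Qed.
End G2Chart.

(** * The Ricci tensor of a G2-structure *)

Section Torsion.
Variables (R : realType) (M : manifold R 7) (s : g2_structure M) (T : tensor_field M 2).
Hypothesis HT : is_torsion s T.
Variable c : atlas_index M.
Local Notation U := (coord_dom c).
Local Notation g := (g_ s c).
Local Notation phi := (phi_ s c).
Local Notation psi := (psi_ s c).
Local Notation t := (T_ T c).
Local Notation V := (VT_ s T c).
Local Notation I := 'I_7.
Local Notation J := (jet R I).
Let openU : open U := @open_chart R M c.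
Let sg := @smooth_metric R M s c.
Let ug := @metric_unit R M s c.
Let symg := @metric_sym R M s c.
Let sphi : smooth3 U phi := @smooth_phi R M s c.
Let spsi : smooth4 U psi := @smooth_psi R M s c.

Lemma smooth_T : smooth2 U t.
Proof. by move=> i j; exact: comp_smooth. Qed.
Let sT := smooth_T.

Let sC := smooth_contract openU sg ug.

Lemma smooth_V : smooth1 U V.
Proof.
move=> k; apply: sC => i i'; apply: sC => j j'; apply: smoothM => //; exact: sphi.
Qed.
Let sV := smooth_V.

Lemma smooth_trT : smooth_on U (trT_ s T c).
Proof. exact: sC. Qed.

Lemma smooth_compose A B : smooth2 U A -> smooth2 U B -> smooth2 U (compose g A B).
Proof. by move=> sA sB i j; apply: sC => p q; exact: smoothM. Qed.

(** The coordinate form of [pRic]. *)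
Definition torsion_Ricci y (a l : I) : R :=
  - nabla1 g V y a l
  + contract g y (fun b b' => contract g y (fun m m' => nabla2 g t y b a m * phi y b' m' l))
  - compose g t t y a l + trT_ s T c y * t y a l.

Lemma smooth_RicN : smooth2 U (fun y a l =>
  contract g y (fun b b' => contract g y (fun m m' => nabla2 g t y b a m * phi y b' m' l))).
Proof.
move=> a l; apply: sC => b b'; apply: sC => m m'; apply: smoothM => //.
exact: smooth_nabla2.
Qed.

Lemma smooth_Ricci : smooth2 U (Ricci g).
Proof. by move=> j k; apply: smooth_sum => // i; exact: smooth_riemann. Qed.

Lemma smooth_nabla_V : smooth2 U (nabla1 g V).
Proof. by move=> i j; exact: smooth_nabla1. Qed.

Section Point.
Variable x : 'rV[R]_7.
Hypothesis Ux : U x.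
Variable E0 : 'M[R]_7.
Hypothesis FGF : E0 *m g x *m E0^T = 1%:M.
Hypothesis Fphi : forall i j k, slot3 E0 (phi x) i j k = zR R (phi0 i j k).
Local Notation hj := (hjet x (christoffel g) E0).
Local Notation hat1 := (hat1 g x E0).
Local Notation hat2 := (hat2 g x E0).
Local Notation hat3 := (hat3 g x E0).
Local Notation hat4 := (hat4 g x E0).
Local Notation Th := (hat2 t).
Local Notation phih := (hat3 phi).
Local Notation psih := (hat4 psi).
Local Notation Vh := (hat1 V).

Lemma phih_nil i j k : jeval (phih i j k) = zR R (phi0 i j k).
Proof.
rewrite -Fphi jeval_slot; apply: eq_bigr => a _; rewrite jeval_slot; congr (_ * _).
by apply: eq_bigr => b _; rewrite jeval_slot.
Qed.

Lemma phih_D a i j k : jshift a (phih i j k) = \sum_l Th a l * psih l i j k.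
Proof.
rewrite (jshift_hat3 openU sg ug Ux) // -(hat4_contract openU sg symg ug Ux FGF) //.
apply: eq_slot => p; apply: (@eq_hat3 _ _ _ openU g _ Ux E0) => y i' j' k' Uy; exact: HT.
Qed.

Lemma phih_12 i j k : phih i j k = - phih j i k.
Proof.
rewrite [in RHS]hat3_swap /hat3 -slotN; apply: eq_slot => p.
rewrite -(hat2N openU g Ux E0) => [|a b]; last exact: sphi.
by apply: (@eq_hat2 _ _ _ openU g _ Ux E0) => y a b Uy; rewrite phi_alt12.
Qed.

Lemma phih_23 i j k : phih i j k = - phih i k j.
Proof.
rewrite /hat3 -slotN; apply: eq_slot => p.
rewrite -[X in - X]hat2_tr -(hat2N openU g Ux E0) => [|a b]; last exact: sphi.
by apply: (@eq_hat2 _ _ _ openU g _ Ux E0) => y a b Uy; rewrite phi_alt23.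
Qed.

Lemma psih_E i j k l : psih i j k l =
  (i == k)%:R * (j == l)%:R - (i == l)%:R * (j == k)%:R - \sum_p phih i j p * phih k l p.
Proof.
pose gr i : 'rV[R]_7 -> I -> R := fun y => g y i.
pose fr := frame x (christoffel g) E0.
have gd a b : slot fr (fun i => hat1 (gr i) b) a = (a == b)%:R.
  exact: (hat2_g openU sg symg ug Ux FGF).
have sgr i' : smooth1 U (gr i') by move=> ?; exact: sg.
pose pp i j y k l := contract g y (fun p q => phi y i j p * phi y k l q).
have spp i' j' : smooth2 U (pp i' j').
  by move=> k' l'; apply: sC => p q; apply: smoothM => //; exact: sphi.
transitivity (slot fr (fun i => slot fr (fun j => hat1 (gr i) k * hat1 (gr j) l
    - hat1 (gr j) k * hat1 (gr i) l
    - \sum_p hat1 (fun y => phi y i j) p * phih k l p) j) i).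
  apply: eq_slot => i'; apply: eq_slot => j'.
  rewrite (@eq_hat2 _ _ _ openU g _ Ux E0 _
    (fun y k l => gr i' y k * gr j' y l - gr j' y k * gr i' y l - pp i' j' y k l)); last first.
    by move=> y k' l' Uy; rewrite psiE // /gr [g y i' l' * _]mulrC.
  have sM u v : smooth2 U (fun y k l => gr u y k * gr v y l).
    by move=> k' l'; apply: smoothM => //; exact: sg.
  rewrite (hat2D openU g Ux E0) => [|k' l'|k' l'].
  - rewrite (hat2D openU g Ux E0) => [|k' l'|k' l'].
    + rewrite !(hat2N openU g Ux E0) // !(hat2_M openU g Ux E0) //; congr (_ - _ - _).
      transitivity (slot fr (fun k => slot fr (fun l =>
        \sum_p hat1 (fun y => phi y i' j') p * hat1 (fun y => phi y k l) p) l) k).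
        apply: eq_slot => k'; apply: eq_slot => l'.
        rewrite /pp (hj_contractM openU sg symg ug Ux FGF) //; exact: sphi.
      under eq_slot => k' do rewrite slot_sum; rewrite slot_sum; apply: eq_bigr => p _.
      by rewrite -slotZ; apply: eq_slot => k'; rewrite slotZ.
    + exact: (sM _ _ k' l').
    + by apply: smoothN => //; exact: (sM _ _ k' l').
  - by apply: smoothD => //; [exact: (sM _ _ k' l')|apply: smoothN => //; exact: (sM _ _ k' l')].
  - by apply: smoothN => //; exact: (spp _ _ k' l').
rewrite -!gd.
under eq_slot => i' do rewrite !slotB slotZ slotZr.
rewrite !slotB slotZr slotZ [X in _ - X - _]mulrC; congr (_ - _ - _).
under [RHS]eq_bigr => p _ do rewrite -slotZr.
rewrite -[RHS]slot_sum; apply: eq_slot => i'.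
under [RHS]eq_bigr => p _ do rewrite -slotZr.
by rewrite -[RHS]slot_sum.
Qed.

Lemma Vh_E k : Vh k = \sum_i \sum_j phih i j k * Th i j.
Proof.
rewrite (hat1_contract2 openU sg symg ug Ux FGF _ sT sphi).
by apply: eq_bigr => i _; apply: eq_bigr => j _; rewrite mulrC.
Qed.

Let Rm12 := Rh_skew12 openU sg symg ug Ux E0.
Let Rm34 := Rh_skew34 openU sg symg ug Ux FGF.
Let RmB := Rh_Bianchi openU sg symg ug Ux E0.

Lemma hat2_torsion_Ricci a l : hat2 torsion_Ricci a l = pRic Th phih Vh a l.
Proof.
have sN := smooth_RicN; have sRV := smooth_nabla_V.
have sTT := smooth_compose sT sT.
have sN3 : smooth3 U (nabla2 g t) by move=> i j k; exact: smooth_nabla2.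
have str : smooth2 U (fun y a l => trT_ s T c y * t y a l).
  by move=> i j; apply: smoothM => //; exact: smooth_trT.
have sNV : smooth2 U (fun y i j => - nabla1 g V y i j) by move=> i j; exact: smoothN.
have sNTT : smooth2 U (fun y i j => - compose g t t y i j) by move=> i j; exact: smoothN.
rewrite /torsion_Ricci !(hat2D openU g Ux E0) //; try by move=> i j; repeat apply: smoothD.
rewrite !(hat2N openU g Ux E0) // (hat2Mf openU g Ux E0) //; last exact: smooth_trT.
rewrite -(jshift_hat1 openU sg ug Ux) // /pRic.
rewrite (hat2_compose openU sg symg ug Ux FGF) //.
rewrite (hat2_contract3 openU sg symg ug Ux FGF) //.
rewrite [hj (trT_ _ _ _)](hjet_contract openU sg symg ug Ux FGF) //.
congr (_ + _ - _ + _); apply: eq_bigr => b _; apply: eq_bigr => m _.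
by rewrite -(jshift_hat2 openU sg ug Ux) // mulrC.
Qed.

Lemma hat2_Ricci_eval a l : jeval (hat2 (Ricci g) a l) = jeval (hat2 torsion_Ricci a l).
Proof.
rewrite hat2_torsion_Ricci -(jeval_Ric phih_nil phih_D psih_E Vh_E Rm12 Rm34 RmB).
  by rewrite (hat2_Ricci openU sg symg ug Ux FGF).
by move=> a' b' i j k; exact: (jcomm_hat3 openU sg symg ug Ux FGF).
Qed.

Lemma hat2_torsion_Ricci_sym a l :
  jeval (hat2 torsion_Ricci a l) = jeval (hat2 (fun y i j => torsion_Ricci y j i) a l).
Proof.
rewrite [in RHS]hat2_tr !hat2_torsion_Ricci (jeval_Ric_sym phih_nil phih_D psih_E Vh_E Rm12 Rm34 RmB) //.
by move=> a' b' i j k; exact: (jcomm_hat3 openU sg symg ug Ux FGF).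
Qed.

End Point.

(** At each point the formula holds in an adapted frame; being tensorial it holds
    in the chart, where it can be differentiated. *)
Lemma RicciE y i j : U y -> Ricci g y i j = torsion_Ricci y i j.
Proof.
move=> Uy; have [F [FGF Fphi _]] := g2_frame s Uy.
exact: (hat2_inj FGF (hat2_Ricci_eval Uy FGF Fphi)).
Qed.

(** The symmetry of the Ricci tensor, which is not apparent from the formula,
    becomes an identity of jets in [pRic_sym]. *)
Lemma torsion_Ricci_sym y i j : U y -> torsion_Ricci y i j = torsion_Ricci y j i.
Proof.
move=> Uy; have [F [FGF Fphi _]] := g2_frame s Uy.
exact: (hat2_inj FGF (hat2_torsion_Ricci_sym Uy FGF Fphi)).
Qed.

End Torsion.

(** * The Bianchi-type identity *)

Section BianchiIdentity.
Variables (R : realType) (M : manifold R 7) (s : g2_structure M) (T : tensor_field M 2).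
Hypothesis HT : is_torsion s T.
Variable c : atlas_index M.
Local Notation U := (coord_dom c).
Local Notation g := (g_ s c).
Local Notation phi := (phi_ s c).
Local Notation psi := (psi_ s c).
Local Notation t := (T_ T c).
Local Notation V := (VT_ s T c).
Local Notation I := 'I_7.
Local Notation J := (jet R I).
Let openU : open U := @open_chart R M c.
Let sg := @smooth_metric R M s c.
Let ug := @metric_unit R M s c.
Let symg := @metric_sym R M s c.
Let sphi : smooth3 U phi := @smooth_phi R M s c.
Let spsi : smooth4 U psi := @smooth_psi R M s c.

Let sT := @smooth_T R M T c.
Let sC := smooth_contract openU sg ug.
Let sV := @smooth_V R M s T c.
Local Notation S := (compose g t (interior_phi s c V)).
Local Notation P1 := (Ptilde1 s T c).
Local Notation X := (P2 s T c).

Lemma smooth_S : smooth2 U S.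
Proof.
apply: smooth_compose => // j k; apply: sC => i i'; smooth.
Qed.

Lemma smooth_norms : smooth_on U (norm2_2 g t) /\ smooth_on U (norm2_1 g V).
Proof.
split; apply: sC => i i'; last exact: smoothM.
by apply: sC => j j'; exact: smoothM.
Qed.

(** [18 (Ptilde1 + Ric)], as a tensor field without denominators. *)
Definition nonRicci y (i j : I) : R :=
  - (6 * (nabla1 g V y i j + nabla1 g V y j i)) - 6 * (S y i j + S y j i)
  + 9 * (trT_ s T c y * (t y i j + t y j i))
  + g y i j * (6 * norm2_2 g t y - 2 * norm2_1 g V y).

Lemma Ptilde1E y i j : U y -> P1 y i j = 18^-1 * (nonRicci y i j - 18 * Ricci g y i j).
Proof.
move=> Uy; rewrite /Ptilde1 (lie_metricE openU) // /sym /nonRicci.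
move: (Ricci _ _ _ _) (nabla1 _ _ _ _ _) (nabla1 _ _ _ _ _) (compose _ _ _ _ _ _) (compose _ _ _ _ _ _)
  (trT_ _ _ _ _) (T_ _ _ _ _ _) (T_ _ _ _ _ _) (norm2_2 _ _ _) (norm2_1 _ _ _) (g_ _ _ _ _ _).
by move=> *; field.
Qed.

Lemma P2E y k : X y k = 3^-1 * (2 * div g t y k + grad (trT_ s T c) y k + trT_ s T c y * V y k).
Proof.
rewrite /P2; move: (div _ _ _ _) (grad _ _ _) (trT_ _ _ _ _) (VT_ _ _ _ _ _).
by move=> *; field.
Qed.

Lemma smooth_div A : smooth2 U A -> smooth1 U (div g A).
Proof. by move=> sA k; apply: sC => a b; exact: smooth_nabla2. Qed.

Lemma smooth_grad f : smooth_on U f -> smooth1 U (grad f).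
Proof. by move=> sf k; exact: smooth_partial. Qed.

Lemma smooth_curl Y : smooth1 U Y -> smooth1 U (curl s c Y).
Proof.
move=> sY k; apply: sC => a a'; apply: sC => b b'; smooth.
exact: smooth_nabla1.
Qed.

Lemma smooth_Pop A : smooth2 U A -> smooth2 U (Pop s c A).
Proof.
move=> sA i j; apply: sC => a a'; apply: sC => b b'; smooth.
Qed.

Lemma smooth_interior2 Y A : smooth1 U Y -> smooth2 U A -> smooth1 U (interior2 g Y A).
Proof. by move=> sY sA k; apply: sC => a a'; exact: smoothM. Qed.

Lemma smooth_apply A Y : smooth2 U A -> smooth1 U Y -> smooth1 U (apply g A Y).
Proof. by move=> sY sA k; apply: sC => a a'; exact: smoothM. Qed.

Lemma smooth_nonRicci : smooth2 U nonRicci.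
Proof.
have [s1 s2] := smooth_norms; have sn := @smooth_nabla_V R M s T c.
have str := @smooth_trT R M s T c; have sS := smooth_S.
move=> i j; rewrite /nonRicci; smooth.
Qed.

Lemma smooth_P1 : smooth2 U P1.
Proof.
move=> i j; apply: (eq_smooth_on openU (f := fun y => 18^-1 * (nonRicci y i j - 18 * Ricci g y i j))).
  by move=> y Uy; rewrite Ptilde1E.
have sN := smooth_nonRicci; have sR := @smooth_Ricci R M s c; smooth.
Qed.

Lemma smooth_P2 : smooth1 U X.
Proof.
move=> k; apply: (eq_smooth_on openU (f := fun y => 3^-1 * (2 * div g t y k
  + grad (trT_ s T c) y k + trT_ s T c y * V y k))).
  by move=> y Uy; rewrite P2E.
have str := @smooth_trT R M s T c; have sd := smooth_div sT; have sgr := smooth_grad str; smooth.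
Qed.

Lemma div_traceless h x k : smooth2 U h -> U x ->
  div g (fun y i j => h y i j - trace g h y / 4 * g y i j) x k =
  div g h x k - 4^-1 * grad (trace g h) x k.
Proof.
move=> sh Ux; have [F FGF] := metric_frame s Ux.
apply: (hat1_inj FGF (X := div g _) (Y := fun y k => div g h y k - 4^-1 * grad (trace g h) y k)).
move=> a; rewrite (hat1_div_traceless openU sg symg ug Ux FGF) //.
have sd := smooth_div sh; have st := smooth_grad (sC sh).
rewrite (hat1D openU g Ux F) // => [|i]; last by smooth.
rewrite (hat1N openU g Ux F) => [|i]; last by smooth.
by rewrite (hat1Z openU g Ux F).
Qed.

Section Point.
Variable x : 'rV[R]_7.
Hypothesis Ux : U x.
Variable E0 : 'M[R]_7.
Hypothesis FGF : E0 *m g x *m E0^T = 1%:M.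
Hypothesis Fphi : forall i j k, slot3 E0 (phi x) i j k = zR R (phi0 i j k).
Local Notation hj := (hjet x (christoffel g) E0).
Local Notation hat1 := (hat1 g x E0).
Local Notation hat2 := (hat2 g x E0).
Local Notation hat3 := (hat3 g x E0).
Local Notation hat4 := (hat4 g x E0).
Local Notation Th := (hat2 t).
Local Notation phih := (hat3 phi).
Local Notation psih := (hat4 psi).
Local Notation Vh := (hat1 V).

Lemma hat2_RicciE a b : hat2 (Ricci g) a b = pRic Th phih Vh a b.
Proof.
rewrite -(hat2_torsion_Ricci T Ux FGF); apply: (@eq_hat2 _ _ _ openU g _ Ux E0).
by move=> y i j; exact: (RicciE HT).
Qed.

Lemma pRic_sym a b : pRic Th phih Vh a b = pRic Th phih Vh b a.
Proof.
rewrite -!(hat2_torsion_Ricci T Ux FGF) -[RHS]hat2_tr.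
by apply: (@eq_hat2 _ _ _ openU g _ Ux E0) => y i j; exact: (torsion_Ricci_sym HT).
Qed.

Lemma jcst_nat m : jcst m%:R = m%:R :> J.
Proof. exact: (rmorph_nat (@jcst R I)). Qed.

Lemma jshiftZ a z (f : J) : jshift a (jcst z * f) = jcst z * jshift a f.
Proof. by rewrite jshiftM jshift_cst mul0r add0r. Qed.

Lemma hat2_tr_sum A a b : smooth2 U A ->
  hat2 (fun y i j => A y i j + A y j i) a b = hat2 A a b + hat2 A b a.
Proof.
by move=> sA; rewrite (hat2D openU g Ux E0) // [X in _ + X]hat2_tr.
Qed.

Lemma hat2_nonRicci a b : hat2 nonRicci a b = pN Th phih Vh a b.
Proof.
have [s1 s2] := smooth_norms; have sn := @smooth_nabla_V R M s T c.
have str := @smooth_trT R M s T c; have sS := smooth_S.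
have symm A : smooth2 U A -> smooth2 U (fun y i j => A y i j + A y j i).
  by move=> sA i j; smooth.
have snn := symm _ sn; have sSS := symm _ sS; have sTT := symm _ sT.
pose f y := 6 * norm2_2 g t y - 2 * norm2_1 g V y.
have sf : smooth_on U f by rewrite /f; smooth.
have sTr : smooth2 U (fun y i j => trT_ s T c y * (t y i j + t y j i)).
  by move=> i j; smooth.
have S6 A (z : R) : smooth2 U A -> smooth2 U (fun y i j => z * A y i j).
  by move=> sA i j; smooth.
have SN A : smooth2 U A -> smooth2 U (fun y i j => - A y i j) by move=> sA i j; smooth.
have SD A B : smooth2 U A -> smooth2 U B -> smooth2 U (fun y i j => A y i j + B y i j).
  by move=> sA sB i j; smooth.
have sgf : smooth2 U (fun y i j => f y * g y i j) by move=> i j; smooth.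
transitivity (hat2 (fun y i j => - (6 * (nabla1 g V y i j + nabla1 g V y j i))
   + - (6 * (S y i j + S y j i)) + 9 * (trT_ s T c y * (t y i j + t y j i)) + f y * g y i j) a b).
  apply: (@eq_hat2 _ _ _ openU g _ Ux E0) => y i j _; rewrite /nonRicci.
  by congr (_ + _); exact: mulrC.
have s6n := S6 _ 6 snn; have s6S := S6 _ 6 sSS; have s9 := S6 _ 9 sTr.
have n6n := SN _ s6n; have n6S := SN _ s6S; have d1 := SD _ _ n6n n6S; have d2 := SD _ _ d1 s9.
rewrite (hat2D openU g Ux E0 _ _ d2 sgf) (hat2D openU g Ux E0 _ _ d1 s9).
rewrite (hat2D openU g Ux E0 _ _ n6n n6S).
rewrite (hat2N openU g Ux E0 _ _ s6n) (hat2N openU g Ux E0 _ _ s6S).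
rewrite (hat2Z openU g Ux E0 _ _ _ snn) (hat2Z openU g Ux E0 _ _ _ sSS).
rewrite (hat2Z openU g Ux E0 _ _ _ sTr) !jcst_nat (hat2Mf openU g Ux E0 _ _ str sTT).
rewrite !hat2_tr_sum // (hat2Mf openU g Ux E0 _ _ sf sg).
rewrite -!(jshift_hat1 openU sg ug Ux) //.
rewrite (hat2_g openU sg symg ug Ux FGF) [hj (trT_ _ _ _)](hjet_contract openU sg symg ug Ux FGF) //.
have SE a' b' : hat2 S a' b' = pS Th phih Vh a' b'.
  rewrite (hat2_compose openU sg symg ug Ux FGF) //; last first.
    by move=> i j; apply: sC => p q; smooth.
  apply: eq_bigr => p _; congr (_ * _); rewrite (hat2_interior3 openU sg symg ug Ux FGF) //.
  by apply: eq_bigr => i _; rewrite mulrC.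
have fE : hj f = 6%:R * (\sum_i \sum_j Th i j * Th i j) - 2%:R * \sum_i Vh i * Vh i.
  rewrite (hjetB openU Ux) //; try by smooth.
  rewrite !(hjetZ openU Ux) // !jcst_nat.
  rewrite (hj_contract2M openU sg symg ug Ux FGF) //.
  by rewrite (hj_contractM openU sg symg ug Ux FGF).
by rewrite !SE fE /pN [X in _ + X]mulrC.
Qed.

Lemma hat1_P2 k : hat1 X k = jcst 3^-1 * pX Th Vh k.
Proof.
have str := @smooth_trT R M s T c; have sd := smooth_div sT; have sgr := smooth_grad str.
have s2d : smooth1 U (fun y k => 2 * div g t y k) by move=> i; smooth.
have s2g : smooth1 U (fun y k => 2 * div g t y k + grad (trT_ s T c) y k) by move=> i; smooth.
have stV : smooth1 U (fun y k => trT_ s T c y * V y k) by move=> i; smooth.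
have sum : smooth1 U (fun y k => 2 * div g t y k + grad (trT_ s T c) y k + trT_ s T c y * V y k).
  by move=> i; smooth.
transitivity (hat1 (fun y k => 3^-1 * (2 * div g t y k + grad (trT_ s T c) y k
    + trT_ s T c y * V y k)) k).
  by apply: (@eq_hat1 _ _ _ openU g _ Ux E0) => y i _; exact: P2E.
rewrite (hat1Z openU g Ux E0 _ _ sum) (hat1D openU g Ux E0 _ s2g stV).
rewrite (hat1D openU g Ux E0 _ s2d sgr) (hat1Z openU g Ux E0 _ _ sd) jcst_nat hat1_grad.
rewrite (hat1M openU g Ux E0 _ str sV) (hat1_div openU sg symg ug Ux FGF) //.
by rewrite [hj (trT_ _ _ _)](hjet_contract openU sg symg ug Ux FGF).
Qed.

Lemma hat2_P1 a b : hat2 P1 a b = jcst 18^-1 * (pN Th phih Vh a b - 18%:R * pRic Th phih Vh a b).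
Proof.
have sN := smooth_nonRicci; have sR := @smooth_Ricci R M s c.
have s18 : smooth2 U (fun y i j => 18 * Ricci g y i j) by move=> i j; smooth.
have sn18 : smooth2 U (fun y i j => - (18 * Ricci g y i j)) by move=> i j; smooth.
have sum : smooth2 U (fun y i j => nonRicci y i j - 18 * Ricci g y i j) by move=> i j; smooth.
transitivity (hat2 (fun y i j => 18^-1 * (nonRicci y i j - 18 * Ricci g y i j)) a b).
  by apply: (@eq_hat2 _ _ _ openU g _ Ux E0) => y i j Uy; exact: Ptilde1E.
rewrite (hat2Z openU g Ux E0 _ _ _ sum) (hat2D openU g Ux E0 _ _ sN sn18).
rewrite (hat2N openU g Ux E0 _ _ s18) (hat2Z openU g Ux E0 _ _ _ sR) jcst_nat.
by rewrite hat2_nonRicci hat2_RicciE.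
Qed.

Lemma hat1_Bianchi k :
  hat1 (fun y k => div g P1 y k - 4^-1 * grad (trace g P1) y k + 2^-1 * curl s c X y k
         - 2^-1 * interior2 g X (Pop s c t) y k - apply g t X y k) k =
  jcst 72^-1 * pBianchi Th phih psih Vh k.
Proof.
have sP1 := smooth_P1; have sP2 := smooth_P2.
have sd := smooth_div sP1; have st := smooth_grad (sC sP1); have sc := smooth_curl sP2.
have sPop := smooth_Pop sT; have si := smooth_interior2 sP2 sPop; have sa := smooth_apply sT sP2.
have SZ z Y : smooth1 U Y -> smooth1 U (fun y k => z * Y y k) by move=> sY i; smooth.
have SN Y : smooth1 U Y -> smooth1 U (fun y k => - Y y k) by move=> sY i; smooth.
have SD Y Z : smooth1 U Y -> smooth1 U Z -> smooth1 U (fun y k => Y y k + Z y k).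
  by move=> sY sZ i; smooth.
have s1 := SZ 4^-1 _ st; have n1 := SN _ s1; have d1 := SD _ _ sd n1.
have s2 := SZ 2^-1 _ sc; have d2 := SD _ _ d1 s2.
have s3 := SZ 2^-1 _ si; have n3 := SN _ s3; have d3 := SD _ _ d2 n3; have n4 := SN _ sa.
rewrite (hat1D openU g Ux E0 _ d3 n4) (hat1D openU g Ux E0 _ d2 n3) (hat1D openU g Ux E0 _ d1 s2).
rewrite (hat1D openU g Ux E0 _ sd n1) (hat1N openU g Ux E0 _ s1) (hat1N openU g Ux E0 _ s3).
rewrite (hat1N openU g Ux E0 _ sa) (hat1Z openU g Ux E0 _ _ st) (hat1Z openU g Ux E0 _ _ sc).
rewrite (hat1Z openU g Ux E0 _ _ si).
have divE : hat1 (div g P1) k = jcst 18^-1 * (\sum_a jshift a (pN Th phih Vh a k)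
    - \sum_a jshift a (12%:R * pRic Th phih Vh k a + 6%:R * pRic Th phih Vh a k)).
  rewrite (hat1_div openU sg symg ug Ux FGF) // -sumrB mulr_sumr; apply: eq_bigr => a _.
  rewrite hat2_P1 jshiftZ -jshiftB [pRic _ _ _ k a]pRic_sym.
  congr (_ * jshift a (_ - _)); rewrite -mulrDl; congr (_ * _).
  by rewrite -natrD.
have gradE : hat1 (grad (trace g P1)) k = jcst 18^-1 *
    jshift k (\sum_a pN Th phih Vh a a - 18%:R * pScal Th psih Vh).
  rewrite hat1_grad -jshiftZ; congr (jshift k _).
  rewrite [LHS](hjet_contract openU sg symg ug Ux FGF) //.
  rewrite -(pRic_trace (phih_D HT Ux FGF) (phih_12 s Ux E0) (phih_23 s Ux E0) (Vh_E T Ux FGF)).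
  by rewrite mulr_sumr -sumrB mulr_sumr; apply: eq_bigr => a _; exact: hat2_P1.
have curlE : hat1 (curl s c X) k = jcst 3^-1 * \sum_a \sum_b phih a b k * jshift a (pX Th Vh b).
  rewrite (hat1_contract2 openU sg symg ug Ux FGF) //; last first.
    by move=> i j; exact: smooth_nabla1.
  rewrite mulr_sumr; apply: eq_bigr => a _; rewrite mulr_sumr; apply: eq_bigr => b _.
  by rewrite -(jshift_hat1 openU sg ug Ux) // hat1_P2 jshiftZ -mulrA; congr (_ * _); exact: mulrC.
have intE : hat1 (interior2 g X (Pop s c t)) k =
    jcst 3^-1 * \sum_i pX Th Vh i * pP Th psih i k.
  rewrite (hat1_interior2 openU sg symg ug Ux FGF) // mulr_sumr; apply: eq_bigr => i _.
  rewrite hat1_P2 -mulrA; congr (_ * (_ * _)).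
  rewrite (hat2_contract2 openU sg symg ug Ux FGF) //.
  by apply: eq_bigr => a _; apply: eq_bigr => b _; rewrite mulrC.
have appE : hat1 (apply g t X) k = jcst 3^-1 * \sum_j Th k j * pX Th Vh j.
  rewrite (hat1_apply openU sg symg ug Ux FGF) // mulr_sumr; apply: eq_bigr => j _.
  by rewrite hat1_P2 mulrCA.
rewrite divE gradE curlE intE appE /pBianchi.
(* All constants are integral multiples of 1/72. *)
have z18 : jcst 18^-1 = 4%:R * jcst 72^-1 :> J by rewrite -jcst_nat -rmorphM; congr jcst; field.
have z4 : jcst 4^-1 * jcst 18^-1 = jcst 72^-1 :> J by rewrite -rmorphM; congr jcst; field.
have z3 : jcst 3^-1 = 24%:R * jcst 72^-1 :> J by rewrite -jcst_nat -rmorphM; congr jcst; field.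
have z2 : jcst 2^-1 * jcst 3^-1 = 12%:R * jcst 72^-1 :> J.
  by rewrite -jcst_nat -!rmorphM; congr jcst; field.
have aux (q A B D C E F : J) : 4%:R * q * (A - B) - q * D + 12%:R * q * C - 12%:R * q * E
    - 24%:R * q * F =
    q * (4%:R * (A - B) - D + 12%:R * C - 12%:R * E - 24%:R * F) by ring.
rewrite (mulrA (jcst 4^-1)) !(mulrA (jcst 2^-1)) z4 z2 z18 z3; exact: aux.
Qed.

End Point.

Lemma Bianchi_identity x k : U x -> Btilde s T c P1 X x k = 0.
Proof.
move=> Ux; have [F [FGF Fphi _]] := g2_frame s Ux.
rewrite /Btilde /Lop div_traceless //; last exact: smooth_P1.
pose B y k := div g P1 y k - 4^-1 * grad (trace g P1) y k + 2^-1 * curl s c X y k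
         - 2^-1 * interior2 g X (Pop s c t) y k - apply g t X y k.
apply: (hat1_inj FGF (X := B) (Y := fun _ _ => 0)) => a.
have -> : jeval (hat1 g x F (fun _ _ => 0) a) = 0.
  by rewrite jeval_slot big1 // => i _; rewrite [jeval _]hjet_nil mulr0.
rewrite (hat1_Bianchi Ux FGF) rmorphM /=.
rewrite (pBianchi0 (phih_nil Fphi) (phih_D HT Ux FGF) (psih_E Ux FGF) (Vh_E T Ux FGF)
  (Rm := Rh g x F)) ?mulr0 //.
- exact: (Rh_skew12 openU sg symg ug Ux F).
- exact: (Rh_skew34 openU sg symg ug Ux FGF).
- exact: (Rh_Bianchi openU sg symg ug Ux F).
- by move=> a' b i j l; exact: (jcomm_hat3 openU sg symg ug Ux FGF).
- by move=> a' b i j; exact: (jcomm_hat2 openU sg symg ug Ux FGF).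
- by move=> a' b i; exact: (jcomm_hat1 openU sg symg ug Ux FGF).
Qed.

End BianchiIdentity.

Theorem corollary4p8 (R : realType) (M : manifold R 7) (s : g2_structure M)
    (T : tensor_field M 2) (HT : is_torsion s T) :
  (forall (h : tensor_field M 2) (X : tensor_field M 1),
     symmetric_tensor h ->
     forall (c : atlas_index M) (x : 'rV[R]_7) (k : 'I_7),
       coord_dom c x ->
       Btilde s T c (comp2 h c) (comp1 X c) x k
       = div (g_ s c) (comp2 h c) x k
         - 4^-1 * grad (trace (g_ s c) (comp2 h c)) x k
         + 2^-1 * curl s c (comp1 X c) x k
         - 2^-1 * interior2 (g_ s c) (comp1 X c) (Pop s c (T_ T c)) x k
         - apply (g_ s c) (T_ T c) (comp1 X c) x k) /\
  (forall c : atlas_index M,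
     satisfies_Bianchi s T c (Ptilde s T c) (Ptilde1 s T c) (P2 s T c)).
Proof.
split=> [h X _ c x k Ux|c x Ux].
  rewrite /Btilde /Lop div_traceless // => i j; exact: comp_smooth.
by split=> // k; exact: Bianchi_identity.
Qed.
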